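(* Let $C_0\in \mathrm{Sym}^+(\mathcal H)\cap \mathrm{Tr}(\mathcal H)$ with $\ker(C_0)=\{0\}$, and let $\mu_0=\mathcal N(0,C_0)$. For $S\in \mathrm{SymHS}(\mathcal H)_{<I}$ let $\mu=\mu(S)=\mathcal N(0,C)$ with $C=C_0^{1/2}(I-S)C_0^{1/2}$. Let $S_*\in \mathrm{SymHS}(\mathcal H)_{<I}$ be fixed but arbitrary, let $C_*=C_0^{1/2}(I-S_* )C_0^{1/2}$ and $\mu_*=\mathcal N(0,C_* )$. Denote by $D\log\left\{\frac{d\mu}{d\mu_0}(x)\right\}(S)(V)$ the Fréchet derivative at $S$ in the direction $V$ of the map $\mathrm{SymHS}(\mathcal H)_{<I}\to \mathcal L^2(\mathcal H,\mu_* )$, $S\mapsto \log\left\{\frac{d\mu(S)}{d\mu_0}\right\}$. Then this derivative exists and satisfies the following. 1. If $S_*\in \mathrm{SymTr}(\mathcal H)_{<I}$ and $V\in \mathrm{Sym}(\mathcal H)\cap \mathrm{Tr}(\mathcal H)$, then $$D\log\left\{\frac{d\mu}{d\mu_0}(x)\right\}(S_* )(V)=\frac12\mathrm{tr}[(I-S_* )^{-1}V]-\frac12\langle C_0^{-1/2}x,(I-S_* )^{-1}V(I-S_* )^{-1}C_0^{-1/2}x\rangle,$$ where $\langle C_0^{-1/2}x,(I-S_* )^{-1}V(I-S_* )^{-1}C_0^{-1/2}x\rangle$ denotes $\lim_{N\to\infty}\langle C_0^{-1/2}P_Nx,(I-S_* )^{-1}V(I-S_* )^{-1}C_0^{-1/2}P_Nx\rangle$,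 the limit being taken in $\mathcal L^2(\mathcal H,\mu_0)$; here $P_N=\sum_{k=1}^N e_k\otimes e_k$ and $\{e_k\}_{k\in\mathbb N}$ are the orthonormal eigenvectors of $C_0$. 2. If $S_*\in \mathrm{SymHS}(\mathcal H)_{<I}$ and $\{S_k\}_{k\in\mathbb N}\subset \mathrm{SymTr}(\mathcal H)_{<I}$ is such that $\lim_{k\to\infty}\|S_k-S_*\|_{\mathrm{HS}}=0$, then for every $V\in \mathrm{Sym}(\mathcal H)\cap \mathrm{Tr}(\mathcal H)$, with the limit taken in $\mathcal L^2(\mathcal H,\mu_* )$, $$D\log\left\{\frac{d\mu}{d\mu_0}(x)\right\}(S_* )(V)=\lim_{k\to\infty}D\log\left\{\frac{d\mu}{d\mu_0}(x)\right\}(S_k)(V).$$ 3. If $S_*\in \mathrm{SymHS}(\mathcal H)_{<I}$, $V\in \mathrm{Sym}(\mathcal H)\cap \mathrm{HS}(\mathcal H)$, and $\{V_j\}_{j\in\mathbb N}\subset \mathrm{Sym}(\mathcal H)\cap \mathrm{Tr}(\mathcal H)$ is such that $\lim_{j\to\infty}\|V_j-V\|_{\mathrm{HS}}=0$, then, with the limit taken in $\mathcal L^2(\mathcal H,\mu_* )$, $$D\log\left\{\frac{d\mu}{d\mu_0}(x)\right\}(S_* )(V)=\lim_{j\to\infty}D\log\left\{\frac{d\mu}{d\mu_0}(x)\right\}(S_* )(V_j).$$ Furthermore, for any $S_*\in \mathrm{SymHS}(\mathcal H)_{<I}$ and any $V\in \mathrm{Sym}(\mathcal H)\cap \mathrm{HS}(\mathcal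 H)$, $$\left\|D\log\left\{\frac{d\mu}{d\mu_0}(x)\right\}(S_* )(V)\right\|^2_{\mathcal L^2(\mathcal H,\mu_* )}=\frac12\|(I-S_* )^{-1/2}V(I-S_* )^{-1/2}\|^2_{\mathrm{HS}},$$ and for any $V,W\in \mathrm{Sym}(\mathcal H)\cap \mathrm{HS}(\mathcal H)$, $$\left\langle D\log\left\{\frac{d\mu}{d\mu_0}(x)\right\}(S_* )(V),\,D\log\left\{\frac{d\mu}{d\mu_0}(x)\right\}(S_* )(W)\right\rangle_{\mathcal L^2(\mathcal H,\mu_* )}=\frac12\mathrm{tr}[(I-S_* )^{-1}V(I-S_* )^{-1}W].$$
   Context: $\mathcal H$ is a real separable Hilbert space with $\dim\mathcal H=\infty$. $\mathrm{Sym}(\mathcal H)$, $\mathrm{Sym}^+(\mathcal H)$ are the bounded self-adjoint, resp. self-adjoint positive (i.e. $\langle Ax,x\rangle\ge 0$) operators on $\mathcal H$; $\mathrm{Tr}(\mathcal H)$ and $\mathrm{HS}(\mathcal H)$ are the trace class and Hilbert-Schmidt operators, $\|\cdot\|_{\mathrm{HS}}$ the Hilbert-Schmidt norm. $A>0$ means $A$ self-adjoint and $\langle x,Ax\rangle>0$ for all $x\neq0$ (for $A=I-S$ with $S$ compact this implies that $A$ is invertible). $\mathrm{SymHS}(\mathcal H)_{<I}=\{S\in \mathrm{Sym}(\mathcal H)\cap \mathrm{HS}(\mathcal H): I-S>0\}$, an open subset of the Hilbert space $\mathrm{Sym}(\mathcal H)\cap\mathrm{HS}(\mathcal H)$; $\mathrm{SymTr}(\mathcal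 H)_{<I}=\{S\in \mathrm{Sym}(\mathcal H)\cap \mathrm{Tr}(\mathcal H): I-S>0\}$. $\mathcal N(0,C)$ is the centered Gaussian measure on $\mathcal H$ with covariance operator $C$. By the Feldman-Hajek theorem, for $S\in \mathrm{SymHS}(\mathcal H)_{<I}$ the measures $\mathcal N(0,C_0^{1/2}(I-S)C_0^{1/2})$ and $\mathcal N(0,C_0)$ are equivalent, and $\frac{d\mu}{d\mu_0}$ is the Radon-Nikodym density; $\log\frac{d\mu}{d\mu_0}$ belongs to $\mathcal L^2(\mathcal H,\mu_* )$. $(a\otimes b)x=\langle b,x\rangle a$. *)

(* Defs.v *)
From HB Require Import structures.
From mathcomp Require Import all_boot all_order all_algebra.
From mathcomp Require Import all_classical all_reals all_analysis.
From mathcomp Require Import measurable_realfun ess_sup_inf ring lra.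
Set Implicit Arguments.
Unset Strict Implicit.
Unset Printing Implicit Defensive.
Import Order.TTheory GRing.Theory Num.Theory.
Import numFieldNormedType.Exports.
Local Open Scope classical_set_scope.
Local Open Scope ring_scope.

(* The L^p space of the library is only a type of classes of functions; it is
   made a normed module for the L^p norm. *)
Section Lspace_normed.
Context d (T : measurableType d) (R : realType).
Variables (mu : {measure set T -> \bar R}) (p : \bar R) (p1 : (1 <= p)%E).
Local Notation Lp := (LspaceType mu p1).
Implicit Types (f g h : T -> R) (u v w : Lp).

(* a representative *)
Definition Lspace_fun u : T -> R := u.

Lemma Lspace_eq u v : Lspace_fun u = Lspace_fun v %[ae mu] -> u = v.
Proof.
rewrite /Lspace_fun; case: u => u [[hu]]; case: v => v [[hv]] /= uv.
have {}uv : u = v.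
  by rewrite -[u]reprK -[v]reprK; apply/eqP; rewrite piE; apply/asboolP.
subst v; by rewrite (Prop_irrelevance hu hv).
Qed.

Lemma Lspace_funP u : Lspace_fun u \in Lfun mu p.
Proof.
rewrite /Lspace_fun; apply/andP; split; rewrite inE/=; last first.
  exact: Lebesgue_finite.
exact: (@measurable_funPT _ _ _ _ (repr (LebesgueSpace.sort u))).
Qed.

Lemma Lfun_measurable f : f \in Lfun mu p -> measurable_fun setT f.
Proof. by move=> /andP[/set_mem]. Qed.

Lemma Lfun_finite f : f \in Lfun mu p -> ('N[mu]_p[EFin \o f]%E < +oo)%E.
Proof. by move=> /andP[_ /set_mem]. Qed.

Lemma Lnorm_ae0 f : measurable_fun setT f -> f = \0 %[ae mu] ->
  'N[mu]_p[EFin \o f]%E = 0%E.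
Proof.
move=> mf f0; rewrite unlock; case: p p1 => [r|_|].
- rewrite lee_fin => r1.
  have r0 : r != 0 by rewrite gt_eqF// (lt_le_trans _ r1).
  rewrite (_ : \int[mu]_x _ = 0)%E; last first.
    rewrite (ae_eq_integral (cst 0%E))//= ?integral0//.
      apply/measurable_EFinP; apply: (measurableT_comp (measurable_powR r)).
      exact: measurableT_comp.
    by apply: filterS f0 => x /(_ I) /= -> _; rewrite normr0 powR0.
  by rewrite poweR0r// invr_eq0.
- case: ifPn => // mu0; apply: ess_sup_ae_cst => //.
  by apply: filterS f0 => x /(_ I) /= ->; rewrite normr0.
- by rewrite leeNy_eq.
Qed.

Let Lnorm_ae_le f g : measurable_fun setT f -> measurable_fun setT g ->
  f = g %[ae mu] -> ('N[mu]_p[EFin \o f]%E <= 'N[mu]_p[EFin \o g]%E)%E.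
Proof.
move=> mf mg fg.
have -> : f = g \+ (f \- g) by apply/funext => x /=; rewrite addrC subrK.
apply: (le_trans (eminkowski _ mg _ p1)); first exact: measurable_funB.
rewrite [X in (_ + X)%E]Lnorm_ae0 ?adde0//; first exact: measurable_funB.
by apply: filterS fg => x /(_ I) /= -> _; rewrite subrr.
Qed.

Lemma Lnorm_ae f g : measurable_fun setT f -> measurable_fun setT g ->
  f = g %[ae mu] -> 'N[mu]_p[EFin \o f]%E = 'N[mu]_p[EFin \o g]%E.
Proof.
move=> mf mg fg; apply/eqP; rewrite eq_le !Lnorm_ae_le//.
exact: ae_eq_sym.
Qed.

HB.instance Definition _ := gen_eqMixin Lp.
HB.instance Definition _ := gen_choiceMixin Lp.

(* [measurableTypeR R], used by [LspaceType], and [R] carry the same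
   sigma-algebra under distinct displays *)
Let mk_mfun f (mf : measurable_fun setT f) :
    {mfun T >-> measurableTypeR R} :=
  MeasurableFun.Pack (MeasurableFun.Class
    (isMeasurableFun.Build _ _ T (measurableTypeR R) f mf)).

Let mk_fun f (fP : f \in Lfun mu p) : {mfun_ mu, T >-> measurableTypeR R} :=
  (\pi_{mfun_ mu, T >-> measurableTypeR R} (mk_mfun (Lfun_measurable fP)))%qT.

Let mk_funE f (fP : f \in Lfun mu p) : (mk_fun fP : T -> R) = f %[ae mu].
Proof.
rewrite /mk_fun /aqEqMfun_to_fun; case: piP => g /eqmodP /asboolP.
exact: ae_eq_sym.
Qed.

Let mk_finite f (fP : f \in Lfun mu p) : finite_norm mu p (mk_fun fP).
Proof.
rewrite /finite_norm (Lnorm_ae _ (Lfun_measurable fP) (mk_funE fP)).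
  exact: Lfun_finite.
exact: (@measurable_funPT _ _ _ _ (repr (mk_fun fP))).
Qed.

Let mk f (fP : f \in Lfun mu p) : Lp :=
  LebesgueSpace.Pack (LebesgueSpace.Class
    (isFinLebesgue.Build d T R mu p p1 (mk_fun fP) (mk_finite fP))).

Let Lfun0 : (fun=> 0) \in Lfun mu p.
Proof. exact: (Lfun_submod_closed mu p1).1. Qed.

Let LfunD f g : f \in Lfun mu p -> g \in Lfun mu p ->
  (fun x => f x + g x) \in Lfun mu p.
Proof. exact: (Lfun_addr_closed mu p1).2. Qed.

Let LfunZ (a : R) f : f \in Lfun mu p -> (fun x => a * f x) \in Lfun mu p.
Proof.
move=> fP; have := (Lfun_submod_closed mu p1).2 a f _ fP Lfun0.
by rewrite (_ : _ + _ = fun x => a * f x)//; apply/funext => x; exact: addr0.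
Qed.

Let mk0 := mk Lfun0.

(* the class of [f]; junk value 0 when [f] is not in L^p *)
Definition to_Lspace f : Lp :=
  if pselect (f \in Lfun mu p) is left fP then mk fP else mk0.

Lemma to_LspaceE f : f \in Lfun mu p -> Lspace_fun (to_Lspace f) = f %[ae mu].
Proof.
rewrite /to_Lspace; case: pselect => // fP _; exact: mk_funE.
Qed.

Local Notation F := Lspace_fun.

Let Lzero : Lp := to_Lspace (fun=> 0).
Let Lopp u : Lp := to_Lspace (fun x => (-1) * F u x).
Let Ladd u v : Lp := to_Lspace (fun x => F u x + F v x).
Let Lscale (a : R) u : Lp := to_Lspace (fun x => a * F u x).

Let LzeroE : F Lzero = (fun=> 0) %[ae mu].
Proof. exact: to_LspaceE. Qed.
Let LaddE u v : F (Ladd u v) = (fun x => F u x + F v x) %[ae mu].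
Proof. by apply: to_LspaceE; apply: LfunD; exact: Lspace_funP. Qed.
Let LscaleE a u : F (Lscale a u) = (fun x => a * F u x) %[ae mu].
Proof. by apply: to_LspaceE; apply: LfunZ; exact: Lspace_funP. Qed.
Let LoppE u : F (Lopp u) = (fun x => -1 * F u x) %[ae mu].
Proof. exact: LscaleE. Qed.

Let LaddA : associative Ladd.
Proof.
move=> u v w; apply: Lspace_eq.
by apply: (filterS _ (filterI (filterI (filterI (LaddE u (Ladd v w)) (LaddE
  v w)) (LaddE (Ladd u v) w)) (LaddE u v)))
  => x [[[/(_ I) -> /(_ I) ->] /(_ I) ->] /(_ I) ->] _; rewrite addrA.
Qed.

Let LaddC : commutative Ladd.
Proof.
move=> u v; apply: Lspace_eq.
by apply: (filterS _ (filterI (LaddE u v) (LaddE v u)))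
  => x [/(_ I) -> /(_ I) ->] _; rewrite addrC.
Qed.

Let Ladd0 : left_id Lzero Ladd.
Proof.
move=> u; apply: Lspace_eq.
by apply: (filterS _ (filterI (LaddE Lzero u) LzeroE))
  => x [/(_ I) -> /(_ I) ->] _; rewrite add0r.
Qed.

Let LaddN : left_inverse Lzero Lopp Ladd.
Proof.
move=> u; apply: Lspace_eq.
by apply: (filterS _ (filterI (filterI (LaddE (Lopp u) u) (LoppE u))
  LzeroE))
  => x [[/(_ I) -> /(_ I) ->] /(_ I) ->] _; rewrite mulN1r addNr.
Qed.

HB.instance Definition _ := GRing.isZmodule.Build Lp LaddA LaddC Ladd0 LaddN.

Let LscaleA a b u : Lscale a (Lscale b u) = Lscale (a * b) u.
Proof.
apply: Lspace_eq.
by apply: (filterS _ (filterI (filterI (LscaleE a (Lscale b u)) (LscaleE b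
  u)) (LscaleE (a * b) u)))
  => x [[/(_ I) -> /(_ I) ->] /(_ I) ->] _; rewrite mulrA.
Qed.

Let Lscale1 : left_id 1 Lscale.
Proof.
move=> u; apply: Lspace_eq.
by apply: (filterS _ (LscaleE 1 u))
  => x /(_ I) -> _; rewrite mul1r.
Qed.

Let LscaleDr : right_distributive Lscale +%R.
Proof.
move=> a u v; apply: Lspace_eq.
apply: (filterS _ (filterI (filterI (filterI (filterI (LscaleE a (Ladd u
  v)) (LaddE u v)) (LscaleE a u)) (LscaleE a v)) (LaddE (Lscale a u) (Lscale
  a v))))
  => x [[[[/(_ I) -> /(_ I) ->] /(_ I) +] /(_ I) +] /(_ I) ->] _ => -> ->.
by rewrite mulrDr.
Qed.

Let LscaleDl v : {morph Lscale^~ v : a b / a + b}.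
Proof.
move=> a b; apply: Lspace_eq.
by apply: (filterS _ (filterI (filterI (filterI (LscaleE (a + b) v) (LscaleE
  a v)) (LscaleE b v)) (LaddE (Lscale a v) (Lscale b v))))
  => x [[[/(_ I) -> /(_ I) +] /(_ I) +] /(_ I) ->] _ => -> ->; rewrite mulrDl.
Qed.

HB.instance Definition _ := GRing.Zmodule_isLmodule.Build R Lp
  LscaleA Lscale1 LscaleDr LscaleDl.

Definition Lspace_norm u : R := fine ('N[mu]_p[EFin \o F u]%E).

Let Lspace_mfun u : measurable_fun setT (F u).
Proof. exact/Lfun_measurable/Lspace_funP. Qed.

Let Lspace_normE u : (Lspace_norm u)%:E = 'N[mu]_p[EFin \o F u]%E.
Proof.
rewrite /Lspace_norm fineK// ge0_fin_numE ?Lnorm_ge0//.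
exact/Lfun_finite/Lspace_funP.
Qed.

Let Lspace_normD u v : Lspace_norm (u + v) <= Lspace_norm u + Lspace_norm v.
Proof.
rewrite -lee_fin EFinD !Lspace_normE.
rewrite (Lnorm_ae (Lspace_mfun _) _ (LaddE u v)); last exact: measurable_funD.
exact: eminkowski.
Qed.

Let Lspace_normZ a u : Lspace_norm (a *: u) = `|a| * Lspace_norm u.
Proof.
apply/EFin_inj; rewrite EFinM !Lspace_normE.
rewrite (Lnorm_ae (Lspace_mfun _) _ (LscaleE a u)); last first.
  exact: measurable_funM.
exact: (LnormZ (Lfun_Sub p1 (Lspace_funP u)) a).
Qed.

Let Lspace_norm_eq0 u : Lspace_norm u = 0 -> u = 0.
Proof.
move=> u0; apply: Lspace_eq.
have : 'N[mu]_p[EFin \o F u]%E = 0%E by rewrite -Lspace_normE u0.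
move=> /Lnorm_eq0_eq0 => /(_ _ (lt_le_trans lte01 p1)) u1.
have {}u1 : EFin \o F u = \0 %[ae mu] by apply: u1; exact/measurable_EFinP.
apply: (filterS _ (filterI u1 LzeroE))
  => x [/(_ I) [ux] /(_ I) ?] _; rewrite ux.
by symmetry.
Qed.

HB.instance Definition _ := Lmodule_isNormed.Build R Lp
  Lspace_normD Lspace_normZ Lspace_norm_eq0.

Lemma Lspace_funD u v : F (u + v) = (fun x => F u x + F v x) %[ae mu].
Proof. exact: LaddE. Qed.

Lemma Lspace_funZ a u : F (a *: u) = (fun x => a * F u x) %[ae mu].
Proof. exact: LscaleE. Qed.

Lemma Lspace_fun0 : F (0 : Lp) = (fun=> 0) %[ae mu].
Proof. exact: LzeroE. Qed.

End Lspace_normed.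

HB.mixin Record CompleteNormedModule_isHilbert (R : realType) H
    of CompleteNormedModule R H := {
  inner : H -> H -> R ;
  innerC : forall x y, inner x y = inner y x ;
  innerDl : forall x y z, inner (x + y) z = inner x z + inner y z ;
  innerZl : forall a x y, inner (a *: x) y = a * inner x y ;
  inner_norm : forall x, inner x x = `|x| ^+ 2 }.

#[short(type="hilbertType")]
HB.structure Definition Hilbert (R : realType) :=
  { H of CompleteNormedModule_isHilbert R H & CompleteNormedModule R H }.

HB.mixin Record Hilbert_isSepInfDim (R : realType) H of Hilbert R H := {
  separable : exists2 D : set H, countable D & dense D ;
  infinite_dim : ~ exists n (v : 'I_n -> H),
    forall x, exists a : 'I_n -> R, x = \sum_i a i *: v i }.

#[short(type="sepHilbertType")]
HB.structure Definition SepHilbert (R : realType) :=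
  { H of Hilbert_isSepInfDim R H & Hilbert R H }.

Section inner_theory.
Context (R : realType) (H : hilbertType R).
Implicit Types x y z : H.

Lemma innerDr x y z : inner x (y + z) = inner x y + inner x z.
Proof. by rewrite innerC innerDl !(innerC x). Qed.

Lemma innerZr a x y : inner x (a *: y) = a * inner x y.
Proof. by rewrite innerC innerZl (innerC x). Qed.

Lemma inner0l y : inner (0 : H) y = 0.
Proof. by rewrite -(scale0r 0) innerZl mul0r. Qed.

Lemma inner0r x : inner x (0 : H) = 0.
Proof. by rewrite innerC inner0l. Qed.

Lemma innerBl x y z : inner (x - y) z = inner x z - inner y z.
Proof. by rewrite innerDl -scaleN1r innerZl mulN1r. Qed.

Lemma innerBr x y z : inner x (y - z) = inner x y - inner x z.
Proof. by rewrite innerC innerBl !(innerC x). Qed.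

Lemma inner_suml (s : seq H) (a : H -> R) y :
  inner (\sum_(u <- s) a u *: u) y = \sum_(u <- s) a u * inner u y.
Proof.
elim: s => [|u s ih]; first by rewrite !big_nil inner0l.
by rewrite !big_cons innerDl innerZl ih.
Qed.

Lemma inner_eq0 x : inner x x = 0 -> x = 0.
Proof. by rewrite inner_norm => /eqP; rewrite sqrf_eq0 normr_eq0 => /eqP. Qed.

Lemma cauchy_schwarz x y : `|inner x y| <= `|x| * `|y|.
Proof.
have [->|y0] := eqVneq y 0; first by rewrite inner0r !normr0 mulr0.
have ny0 : `|y| != 0 by rewrite normr_eq0.
have : 0 <= inner (inner y y *: x - inner x y *: y)
                  (inner y y *: x - inner x y *: y).
  by rewrite inner_norm sqr_ge0.
rewrite !(innerBl, innerBr, innerZl, innerZr) (innerC y x) !inner_norm => h.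
have {h} : 0 <= `|y| ^+ 2 * ((`|x| * `|y|) ^+ 2 - inner x y ^+ 2).
  apply: le_trans h _; rewrite le_eqVlt; apply/orP; left; apply/eqP.
  by ring.
rewrite pmulr_rge0 ?exprn_gt0 ?normr_gt0// subr_ge0 => h.
by rewrite -(@ler_sqr _ `|_|) ?nnegrE ?mulr_ge0// real_normK ?num_real.
Qed.

Lemma inner_continuousl y : continuous (fun x : H => inner x y).
Proof.
move=> x; apply/cvgrPdist_le => e e0.
have y1 : 0 < `|y| + 1 by rewrite ltr_wpDl.
near=> z; rewrite -innerBl (le_trans (cauchy_schwarz _ _))//.
apply: (@le_trans _ _ (e / (`|y| + 1) * (`|y| + 1))); last first.
  by rewrite divfK// gt_eqF.
apply: ler_pM => //; last by rewrite lerDl.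
near: z; have /cvgrPdist_le := @cvg_id _ (nbhs x); apply.
by rewrite divr_gt0.
Unshelve. all: by end_near. Qed.

End inner_theory.

Section orthonormal_basis.
Context (R : realType) (H : sepHilbertType R).

Definition is_onb (e : nat -> H) : Prop :=
  (forall i j, inner (e i) (e j) = (i == j)%:R) /\
  (forall x, (forall k, inner x (e k) = 0) -> x = 0).

Let res (s : seq H) (x : H) : H := x - \sum_(u <- s) inner x u *: u.

Let res_continuous s : continuous (res s).
Proof.
rewrite /res => x; apply: cvgB; first exact: cvg_id.
elim: s => [|u s ih].
  under eq_fun do rewrite big_nil; rewrite big_nil; exact: cvg_cst.
under eq_fun do rewrite big_cons; rewrite big_cons; apply: cvgD => //.
by apply: cvgZr_tmp; exact: inner_continuousl.
Qed.

Let d_exists : exists d : nat -> H, dense (range d).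
Proof.
have [D cD dD] := @separable R H.
have [f finj] := countable_injP _ cD.
exists (fun n => xget 0 [set x | D x /\ f x = n]) => U U0 oU.
have [x [Ux Dx]] := dD U U0 oU; exists x; split => //.
exists (f x) => //; case: xgetP => [y -> [Dy fyx]|/(_ x)[]//].
by apply: finj => //; rewrite inE.
Qed.

Let d : nat -> H := sval (cid d_exists).

Let res_neq0 s : exists m, res s (d m) != 0.
Proof.
apply: contrapT => /forallNP res0.
have {}res0 m : res s (d m) = 0 by apply/eqP/negPn/negP.
apply: (@infinite_dim R H); exists (size s), (fun i => nth 0 s i) => x.
exists (fun i => inner x (nth 0 s i)).
have : res s x = 0.
  apply: contrapT => /eqP rx0.
  have : open (res s @^-1` [set y | y != 0]).
    apply: open_comp; first by move=> ? _; exact: res_continuous.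
    rewrite (_ : mkset _ = ~` [set 0]); last first.
      by apply/seteqP; split => y /= /eqP.
    apply/closed_openC/accessible_closed_set1/hausdorff_accessible.
    exact: norm_hausdorff.
  have dd := svalP (cid d_exists).
  move=> /(dd _ (ex_intro _ x rx0))[y [/= + [m _ dm]]].
  by rewrite -dm -/d res0 eqxx.
move=> /eqP; rewrite subr_eq0 => /eqP xE.
by rewrite [LHS]xE (big_nth 0) big_mkord.
Qed.

Let idx s : nat := ex_minn (res_neq0 s).
Let nxt s : H := `|res s (d (idx s))|^-1 *: res s (d (idx s)).
Let gs n : seq H := iter n (fun s => rcons s (nxt s)) [::].
Let e n : H := nxt (gs n).

Let gsS n : gs n.+1 = rcons (gs n) (e n). Proof. by []. Qed.

Let gsE n : gs n = mkseq e n.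
Proof.
elim: n => // n ih.
by rewrite gsS ih /mkseq -addn1 iotaD map_cat /= cats1.
Qed.

Let ortho n := forall i j, (i < n)%N -> (j < n)%N ->
  inner (e i) (e j) = (i == j)%:R.

Let res_ortho n x k : ortho n -> (k < n)%N -> inner (res (gs n) x) (e k) = 0.
Proof.
move=> on kn; rewrite /res innerBl inner_suml gsE big_map.
rewrite -[X in iota 0 X]subn0 -/(index_iota 0 n) big_mkord.
rewrite (bigD1 (Ordinal kn))//= on// eqxx mulr1 big1 ?addr0 ?subrr// => i ik.
by rewrite on// (_ : (i == k :> nat) = false) ?mulr0//; apply/negbTE.
Qed.

Let e_unit n : inner (e n) (e n) = 1.
Proof.
have r0 : res (gs n) (d (idx (gs n))) != 0.
  by rewrite /idx; case: ex_minnP.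
rewrite /e /nxt innerZl innerZr inner_norm; set a := `|_|.
have a0 : a != 0 by rewrite normr_eq0.
by rewrite expr2 mulKf// mulVf.
Qed.

Let e_ortho n : ortho n.
Proof.
elim: n => [|n ih] i j; first by rewrite ltn0.
have en k : (k < n)%N -> inner (e n) (e k) = 0.
  by move=> kn; rewrite {1}/e /nxt innerZl res_ortho ?mulr0.
rewrite !ltnS (leq_eqVlt i) (leq_eqVlt j) => /predU1P[->|ni] /predU1P[->|nj].
- by rewrite e_unit eqxx.
- by rewrite en// gtn_eqF.
- by rewrite innerC en// ltn_eqF.
- exact: ih.
Qed.

Let res_rcons n x : res (gs n.+1) x = res (gs n) x - inner x (e n) *: e n.
Proof. by rewrite /res gsS -cats1 big_cat big_seq1 opprD addrA. Qed.

Let res0_ortho n x : res (gs n) x = 0 -> inner x (e n) = 0.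
Proof.
move=> /eqP; rewrite subr_eq0 => /eqP ->.
rewrite inner_suml gsE big_map big1_seq// => k /=; rewrite mem_iota add0n => kn.
by rewrite (e_ortho (n := n.+1)) ?ltnS ?leqnn ?(ltnW kn)// ltn_eqF ?mulr0.
Qed.

Let res0S n x : res (gs n) x = 0 -> res (gs n.+1) x = 0.
Proof. by move=> x0; rewrite res_rcons x0 res0_ortho// scale0r subrr. Qed.

Let res_d n k : (k < n)%N -> res (gs n) (d k) = 0.
Proof.
elim: n k => // n ih k; rewrite ltnS leq_eqVlt => /predU1P[->|kn]; last first.
  exact/res0S/ih.
have [|r0] := eqVneq (res (gs n) (d n)) 0; first exact: res0S.
have idxn : idx (gs n) = n.
  rewrite /idx; case: ex_minnP => m rm /(_ n r0); rewrite leq_eqVlt.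
  by move=> /predU1P[//|mn]; move: rm; rewrite ih// eqxx.
have : inner (d n) (e n) = `|res (gs n) (d n)|.
  rewrite -[X in inner X _](subrK (\sum_(u <- gs n) inner (d n) u *: u)).
  rewrite innerDl -/(res _ _) [X in _ + X](_ : _ = 0) ?addr0; last first.
    rewrite inner_suml gsE big_map big1_seq// => k' /=.
    rewrite mem_iota add0n => kn.
    by rewrite (e_ortho (n := n.+1)) ?ltnS ?leqnn ?(ltnW kn)// ltn_eqF ?mulr0.
  rewrite /e /nxt idxn innerZr inner_norm expr2.
  by rewrite mulKf// normr_eq0.
move=> hn; rewrite res_rcons hn /e /nxt idxn scalerA divff ?normr_eq0//.
by rewrite scale1r subrr.
Qed.

Lemma onb_exists : exists e, is_onb e.
Proof.
exists e; split=> [i j|x xe].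
  by apply: (e_ortho (n := (maxn i j).+1)); rewrite ltnS ?leq_maxl ?leq_maxr.
have xd k : inner x (d k) = 0.
  have /eqP := res_d (ltnSn k); rewrite subr_eq0 => /eqP ->.
  rewrite innerC inner_suml gsE big_map big1// => i _.
  by rewrite (innerC _ x) xe mulr0.
apply: contrapT => /eqP x0.
have : open ((fun y => inner y x) @^-1` [set r : R | r != 0]).
  by apply: open_comp; [move=> ? _; exact: inner_continuousl|exact: open_neq].
have dd := svalP (cid d_exists).
have xx0 : inner x x != 0 by apply/eqP => /inner_eq0/eqP; exact/negP.
move=> /(dd _ (ex_intro _ x xx0))[y [/= + [m _ dm]]].
by rewrite -dm -/d innerC xd eqxx.
Qed.

Definition onb : nat -> H := get [set e | is_onb e].

Lemma onbP : is_onb onb.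
Proof. by have [e0 e0P] := onb_exists; exact: (getI e0P). Qed.

End orthonormal_basis.
Arguments onb {R} H.

Section operators.
Context (R : realType) (H : sepHilbertType R).
Implicit Types A B : H -> H.

Definition bounded_op A : Prop := linear A /\ continuous A.

Definition self_adjoint A : Prop := forall x y, inner (A x) y = inner x (A y).

Definition Sym : set (H -> H) := [set A | bounded_op A /\ self_adjoint A].

Definition SymP : set (H -> H) :=
  [set A | Sym A /\ forall x, 0 <= inner (A x) x].

Definition pos_def A : Prop :=
  self_adjoint A /\ forall x, x != 0 -> 0 < inner x (A x).

(* the sums defining the Hilbert-Schmidt norm, the trace norm and the trace do
   not depend on the orthonormal basis, so a fixed one is used *)
Definition hs_sum A : \bar R := (\sum_(k <oo) (`|A (onb H k)| ^+ 2)%:E)%E.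

Definition HS : set (H -> H) := [set A | bounded_op A /\ (hs_sum A < +oo)%E].

Definition hs_norm A : R := Num.sqrt (fine (hs_sum A)).

(* [get] picks a default value when there is no witness *)
Definition adjoint A : H -> H :=
  get [set B | bounded_op B /\ forall x y, inner (A x) y = inner x (B y)].

(* the positive square root, for [A] bounded and positive *)
Definition sqrt_op A : H -> H := get [set B | SymP B /\ B \o B = A].

(* [inv_op A y] is the preimage of [y] for [A] injective and [y] in the range
   of [A]; the range need not be all of [H], so that unbounded inverses are
   covered *)
Definition inv_op A : H -> H := fun y => get [set x | A x = y].

Definition abs_op A : H -> H := sqrt_op (adjoint A \o A).

(* trace class: the trace of |A| is finite *)
Definition Tr : set (H -> H) := [set A | bounded_op A /\
  (\sum_(k <oo) (inner (abs_op A (onb H k)) (onb H k))%:E < +oo)%E].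

Definition trace A : R :=
  limn (series (fun k => inner (A (onb H k)) (onb H k))).

Definition tensor (a b : H) : H -> H := fun x => inner b x *: a.

End operators.
Arguments Sym {R} H.
Arguments SymP {R} H.
Arguments HS {R} H.
Arguments Tr {R} H.

Section SymHS.
Context (R : realType) (H : sepHilbertType R).
Implicit Types A B : H -> H.

Definition symhs : {pred H -> H} := mem (Sym H `&` HS H).

Let psum A n : R := \sum_(0 <= k < n) `|A (onb H k)| ^+ 2.

Let psum_ge0 A n : 0 <= psum A n.
Proof. by apply: sumr_ge0 => k _; exact: sqr_ge0. Qed.

Let minkowski2 (a b c d : R) : 0 <= a -> 0 <= b -> 0 <= c -> 0 <= d ->
  (Num.sqrt a + Num.sqrt b) ^+ 2 + (c + d) ^+ 2 <=
  (Num.sqrt (a + c ^+ 2) + Num.sqrt (b + d ^+ 2)) ^+ 2.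
Proof.
move=> a0 b0 c0 d0; rewrite !sqrrD !sqr_sqrtr ?addr_ge0 ?sqr_ge0//.
suff : Num.sqrt a * Num.sqrt b + c * d <=
    Num.sqrt (a + c ^+ 2) * Num.sqrt (b + d ^+ 2) by lra.
set s := Num.sqrt a; set t := Num.sqrt b.
have sE : a = s ^+ 2 by rewrite sqr_sqrtr.
have tE : b = t ^+ 2 by rewrite sqr_sqrtr.
have s0 : 0 <= s := sqrtr_ge0 _; have t0 : 0 <= t := sqrtr_ge0 _.
rewrite -sqrtrM ?addr_ge0 ?sqr_ge0// sE tE.
rewrite -[leLHS]ger0_norm ?addr_ge0 ?mulr_ge0// -sqrtr_sqr.
rewrite ler_wsqrtr// -subr_ge0.
rewrite [leRHS](_ : _ = (s * d - t * c) ^+ 2) ?sqr_ge0//; ring.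
Qed.

Let psumD A B n :
  psum (A + B) n <= (Num.sqrt (psum A n) + Num.sqrt (psum B n)) ^+ 2.
Proof.
rewrite /psum; elim: n => [|n ih]; first by rewrite !big_nil sqr_ge0.
rewrite !big_nat_recr//=; apply: le_trans; last first.
  by apply: minkowski2 => //; exact: psum_ge0.
apply: lerD => //; rewrite ler_sqr ?nnegrE ?addr_ge0//.
exact: ler_normD.
Qed.

Let psumE A n : (\sum_(0 <= k < n) (`|A (onb H k)| ^+ 2)%:E)%E = (psum A n)%:E.
Proof. by rewrite sumEFin. Qed.

Let psum_le A n : (hs_sum A < +oo)%E -> psum A n <= fine (hs_sum A).
Proof.
move=> fA; have h0 : (0 <= hs_sum A)%E.
  by apply: nneseries_ge0 => k _ _; rewrite lee_fin sqr_ge0.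
rewrite -lee_fin fineK ?ge0_fin_numE// -psumE.
by apply: nneseries_lim_ge => k _ _; rewrite lee_fin sqr_ge0.
Qed.

Let hs_sum_le A (M : R) : (forall n, psum A n <= M) -> (hs_sum A <= M%:E)%E.
Proof.
move=> AM; apply: lime_le.
  by apply: is_cvg_nneseries => k _ _; rewrite lee_fin sqr_ge0.
by apply: nearW => n; rewrite psumE lee_fin.
Qed.

Lemma hs_normD_fin A B : (hs_sum A < +oo)%E -> (hs_sum B < +oo)%E ->
  (hs_sum (A + B)%R <= ((hs_norm A + hs_norm B) ^+ 2)%:E)%E.
Proof.
move=> fA fB; apply: hs_sum_le => n; apply: le_trans (psumD _ _ _) _.
rewrite ler_sqr ?nnegrE ?addr_ge0 ?sqrtr_ge0//.
by apply: lerD; apply: ler_wsqrtr; exact: psum_le.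
Qed.

Lemma hs_sumZ (a : R) A : hs_sum (a *: A)%R = ((`|a| ^+ 2)%:E * hs_sum A)%E.
Proof.
rewrite /hs_sum -nneseriesZl; last by move=> k _; rewrite lee_fin sqr_ge0.
by apply: eq_eseriesr => k _ /=; rewrite -EFinM -exprMn -normrZ.
Qed.

Let symhs_submod : submod_closed symhs.
Proof.
split.
  rewrite inE; split; [split; [split|]|split; [split|]].
  - by move=> a x y; rewrite /= scaler0 addr0.
  - by move=> x; exact: cvg_cst.
  - by move=> x y; rewrite inner0l inner0r.
  - by move=> a x y; rewrite /= scaler0 addr0.
  - by move=> x; exact: cvg_cst.
  - by rewrite -(scale0r 0) hs_sumZ normr0 expr0n mul0e.
move=> a A B /set_mem[[[lA cA] sA] [_ hA]] /set_mem[[[lB cB] sB] [_ hB]].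
have E x : (a *: A + B) x = a *: A x + B x by [].
have bAB : bounded_op (a *: A + B).
  split=> [b x y|x].
    by rewrite !E lA lB !scalerDr !scalerA (mulrC a b) addrACA.
  by apply: cvgD; [apply: cvgZl_tmp; exact: cA|exact: cB].
rewrite inE; split; split => //.
  by move=> x y; rewrite !E innerDl innerZl innerDr innerZr sA sB.
apply: le_lt_trans (hs_normD_fin _ hB) _; last exact: ltry.
by rewrite hs_sumZ lte_mul_pinfty// lee_fin sqr_ge0.
Qed.

HB.instance Definition _ := GRing.isSubmodClosed.Build _ _ symhs symhs_submod.

(* Sym(H) `&` HS(H), normed by the Hilbert-Schmidt norm; as trace class
   operators are Hilbert-Schmidt, Sym(H) `&` Tr(H) is the subset of those
   [V : SymHS] such that [Tr H V] *)
Record SymHS := MkSymHS { SymHS_op :> H -> H ; SymHSP : SymHS_op \in symhs }.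

HB.instance Definition _ := [isSub for SymHS_op].
HB.instance Definition _ := [Choice of SymHS by <:].
HB.instance Definition _ := [SubChoice_isSubLmodule of SymHS by <:].

Implicit Types S T : SymHS.

Let SymHS_fin S : (hs_sum S < +oo)%E.
Proof. by have /set_mem[_ []] := SymHSP S. Qed.

Let hs_norm_ge0 A : 0 <= hs_norm A. Proof. exact: sqrtr_ge0. Qed.

Let hs_normD S T : hs_norm (S + T)%R <= hs_norm S + hs_norm T.
Proof.
rewrite -ler_sqr ?nnegrE ?addr_ge0// /hs_norm sqr_sqrtr; last first.
  by rewrite fine_ge0//; apply: nneseries_ge0 => k _ _; rewrite lee_fin sqr_ge0.
rewrite -lee_fin fineK; first exact: hs_normD_fin.
rewrite ge0_fin_numE; first exact: SymHS_fin.
by apply: nneseries_ge0 => k _ _; rewrite lee_fin sqr_ge0.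
Qed.

Let hs_normZ (a : R) S : hs_norm (a *: S)%R = `|a| * hs_norm S.
Proof.
rewrite /hs_norm [hs_sum _]hs_sumZ fineM//; last first.
  rewrite ge0_fin_numE; first exact: SymHS_fin.
  by apply: nneseries_ge0 => k _ _; rewrite lee_fin sqr_ge0.
by rewrite sqrtrM ?sqr_ge0//= sqrtr_sqr normr_id.
Qed.

Let hs_norm0_eq0 S : hs_norm S = 0 -> S = 0.
Proof.
move=> /eqP; rewrite sqrtr_eq0 => S0.
have ek k : S (onb H k) = 0.
  apply/eqP; rewrite -normr_eq0 -sqrf_eq0 eq_le sqr_ge0 andbT.
  apply: le_trans S0; apply: le_trans (psum_le k.+1 (SymHS_fin S)).
  by rewrite /psum big_nat_recr//= lerDr psum_ge0.
have /set_mem[[_ sS] _] := SymHSP S.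
apply/val_inj/funext => x /=; apply: (onbP H).2 => k.
by rewrite sS ek inner0r.
Qed.

HB.instance Definition _ := Lmodule_isNormed.Build R SymHS
  hs_normD hs_normZ hs_norm0_eq0.

Lemma SymHS_normE S : `|S| = hs_norm S. Proof. by []. Qed.

End SymHS.
Arguments SymHS {R} H.

Notation borel H := (g_sigma_algebraType (@open H)).

Section gaussian.
Context (R : realType) (H : sepHilbertType R).
Local Open Scope charge_scope.

(* the degenerate case is separate because [normal_prob 0 0] is not a Dirac
   mass *)
Definition centered_normal (v : R) : set R -> \bar R :=
  if v == 0 then \d_(0 : R) else normal_prob 0 (Num.sqrt v).

(* [mu] is N(0, C): the law of <x, y> is N(0, <C y, y>) for every y *)
Definition gaussian (C : H -> H) (mu : probability (borel H) R) : Prop :=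
  forall (y : H) (U : set R), measurable U ->
    mu [set x | U (inner x y)] = centered_normal (inner (C y) y) U.

(* of [nu] with respect to [mu] *)
Definition log_density (nu mu : probability (borel H) R) : H -> R :=
  fun x => ln (fine (('d (charge_of_finite_measure nu) '/d mu) x)).

Definition SymHS_ltI : set (SymHS H) := [set S | pos_def (idfun \- S)].

Definition SymTr_ltI : set (SymHS H) := [set S | SymHS_ltI S /\ Tr H S].

Definition cov (C0 : H -> H) (S : SymHS H) : H -> H :=
  sqrt_op C0 \o (idfun \- S) \o sqrt_op C0.

Definition onproj (e : nat -> H) (N : nat) : H -> H :=
  \sum_(k < N) tensor (e k) (e k).

End gaussian.

Section L2.
Context d (T : measurableType d) (R : realType).
Variable mu : {measure set T -> \bar R}.

Definition L2_class (f : T -> R) : LspaceType2 mu := to_Lspace mu (lee1n 2) f.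

Definition L2_inner (u v : LspaceType2 mu) : R :=
  \int[mu]_x (Lspace_fun u x * Lspace_fun v x).

(* convergence in L^2 of a sequence of functions *)
Definition L2_cvg (f : nat -> T -> R) (u : LspaceType2 mu) : Prop :=
  (forall n, f n \in Lfun mu 2%:E) /\ L2_class (f n) @[n --> \oo] --> u.

End L2.

(* Main.v *)
(* Write R = (I - S)^-1, B = (I - S)^(1/2), Q = C0^(1/2). For A = sum_i a_i w_i (x) w_i with
   w_i = Q y_i, the quadratic function G(A)(x) = sum_i a_i (<x, y_i>^2 - |w_i|^2) has, under
   every mu(S), mean - <S, A>_HS and variance 2 |B A B|_HS^2. Such A being dense, G extends to
   all self-adjoint Hilbert-Schmidt A, as a function of x that does not depend on S.

   The core is that, for all S and S', mu(S') has density exp(c - G(R' - R) / 2) with respect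
   to mu(S), for some constant c. When R' - R = delta w (x) w with w = Q y, both measures have
   the same characteristic function by a one-dimensional Gaussian integral; chaining gives
   the case where R' - R is a finite combination. Jensen's inequality applied both ways gives
   - <S', R' - R> / 2 <= c <= - <S, R' - R> / 2, and the symmetrized relative entropy is
   <S - S', R - R'> / 2, which bounds the total variation distance; so densities converge when
   S' does in Hilbert-Schmidt norm, whence the general case.

   As R' - R = R V R + O(|V|^2) for S' = S + V, the bounds on c show that the derivative of the
   log-density is V |-> - (<S, R V R> + G(R V R)) / 2, and everything follows from the
   isometry above. *)

From HB Require Import structures.
Require Import Defs.
From mathcomp Require Import all_boot all_order all_algebra.
From mathcomp Require Import all_classical all_reals all_analysis.
From mathcomp Require Import measurable_realfun ring lra.
Set Implicit Arguments.
Unset Strict Implicit.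
Unset Printing Implicit Defensive.
Import Order.TTheory GRing.Theory Num.Theory.
Import numFieldNormedType.Exports.
Local Open Scope classical_set_scope.
Local Open Scope ring_scope.

(** * Limits, Hilbert bases and bounded operators *)

(** [G] must be one function of [x] serving all the measures [mu S], although under each of them it
    is only an L2 limit. Hence the approximating lists are chosen once, with error [2^-1 ^+ n] in
    Hilbert-Schmidt norm: the limit then exists almost surely under every [mu S], and [limn_esup]
    selects it without naming a measure.

    The working variable is the resolvent, in which the log-density is affine up to its constant.
    The resolvent is not Hilbert-Schmidt, but [rho S = R - I] is, and [S |-> - rho S] is an
    involution of [SymHS_ltI]; so an admissible resolvent can be prescribed, and the intermediate
    measures of a chain exist.

    The constant [c] (for [S = 0], half the logarithm of the Carleman-Fredholm determinant of
    [I + rho S']) is never computed. Its two bounds differ by half of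
    [hs_ip (S' - S) (rho S' - rho S)], which is quadratic in [S' - S]: exactly what
    differentiability tolerates.

    Almost sure convergence of log-densities does not by itself prevent a loss of mass in the limit;
    the entropy bound is what excludes it. *)

Lemma half_pow_cvg (R : realType) : (2^-1 : R) ^+ n @[n --> \oo] --> (0 : R).
Proof. by apply: cvg_expr; rewrite ger0_norm ?invr_ge0// invf_lt1// ltr1n. Qed.

Lemma cauchy_dom (R : realType) (V : completeNormedModType R) (u : nat -> V)
    (d : nat -> R) : d @ \oo --> 0 ->
  (forall n m, (n <= m)%N -> `|u m - u n| <= d n) -> cvgn u.
Proof.
move=> d0 ud; apply/cauchy_cvgP/cauchy_exP => e e0.
have /cvgrPdist_lt /(_ _ e0) [N _ dN] := d0.
exists (u N); exists N => // m /= Nm.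
rewrite -ball_normE /= distrC; apply: le_lt_trans (ud _ _ Nm) _.
by have /= := dN N (leqnn N); rewrite sub0r normrN; apply: le_lt_trans; exact: ler_norm.
Qed.

Section limits.
Context (R : realType).

Lemma cvg_uniq (V : normedModType R) (u : nat -> V) (a b : V) :
  u @ \oo --> a -> u @ \oo --> b -> a = b.
Proof.
move=> ua ub.
by rewrite -(cvg_lim (@norm_hausdorff _ V) ua) (cvg_lim (@norm_hausdorff _ V) ub).
Qed.

Lemma cvg_dom0 (V : normedModType R) (u : nat -> V) (a : V) (d : nat -> R) :
  d @ \oo --> 0 -> (forall n, `|u n - a| <= d n) -> u @ \oo --> a.
Proof.
move=> d0 ud; apply/cvgrPdist_lt => e e0.
have /cvgrPdist_lt /(_ _ e0) := d0; apply: filterS => n.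
rewrite sub0r normrN => dn; rewrite distrC; apply: le_lt_trans (ud n) _.
by apply: le_lt_trans dn; exact: ler_norm.
Qed.

Lemma cvg_dom (V : normedModType R) (u v : nat -> V) (a : V) (d : nat -> R) :
  v @ \oo --> a -> d @ \oo --> 0 -> (forall n, `|u n - v n| <= d n) -> u @ \oo --> a.
Proof.
move=> va d0 uvd.
have h : (fun n => u n - v n) @ \oo --> (0 : V).
  by apply: (cvg_dom0 d0) => n; rewrite subr0.
have -> : u = (fun n => u n - v n) \+ v by apply/funext => n /=; rewrite subrK.
by rewrite -[a]add0r; exact: cvgD.
Qed.

Lemma cvg_le (u v : nat -> R) (a b : R) :
  u @ \oo --> a -> v @ \oo --> b -> (forall n, u n <= v n) -> a <= b.
Proof. by move=> ua vb uv; apply: ler_cvg_to ua vb _; exact: nearW. Qed.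

Lemma cvg_le_cst (u : nat -> R) (a M : R) :
  u @ \oo --> a -> (\forall n \near \oo, u n <= M) -> a <= M.
Proof. by move=> ua uM; apply: (ler_cvg_to ua (cvg_cst M)). Qed.

Lemma cvg_dist0 (V : normedModType R) (u : nat -> V) (a : V) :
  u @ \oo --> a -> `|u n - a| @[n --> \oo] --> (0 : R).
Proof.
move=> ua; rewrite -(normr0 V); apply: cvg_norm.
by rewrite -(subrr a); apply: cvgB => //; exact: cvg_cst.
Qed.

Lemma cvg_norm_sqr (V : normedModType R) (u : nat -> V) (a : V) :
  u @ \oo --> a -> `|u n| ^+ 2 @[n --> \oo] --> `|a| ^+ 2.
Proof. by move=> ua; apply: cvgM; exact: cvg_norm. Qed.

End limits.

Section hilbert.
Context (R : realType) (H : hilbertType R).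
Implicit Types x y z : H.

Lemma innerNl x y : inner (- x) y = - inner x y.
Proof. by rewrite -scaleN1r innerZl mulN1r. Qed.

Lemma innerNr x y : inner x (- y) = - inner x y.
Proof. by rewrite innerC innerNl innerC. Qed.

Lemma inner_suml_ord I (r : seq I) (F : I -> H) y :
  inner (\sum_(i <- r) F i) y = \sum_(i <- r) inner (F i) y.
Proof.
elim: r => [|i r ih]; first by rewrite !big_nil inner0l.
by rewrite !big_cons innerDl ih.
Qed.

Lemma inner_sumr_ord I (r : seq I) (F : I -> H) y :
  inner y (\sum_(i <- r) F i) = \sum_(i <- r) inner y (F i).
Proof. by rewrite innerC inner_suml_ord; apply: eq_bigr => i _; rewrite innerC. Qed.

Lemma inner_ge0 x : 0 <= inner x x.
Proof. by rewrite inner_norm sqr_ge0. Qed.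

Lemma inner_continuousr y : continuous (fun x : H => inner y x).
Proof.
by under eq_fun do rewrite innerC; exact: inner_continuousl.
Qed.

Lemma cvg_innerl (T : Type) (F : set_system T) (FF : Filter F) (u : T -> H) l y :
  u @ F --> l -> inner (u t) y @[t --> F] --> inner l y.
Proof.
by move=> ul; apply: (cvg_comp u (fun z => inner z y) ul); exact: inner_continuousl.
Qed.

Lemma cvg_innerr (T : Type) (F : set_system T) (FF : Filter F) (u : T -> H) l y :
  u @ F --> l -> inner y (u t) @[t --> F] --> inner y l.
Proof.
by move=> ul; rewrite innerC; under eq_fun do rewrite innerC; exact: cvg_innerl.
Qed.

Lemma normD_sqr x y : `|x + y| ^+ 2 = `|x| ^+ 2 + 2 * inner x y + `|y| ^+ 2.
Proof. rewrite -!inner_norm innerDl !innerDr (innerC y x); ring. Qed.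

Lemma normB_sqr x y : `|x - y| ^+ 2 = `|x| ^+ 2 - 2 * inner x y + `|y| ^+ 2.
Proof. by rewrite normD_sqr innerNr normrN mulrN. Qed.

Lemma inner_le x y : inner x y <= `|x| * `|y|.
Proof. by apply: le_trans (cauchy_schwarz x y); exact: ler_norm. Qed.

Lemma inner_ext x y : (forall z, inner x z = inner y z) -> x = y.
Proof.
move=> xy; apply/eqP; rewrite -subr_eq0; apply/eqP/inner_eq0.
by rewrite innerBl xy subrr.
Qed.

End hilbert.

Section onb_theory.
Context (R : realType) (H : sepHilbertType R) (e : nat -> H).
Hypothesis oe : is_onb e.
Implicit Types x y z : H.

Definition fourier x n : H := \sum_(0 <= k < n) inner x (e k) *: e k.

Lemma inner_fourier x n k : inner (fourier x n) (e k) = if (k < n)%N then inner x (e k) else 0.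
Proof.
rewrite inner_suml_ord.
under eq_bigr do rewrite innerZl oe.1.
rewrite big_mkord; case: ifPn => [kn|kn].
  rewrite (bigD1 (Ordinal kn))//= eqxx mulr1 big1 ?addr0// => i ik.
  by rewrite (_ : (i == k :> nat) = false) ?mulr0//; exact/negbTE.
rewrite big1// => i _; rewrite (_ : (i == k :> nat) = false) ?mulr0//.
by apply/negbTE; apply: contraNneq kn => <-.
Qed.

Lemma norm_fourierB x n m : (n <= m)%N ->
  `|fourier x m - fourier x n| ^+ 2 =
  \sum_(n <= k < m) inner x (e k) ^+ 2.
Proof.
move=> nm; rewrite /fourier (@big_cat_nat _ _ _ n _ m)//= addrAC subrr add0r.
rewrite -inner_norm inner_suml_ord; apply: eq_big_nat => i /andP[ni im].
rewrite innerZl inner_sumr_ord.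
under eq_bigr do rewrite innerZr oe.1.
rewrite (bigD1_seq i)//= ?mem_index_iota ?ni ?iota_uniq// eqxx mulr1.
rewrite big1 ?addr0// => k ki.
by rewrite eq_sym (negbTE ki) mulr0.
Qed.

Lemma fourier0 x : fourier x 0 = 0. Proof. by rewrite /fourier big_nil. Qed.

Lemma bessel x n : \sum_(0 <= k < n) inner x (e k) ^+ 2 <= `|x| ^+ 2.
Proof.
have : 0 <= `|x - fourier x n| ^+ 2 by exact: sqr_ge0.
rewrite normB_sqr.
have := norm_fourierB x (leq0n n); rewrite fourier0 subr0 => ->.
rewrite inner_sumr_ord (_ : \sum_(0 <= k < n) inner x (inner x (e k) *: e k) = \sum_(0 <= k < n) inner x (e k) ^+ 2); last first.
  by apply: eq_bigr => i _; rewrite innerZr.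
by set s := \sum_(_ <= _ < _) _; lra.
Qed.

(** Bessel makes the partial sums Cauchy; their limit has the same coefficients as [x], and totality
    of the basis identifies the two. *)
Lemma fourier_cvg x : fourier x n @[n --> \oo] --> x.
Proof.
have s_cvg : cvgn (series (fun k => inner x (e k) ^+ 2)).
  apply: nondecreasing_is_cvgn.
    apply/nondecreasing_seqP => n; rewrite /series/= big_nat_recr//= lerDl.
    exact: sqr_ge0.
  by exists (`|x| ^+ 2) => _ [n _ <-]; exact: bessel.
set L := limn (series (fun k => inner x (e k) ^+ 2)).
have c : cvgn (fourier x).
  apply: (@cauchy_dom _ _ _ (fun n =>
     Num.sqrt (L - series (fun k => inner x (e k) ^+ 2) n))).
    rewrite -[X in _ --> X]sqrtr0.
    apply: cvg_comp; last exact: sqrt_continuous.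
    by rewrite -(subrr L); apply: cvgB => //; exact: cvg_cst.
  move=> n m nm; rewrite -[leLHS]ger0_norm// -sqrtr_sqr ler_wsqrtr//.
  rewrite norm_fourierB// -(sub_series_geq _ nm) lerD2r.
  apply: nondecreasing_cvgn_le => //.
  apply/nondecreasing_seqP => k; rewrite /series/= big_nat_recr//= lerDl.
  exact: sqr_ge0.
suff E : limn (fourier x) = x by rewrite -[X in _ --> X]E.
apply/eqP; rewrite -subr_eq0; apply/eqP; apply: oe.2 => k.
rewrite innerBl; apply/eqP; rewrite subr_eq0; apply/eqP.
have h : inner (fourier x n) (e k) @[n --> \oo] --> inner (limn (fourier x)) (e k).
  exact: cvg_innerl.
have h2 : inner (fourier x n) (e k) @[n --> \oo] --> inner x (e k).
  apply: cvg_near_cst; exists k.+1 => // n /= kn.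
  by rewrite inner_fourier kn.
by rewrite -(cvg_lim (@Rhausdorff R) h) (cvg_lim (@Rhausdorff R) h2).
Qed.

Lemma parseval x y :
  series (fun k => inner x (e k) * inner y (e k)) @ \oo --> inner x y.
Proof.
have h : inner (fourier x n) y @[n --> \oo] --> inner x y.
  by apply: cvg_innerl; exact: fourier_cvg.
apply: cvg_trans h; apply: near_eq_cvg; near=> n.
rewrite /= /series/= inner_suml_ord; apply: eq_bigr => k _.
by rewrite innerZl (innerC y).
Unshelve. all: by end_near. Qed.

Lemma parseval_sqr x :
  (\sum_(k <oo) ((inner x (e k)) ^+ 2)%:E = (`|x| ^+ 2)%:E)%E.
Proof.
apply/cvg_lim => //.
have := @parseval x x; rewrite inner_norm => h.
apply: cvg_trans (cvg_comp _ EFin h (@cvg_id _ _)).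
by apply: near_eq_cvg; near=> n; rewrite /= /series/= sumEFin.
Unshelve. all: by end_near. Qed.

End onb_theory.

Section hs_basis.
Context (R : realType) (H : sepHilbertType R).

(** Parseval expands both sides into the same double series of [inner (A (e k)) (f j) ^+ 2], summed
    in either order. With [A' = A] this is independence of the basis; with an adjoint pair it moves
    a factor from the right of a product to its left. *)
Lemma hs_sum_basis (A A' : H -> H) (e f : nat -> H) :
  is_onb e -> is_onb f -> (forall x y, inner (A x) y = inner x (A' y)) ->
  (\sum_(k <oo) (`|A (e k)| ^+ 2)%:E = \sum_(k <oo) (`|A' (f k)| ^+ 2)%:E)%E.
Proof.
move=> oe of_ AA'.
under eq_eseriesr do rewrite -(parseval_sqr of_).
under [RHS]eq_eseriesr do rewrite -(parseval_sqr oe).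
rewrite nneseries_interchange; last by move=> *; rewrite lee_fin sqr_ge0.
by do 2 (apply: eq_eseriesr => ? _); rewrite AA' innerC.
Qed.

End hs_basis.

Section linear_maps.
Context (R : realType) (U V : normedModType R) (A : U -> V).
Hypothesis lA : linear A.

Lemma lin0 : A 0 = 0.
Proof. by have := lA (-1) 0 0; rewrite scaler0 addr0 scaleN1r addNr. Qed.

Lemma linZ a x : A (a *: x) = a *: A x.
Proof. by have := lA a x 0; rewrite !addr0 lin0 addr0. Qed.

Lemma linD x y : A (x + y) = A x + A y.
Proof. by have := lA 1 x y; rewrite !scale1r. Qed.

Lemma linN x : A (- x) = - A x.
Proof. by rewrite -scaleN1r linZ scaleN1r. Qed.

Lemma linB x y : A (x - y) = A x - A y.
Proof. by rewrite linD linN. Qed.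

Lemma lin_sum I (r : seq I) (F : I -> U) : A (\sum_(i <- r) F i) = \sum_(i <- r) A (F i).
Proof.
elim: r => [|i r ih]; first by rewrite !big_nil lin0.
by rewrite !big_cons linD ih.
Qed.

Lemma lin_lipschitz_continuous M : (forall x, `|A x| <= M * `|x|) -> continuous A.
Proof.
move=> AM x; apply/cvgrPdist_le => e e0.
have M1 : 0 < `|M| + 1 by rewrite ltr_wpDl.
near=> z; rewrite -linB (le_trans (AM _))//.
apply: (@le_trans _ _ ((`|M| + 1) * (e / (`|M| + 1)))); last first.
  by rewrite mulrC divfK// gt_eqF.
apply: (@le_trans _ _ ((`|M| + 1) * `|x - z|)).
  by rewrite ler_wpM2r// (le_trans (ler_norm _))// lerDl.
rewrite ler_wpM2l ?(ltW M1)//.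
near: z; have /cvgrPdist_le := @cvg_id _ (nbhs x); apply.
by rewrite divr_gt0.
Unshelve. all: by end_near. Qed.

Lemma lin_continuous_lipschitz : continuous A ->
  exists2 M, 0 < M & forall x, `|A x| <= M * `|x|.
Proof.
move=> /(_ 0)/cvgrPdist_le/(_ 1 ltr01).
rewrite lin0 => /nbhs_ballP[r /= r0 Ar].
exists (2 / r) => [|x]; first by rewrite divr_gt0.
have [->|x0] := eqVneq x 0; first by rewrite lin0 !normr0 mulr0.
have nx0 : 0 < `|x| by rewrite normr_gt0.
have rx0 : 0 < r / 2 / `|x| by rewrite !divr_gt0.
have : ball 0 r ((r / 2 / `|x|) *: x).
  rewrite -ball_normE /= sub0r normrN normrZ (gtr0_norm rx0).
  by rewrite divfK ?gt_eqF// ltr_pdivrMr// ltr_pMr// ltr1n.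
move=> /Ar /=; rewrite sub0r normrN linZ normrZ (gtr0_norm rx0).
rewrite -ler_pdivlMl ?divr_gt0// => /le_trans; apply.
by rewrite mulr1 le_eqVlt; apply/orP; left; apply/eqP; field; rewrite !gt_eqF.
Qed.

End linear_maps.

(** * Positive and coercive operators *)

Section operators.
Context (R : realType) (H : sepHilbertType R).
Implicit Types (A B X Z : H -> H) (x y z : H).

Definition opb A (M : R) := forall x, `|A x| <= M * `|x|.

Lemma bounded_opP A :
  bounded_op A <-> linear A /\ exists2 M, 0 < M & opb A M.
Proof.
split=> [[lA cA]|[lA [M _ AM]]]; split => //.
  exact: lin_continuous_lipschitz.
exact: lin_lipschitz_continuous AM.
Qed.

Lemma Sym_lin A : Sym H A -> linear A. Proof. by case=> -[]. Qed.
Lemma Sym_sa A : Sym H A -> self_adjoint A. Proof. by case. Qed.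
Lemma Sym_cont A : Sym H A -> continuous A. Proof. by case=> -[]. Qed.
Lemma Sym_opb A : Sym H A -> exists2 M, 0 < M & opb A M.
Proof. by move=> [/bounded_opP[_]]. Qed.

Lemma SymI A M : linear A -> opb A M -> self_adjoint A -> Sym H A.
Proof. by move=> lA AM sA; split => //; split => //; exact: lin_lipschitz_continuous AM. Qed.

(** Evaluate the nonnegative form of [A] at [x - M^-1 *: A x]; the upper bound at [A x] controls the
    quadratic term. It turns smallness of [inner (A x) x] into smallness of [A x]. *)
Lemma psd_sqr_le A (M : R) : linear A -> self_adjoint A -> 0 < M ->
  (forall x, 0 <= inner (A x) x) -> (forall x, inner (A x) x <= M * `|x| ^+ 2) ->
  forall x, `|A x| ^+ 2 <= M * inner (A x) x.
Proof.
move=> lA sA M0 A0 AM x.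
have := A0 (x - M^-1 *: A x).
rewrite (linB lA) (linZ lA) !(innerBl, innerBr, innerZl, innerZr).
rewrite [inner (A (A x)) x]sA -inner_norm.
have := AM (A x); rewrite -inner_norm.
set a := inner (A x) (A x); set b := inner (A (A x)) _; set c := inner _ x.
move=> ba; set t := M^-1.
have t0 : 0 < t by rewrite invr_gt0.
have tM : t * M = 1 by rewrite mulVf// gt_eqF.
have : t * (t * b) <= t * a.
  rewrite ler_wpM2l ?(ltW t0)//; apply: le_trans (ler_wpM2l (ltW t0) ba) _.
  by rewrite mulrA tM mul1r.
move=> h1 h2.
have : t * a <= c by lra.
by move=> /(ler_wpM2l (ltW M0)); rewrite mulrA (mulrC M) tM mul1r.
Qed.

Lemma psd_opb A (M : R) : linear A -> self_adjoint A -> 0 <= M ->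
  (forall x, 0 <= inner (A x) x) -> (forall x, inner (A x) x <= M * `|x| ^+ 2) ->
  opb A M.
Proof.
move=> lA sA M0 A0 AM x.
(* [psd_sqr_le] needs a positive bound: when [M = 0] the bound [1] also holds, and the form itself
   vanishes. *)
have [M00|M00] := eqVneq M 0.
  have : `|A x| ^+ 2 <= 1 * inner (A x) x.
    apply: psd_sqr_le => // y; apply: le_trans (AM y) _.
    by rewrite M00 mul0r mul1r sqr_ge0.
  rewrite mul1r => /le_trans /(_ (AM x)); rewrite M00 !mul0r.
  move=> h; suff /eqP -> : `|A x| == 0 by [].
  by rewrite -sqrf_eq0 eq_le h sqr_ge0.
have {M00}M0 : 0 < M by rewrite lt_neqAle eq_sym M00.
have [->|Ax0] := eqVneq (A x) 0; first by rewrite normr0 mulr_ge0// ltW.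
have := psd_sqr_le lA sA M0 A0 AM x.
move=> /le_trans /(_ (ler_wpM2l (ltW M0) (inner_le _ _))).
by rewrite expr2 mulrCA ler_pM2l ?normr_gt0.
Qed.

Lemma opb_inner_le A M x : opb A M -> inner (A x) x <= M * `|x| ^+ 2.
Proof.
move=> AM; apply: le_trans (inner_le _ _) _.
by rewrite expr2 mulrA ler_wpM2r.
Qed.

Definition coercive A (c : R) := forall x, c * `|x| ^+ 2 <= inner (A x) x.

(** Richardson iteration: each step applies [Z = I - A / K] to the increments of [u]. As a form
    [0 <= Z <= q < 1], which [psd_opb] turns into a norm bound, so [u] converges to a solution. *)
Lemma coercive_surj A c : Sym H A -> 0 < c -> coercive A c ->
  forall y, exists x, A x = y.
Proof.
move=> SA c0 cA y; have lA := Sym_lin SA; have sA := Sym_sa SA.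
have [M M0 AM] := Sym_opb SA.
(* Adding [c] makes [q = 1 - c / K] strictly positive as well as less than 1. *)
pose K := M + c; have K0 : 0 < K by rewrite addr_gt0.
pose Z x := x - K^-1 *: A x.
have lZ : linear Z.
  move=> a u v; rewrite /Z lA scalerDr scalerBr opprD addrACA scalerA.
  by rewrite (mulrC K^-1) -scalerA.
have sZ : self_adjoint Z.
  by move=> u v; rewrite /Z innerBl innerBr innerZl innerZr sA.
pose q := 1 - K^-1 * c.
have q0 : 0 < q by rewrite subr_gt0 mulrC ltr_pdivrMr// mul1r ltrDr.
have q1 : q < 1 by rewrite gtrBl mulr_gt0 ?invr_gt0.
have Zq : opb Z q.
  apply: psd_opb => // [|x|x]; first exact: ltW.
    rewrite innerBl innerZl subr_ge0 inner_norm mulrC ler_pdivrMr//.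
    apply: le_trans (opb_inner_le _ AM) _.
    by rewrite mulrC ler_wpM2l ?sqr_ge0// lerDl ltW.
  rewrite innerBl innerZl inner_norm mulrBl mul1r lerD2l lerN2 -mulrA.
  by rewrite ler_wpM2l ?invr_ge0 ?(ltW K0).
pose u := fix u n := if n is n'.+1 then u n' + K^-1 *: (y - A (u n')) else 0.
have uS n : u n.+1 = u n + K^-1 *: (y - A (u n)) by [].
have uB n : u n.+1 - u n = K^-1 *: (y - A (u n)) by rewrite uS addrAC subrr add0r.
have duS n : u n.+2 - u n.+1 = Z (u n.+1 - u n).
  by rewrite /Z (linB lA) uB uB -scalerBr opprB addrA subrK.
have du n : `|u n.+1 - u n| <= `|u 1%N| * q ^+ n.
  elim: n => [|n ih]; first by rewrite expr0 mulr1 subr0.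
  rewrite duS; apply: le_trans (Zq _) _.
  by rewrite exprS mulrCA ler_wpM2l// ltW.
have cu : cvgn u.
  apply: (@cauchy_dom _ _ u (fun n => `|u 1%N| / (1 - q) * q ^+ n)).
    rewrite -[X in _ --> X](mulr0 (`|u 1%N| / (1 - q))).
    by apply: cvgM; [exact: cvg_cst|apply: cvg_expr; rewrite ger0_norm ?ltW].
  move=> n m nm; rewrite -(subnKC nm); move: (m - n)%N => {nm}m.
  (* The difference of powers telescopes in the induction on [m]; the bound by [q ^+ n] alone is not
     inductive. *)
  suff : `|u (n + m)%N - u n| <= `|u 1%N| / (1 - q) * (q ^+ n - q ^+ (n + m)).
    move=> /le_trans; apply; rewrite ler_wpM2l ?divr_ge0 ?subr_ge0 ?(ltW q1)//.
    by rewrite gerBl exprn_ge0 ?ltW.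
  elim: m => [|m ih]; first by rewrite addn0 !subrr normr0 mulr0.
  have := ler_normD (u (n + m.+1)%N - u (n + m)%N) (u (n + m)%N - u n).
  rewrite addrA subrK => /le_trans; apply.
  rewrite addnS; apply: le_trans (lerD (du _) ih) _.
  rewrite -mulrA [leLHS](_ : _ = `|u 1%N| / (1 - q) * (q ^+ n - q ^+ (n + m).+1))//.
  rewrite exprS; field; lra.
exists (limn u).
have Aul : A (u n) @[n --> \oo] --> A (limn u).
  by apply: (cvg_comp u A cu); exact: Sym_cont.
have h1 : (u n.+1) @[n --> \oo] --> limn u by move: cu; rewrite -(cvg_shiftS u).
have h2 : (u n.+1) @[n --> \oo] --> limn u + K^-1 *: (y - A (limn u)).
  under eq_fun do rewrite uS.
  apply: cvgD => //; apply: cvgZl_tmp; apply: cvgB => //; exact: cvg_cst.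
have hH := @norm_hausdorff _ H.
have : limn u = limn u + K^-1 *: (y - A (limn u)).
  by rewrite -{1}(cvg_lim hH h1) (cvg_lim hH h2).
move=> /esym/eqP; rewrite -subr_eq0 addrAC subrr add0r.
by rewrite scaler_eq0 invr_eq0 gt_eqF//= subr_eq0 => /eqP ->.
Qed.

Lemma coercive_lb A c x : 0 < c -> coercive A c -> c * `|x| <= `|A x|.
Proof.
move=> c0 cA; have [->|x0] := eqVneq x 0; first by rewrite normr0 mulr0.
have := le_trans (cA x) (inner_le _ _).
by rewrite expr2 mulrA ler_pM2r ?normr_gt0.
Qed.

Lemma coercive_inj A c : linear A -> 0 < c -> coercive A c -> injective A.
Proof.
move=> lA c0 cA x y Axy; apply/eqP; rewrite -subr_eq0 -normr_eq0.
have := coercive_lb (x - y) c0 cA.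
by rewrite (linB lA) Axy subrr normr0 pmulr_rle0// => h; rewrite eq_le h normr_ge0.
Qed.

End operators.

Section coercive_inverse.
Context (R : realType) (H : sepHilbertType R) (A : H -> H) (c : R).
Hypotheses (SA : Sym H A) (c0 : 0 < c) (cA : coercive A c).
Let iA := inv_op A.

Lemma inv_opK y : A (iA y) = y.
Proof. by have [x Ax] := coercive_surj SA c0 cA y; apply: (@getPex _ [set x | A x = y]); exists x. Qed.

Lemma inv_opKl x : iA (A x) = x.
Proof. by apply: (coercive_inj (Sym_lin SA) c0 cA); exact: inv_opK. Qed.

Lemma inv_op_opb : opb iA c^-1.
Proof.
move=> y; rewrite -[y in leRHS]inv_opK mulrC ler_pdivlMr// mulrC.
exact: coercive_lb.
Qed.

Lemma inv_op_sa : self_adjoint iA.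
Proof. by move=> x y; rewrite -{1}[y]inv_opK -(Sym_sa SA) inv_opK. Qed.

Lemma inv_op_lin : linear iA.
Proof.
move=> a x y; apply: (coercive_inj (Sym_lin SA) c0 cA).
by rewrite (Sym_lin SA) !inv_opK.
Qed.

Lemma inv_op_Sym : Sym H iA.
Proof. exact: SymI inv_op_lin inv_op_opb inv_op_sa. Qed.

(** Coercivity of [A] at [iA x] bounds [inner (iA x) x] below by [c] times the squared norm of
    [iA x], and the norm of [x] is at most [M] times that of [iA x]. *)
Lemma inv_op_coercive M : 0 < M -> opb A M -> coercive iA (c / M ^+ 2).
Proof.
move=> M0 AM x; have := cA (iA x); rewrite inv_opK [inner x _]innerC.
apply: le_trans; rewrite -mulrA ler_wpM2l ?(ltW c0)//.
rewrite mulrC ler_pdivrMr ?exprn_gt0// -exprMn mulrC.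
rewrite ler_sqr ?nnegrE// ?mulr_ge0 ?(ltW M0)//.
by rewrite -{1}[x]inv_opK.
Qed.

End coercive_inverse.

(** * Positive square roots *)

Section square_root.
Context (R : realType) (H : sepHilbertType R).
Implicit Types (A B X Z : H -> H) (x y z : H).

Section contraction.
Variable Z : H -> H.
Hypotheses (lZ : linear Z) (sZ : self_adjoint Z) (Z1 : opb Z 1).

(* Solves [Y = (Z + Y ^+ 2) / 2], that is [(1 - Y) ^+ 2 = 1 - Z]. *)
Let Y := fix Y n : H -> H := if n is n'.+1 then fun x => 2^-1 *: (Z x + Y n' (Y n' x)) else fun=> 0.
(** The same recursion for the scalar 1. It majorizes the norms of [Y n] and of its increments, and
    increases to the double root 1 of [r = (1 + r ^ 2) / 2]. This gives convergence even when [Z]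
    has norm 1, where the recursion is not a strict contraction. *)
Let r := fix r n : R := if n is n'.+1 then 2^-1 * (1 + r n' * r n') else 0.

Let YS n x : Y n.+1 x = 2^-1 *: (Z x + Y n (Y n x)). Proof. by []. Qed.

Let rS n : r n.+1 = 2^-1 * (1 + r n * r n). Proof. by []. Qed.

Let r01 n : 0 <= r n <= 1.
Proof.
elim: n => [|n /andP[r0 r1]]; first by rewrite lexx ler01.
have := mulr_ge0 r0 r0; have := mulr_ile1 r0 r0 r1 r1; rewrite /= => *.
by apply/andP; split; lra.
Qed.

Let r_nd : nondecreasing_seq r.
Proof.
apply/nondecreasing_seqP => n; have /andP[_ r1] := r01 n.
by rewrite /=; have := sqr_ge0 (1 - r n); rewrite expr2 => h; nra.
Qed.

Let r_cvg : r @ \oo --> (1 : R).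
Proof.
have cr : cvgn r.
  apply: nondecreasing_is_cvgn => //.
  by exists 1 => _ [n _ <-]; have /andP[] := r01 n.
have h1 : r n.+1 @[n --> \oo] --> limn r by move: cr; rewrite -(cvg_shiftS r).
have h2 : r n.+1 @[n --> \oo] --> 2^-1 * (1 + limn r * limn r).
  apply: cvgM; first exact: cvg_cst.
  by apply: cvgD; [exact: cvg_cst|exact: cvgM].
have E : limn r = 2^-1 * (1 + limn r * limn r).
  by rewrite -{1}(cvg_lim (@Rhausdorff R) h1) (cvg_lim (@Rhausdorff R) h2).
suff <- : limn r = 1 by [].
have : (limn r - 1) ^+ 2 = 0 by rewrite {1}E; move: (limn r) E => l E; nra.
by move/eqP; rewrite sqrf_eq0 subr_eq0 => /eqP.
Qed.

Let Y_lin n : linear (Y n).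
Proof.
elim: n => [|n ih] a x y; first by rewrite /= scaler0 addr0.
by rewrite /= lZ !ih addrACA -scalerDr !scalerDr !scalerA (mulrC a).
Qed.

Let Y_sa n : self_adjoint (Y n).
Proof.
elim: n => [|n ih] x y; first by rewrite /= inner0l inner0r.
by rewrite /= innerZl innerZr innerDl innerDr sZ !ih.
Qed.

Let Y_opb n : opb (Y n) (r n).
Proof.
elim: n => [|n ih] x; first by rewrite /= normr0 mul0r.
rewrite /= normrZ ger0_norm ?invr_ge0// -mulrA ler_wpM2l ?invr_ge0//.
apply: le_trans (ler_normD _ _) _; rewrite mulrDl lerD//.
apply: le_trans (ih _) _; rewrite -mulrA ler_wpM2l//.
by have /andP[] := r01 n.
Qed.

Let Y_step n x : `|Y n.+1 x - Y n x| <= (r n.+1 - r n) * `|x|.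
Proof.
elim: n x => [|n ih] x.
  rewrite YS rS /= subr0 addr0 normrZ ger0_norm ?invr_ge0//.
  rewrite mulr0 addr0 subr0 mulr1.
  by rewrite ler_wpM2l ?invr_ge0// (le_trans (Z1 _)) ?mul1r.
rewrite YS (YS n) -scalerBr opprD addrACA subrr add0r.
rewrite normrZ ger0_norm ?invr_ge0//.
rewrite rS [in leRHS](rS n) -mulrBr opprD addrACA subrr add0r.
rewrite -mulrA ler_wpM2l ?invr_ge0//.
(* A difference of squares with noncommuting factors; the two bounds add up to
   [r n.+1 ^+ 2 - r n ^+ 2]. *)
rewrite (_ : _ - _ = Y n.+1 (Y n.+1 x - Y n x) + (Y n.+1 (Y n x) - Y n (Y n x))); last first.
  by rewrite (linB (Y_lin n.+1)) addrA subrK.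
apply: le_trans (ler_normD _ _) _.
apply: le_trans (lerD (le_trans (Y_opb _ _) (ler_wpM2l _ (ih _))) (le_trans (ih _) (ler_wpM2l _ (Y_opb _ _)))) _.
- by have /andP[] := r01 n.+1.
- by rewrite subr_ge0 r_nd.
by rewrite le_eqVlt; apply/orP; left; apply/eqP; rewrite !rS; ring.
Qed.

Let Y_dist n m x : (n <= m)%N -> `|Y m x - Y n x| <= (1 - r n) * `|x|.
Proof.
move=> nm; rewrite -(subnKC nm); move: (m - n)%N => {nm}m.
suff : `|Y (n + m)%N x - Y n x| <= (r (n + m)%N - r n) * `|x|.
  move=> /le_trans; apply; rewrite ler_wpM2r// lerD2r.
  by have /andP[] := r01 (n + m)%N.
elim: m => [|m ih]; first by rewrite addn0 !subrr normr0 mul0r.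
have := ler_normD (Y (n + m.+1)%N x - Y (n + m)%N x) (Y (n + m)%N x - Y n x).
rewrite addrA subrK => /le_trans; apply.
rewrite addnS; apply: le_trans (lerD (Y_step _ _) ih) _.
by rewrite -mulrDl addrA subrK.
Qed.

Let d_cvg x : (1 - r n) * `|x| @[n --> \oo] --> (0 : R).
Proof.
rewrite -[X in _ --> X](mul0r `|x|) -[X in X * _](subrr 1).
by apply: cvgM; [apply: cvgB => //; exact: cvg_cst|exact: cvg_cst].
Qed.

Let Y_cvg x : cvgn (Y^~ x).
Proof. by apply: (cauchy_dom (d_cvg x)) => n m; exact: Y_dist. Qed.

Lemma sqrt_contraction : exists B, SymP H B /\ forall x, B (B x) = x - Z x.
Proof.
pose L x := limn (Y^~ x).
have LC x : Y n x @[n --> \oo] --> L x by exact: Y_cvg.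
have lL : linear L.
  move=> a x y; apply: (@cvg_uniq _ _ (Y^~ (a *: x + y))) => //.
  under eq_fun do rewrite Y_lin.
  by apply: cvgD => //; apply: cvgZl_tmp.
have sL : self_adjoint L.
  move=> x y; apply: (cvg_uniq (cvg_innerl _ (LC x))).
  by under eq_fun do rewrite Y_sa; exact: cvg_innerr.
have Y1 n x : `|Y n x| <= `|x|.
  apply: le_trans (Y_opb _ _) _; rewrite ler_piMl//.
  by have /andP[] := r01 n.
have L1 x : `|L x| <= `|x|.
  by apply: (cvg_le (cvg_norm (LC x)) (cvg_cst `|x|)).
have LE x : L x = 2^-1 *: (Z x + L (L x)).
  have h1 : Y n.+1 x @[n --> \oo] --> L x.
    by have := LC x; rewrite -(cvg_shiftS (Y^~ x)).
  apply: (cvg_uniq h1); under eq_fun do rewrite YS.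
  apply: cvgZl_tmp; apply: cvgD; first exact: cvg_cst.
  (* [Y n (Y n x)] is compared with [Y n (L x)], as [Y n] does not increase norms. *)
  apply: (cvg_dom (LC (L x)) (cvg_dist0 (LC x))) => n.
  by rewrite -(linB (Y_lin n)).
(* [(I - L) ^ 2 = I - 2 L + L ^ 2], and the fixed point equation reads [2 L = Z + L ^ 2]. *)
exists (fun x => x - L x); split; [split|].
- apply: (@SymI _ _ _ 2).
  + move=> a x y; rewrite lL scalerBr opprD addrACA; congr (_ + _).
  + by move=> x; apply: le_trans (ler_normB _ _) _; have := L1 x; lra.
  + by move=> x y; rewrite innerBl innerBr sL.
- move=> x; rewrite innerBl inner_norm subr_ge0 expr2.
  by apply: le_trans (inner_le _ _) _; rewrite ler_wpM2r.
move=> x; rewrite (linB lL).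
have : 2 *: L x = Z x + L (L x).
  by rewrite [in LHS]LE scalerA mulfV ?scale1r// pnatr_eq0.
rewrite scaler_nat mulr2n => h.
have -> : Z x = L x + L x - L (L x) by rewrite h addrK.
by rewrite !opprB -addrA opprD; congr (x + _); rewrite addrCA.
Qed.

End contraction.

(** Scaling by a bound [M] of [A] makes [Z = I - A / M] a contraction; the root is [sqrt M] times
    that of [I - Z]. *)
Lemma sqrt_exists A : SymP H A -> exists B, SymP H B /\ B \o B = A.
Proof.
move=> [SA A0]; have lA := Sym_lin SA; have sA := Sym_sa SA.
have [M M0 AM] := Sym_opb SA.
pose Z x := x - M^-1 *: A x.
have lZ : linear Z.
  move=> a u v; rewrite /Z lA scalerDr scalerBr opprD addrACA scalerA.
  by rewrite (mulrC M^-1) -scalerA.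
have sZ : self_adjoint Z.
  by move=> u v; rewrite /Z innerBl innerBr innerZl innerZr sA.
have Z1 : opb Z 1.
  apply: psd_opb => // x.
    rewrite innerBl innerZl subr_ge0 inner_norm mulrC ler_pdivrMr//.
    by rewrite mulrC; exact: opb_inner_le.
  rewrite innerBl innerZl inner_norm mul1r gerBl.
  by rewrite mulr_ge0// invr_ge0 ltW.
have [B [[SB B0] BB]] := sqrt_contraction lZ sZ Z1.
pose m := Num.sqrt M; have m0 : 0 <= m by exact: sqrtr_ge0.
have mm : m * m = M by rewrite -expr2 sqr_sqrtr// ltW.
exists (fun x => m *: B x); split; [split|].
- have [K K0 BK] := Sym_opb SB; apply: (@SymI _ _ _ (m * K)).
  + by move=> a x y; rewrite (Sym_lin SB) scalerDr !scalerA (mulrC m).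
  + by move=> x; rewrite normrZ ger0_norm// -mulrA ler_wpM2l.
  + by move=> x y; rewrite innerZl innerZr (Sym_sa SB).
- by move=> x; rewrite innerZl mulr_ge0.
apply/funext => x /=.
rewrite (linZ (Sym_lin SB)) scalerA mm BB /Z opprB addrC subrK.
by rewrite scalerA mulfV ?scale1r// gt_eqF.
Qed.

Lemma sqrt_opP A : SymP H A -> SymP H (sqrt_op A) /\ forall x, sqrt_op A (sqrt_op A x) = A x.
Proof.
move=> /sqrt_exists [B HB].
have [S2 /funeqP E] := @getI _ [set B | SymP H B /\ B \o B = A] B HB.
by split=> // x; exact: E.
Qed.

End square_root.

Section dense_range.
Context (R : realType) (H : sepHilbertType R) (Q : H -> H).
Hypotheses (PQ : SymP H Q) (Q_ker : forall x, Q x = 0 -> x = 0).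

(** Let [u n = Z ^ n x] with [Z = I - Q / M]; then [x - u n] stays in the range of [Q]. The moments
    [a n = inner (u n) x] decrease, so [u] is Cauchy; its limit is fixed by [Z], hence killed by
    [Q], hence zero. *)
Lemma range_dense x (eps : R) : 0 < eps -> exists y, `|x - Q y| < eps.
Proof.
have [SQ Q0] := PQ; have lQ := Sym_lin SQ; have sQ := Sym_sa SQ.
have [M M0 QM] := Sym_opb SQ.
pose Z x := x - M^-1 *: Q x.
have lZ : linear Z.
  move=> a u v; rewrite /Z lQ scalerDr scalerBr opprD addrACA scalerA.
  by rewrite (mulrC M^-1) -scalerA.
have sZ : self_adjoint Z.
  by move=> u v; rewrite /Z innerBl innerBr innerZl innerZr sQ.
have Z0 u : 0 <= inner (Z u) u.
  rewrite innerBl innerZl subr_ge0 inner_norm mulrC ler_pdivrMr//.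
  by rewrite mulrC; exact: opb_inner_le.
have ZI u : inner (Z u) u <= 1 * `|u| ^+ 2.
  rewrite innerBl innerZl inner_norm mul1r gerBl.
  by rewrite mulr_ge0// invr_ge0 ltW.
have ZZ := psd_sqr_le lZ sZ ltr01 Z0 ZI.
pose u n := iter n Z x.
have uE n m : inner (u n) (u m) = inner (u (n + m)%N) x.
  elim: n m => [|n ih] m; first by rewrite innerC.
  by apply: etrans (sZ _ _) _; rewrite (ih m.+1) addnS.
pose a n := inner (u n) x.
have a_ge0 n : 0 <= a n.
  rewrite /a -(odd_double_half n) -addnn; case: odd; rewrite ?add1n ?add0n -?addSn -uE//=.
  exact: inner_ge0.
have a_ni n : a n.+1 <= a n.
  rewrite /a -(odd_double_half n) -addnn; case: odd; rewrite ?add1n ?add0n.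
    rewrite -addSn -addnS -!uE /= inner_norm; apply: le_trans (ZZ _) _.
    by rewrite mul1r.
  rewrite -addSn -!uE /= [leRHS]inner_norm; apply: le_trans (ZI _) _.
  by rewrite mul1r.
have ca : cvgn a.
  apply: nonincreasing_is_cvgn; first exact/nonincreasing_seqP.
  by exists 0 => _ [n _ <-].
have a_lim n : limn a <= a n.
  by apply: nonincreasing_cvgn_ge => //; exact/nonincreasing_seqP.
have /nonincreasing_seqP nia := a_ni.
have cu : cvgn u.
  apply: (@cauchy_dom _ _ u (fun n => Num.sqrt (a n - limn a))).
    rewrite -[X in _ --> X]sqrtr0.
    apply: cvg_comp; last exact: sqrt_continuous.
    by rewrite -(subrr (limn a)); apply: cvgB => //; exact: cvg_cst.
  move=> n m nm; rewrite -[leLHS]ger0_norm// -sqrtr_sqr ler_wsqrtr//.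
  (* The squared distance is [a (2 m) - 2 a (m + n) + a (2 n)], where [a (2 m)] and the limit are at
     most [a (m + n)], and [a (2 n) <= a n]. *)
  rewrite normB_sqr -!inner_norm !uE -/(a _) -/(a _) -/(a _).
  have := nia (m + n)%N (m + m)%N; rewrite leq_add2l => /(_ nm).
  have := a_lim (m + n)%N; have := nia _ _ (leq_addr n n).
  lra.
have Zl : Z (limn u) = limn u.
  apply: (@cvg_uniq _ _ (fun n => u n.+1)).
    by apply: (cvg_comp u Z cu); exact: lin_lipschitz_continuous (psd_opb lZ sZ ler01 Z0 ZI) _.
  by move: cu; rewrite -(cvg_shiftS u).
have l0 : limn u = 0.
  apply: Q_ker; have := Zl; rewrite /Z => /eqP.
  rewrite -subr_eq0 addrAC subrr add0r oppr_eq0 scaler_eq0 invr_eq0 gt_eqF//=.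
  by move=> /eqP.
have uQ n : exists y, x - u n = Q y.
  elim: n => [|n [y yE]]; first by exists 0; rewrite subrr (lin0 lQ).
  exists (y + M^-1 *: u n).
  by rewrite (linD lQ) (linZ lQ) -yE /= /Z opprB addrCA addrC.
move=> e0; have /cvgrPdist_lt /(_ _ e0) [N _ /(_ N (leqnn N))] := cu.
by rewrite l0 sub0r normrN => uN; have [y yE] := uQ N; exists y; rewrite -yE subKr.
Qed.

End dense_range.

(** * Hilbert-Schmidt operators *)

Section hs_theory.
Context (R : realType) (H : sepHilbertType R).
Implicit Types (A B C S : SymHS H) (X Y : H -> H) (x y z w : H).

Lemma SymHSD A B x : (A + B : SymHS H) x = A x + B x. Proof. by []. Qed.
Lemma SymHSB A B x : (A - B : SymHS H) x = A x - B x. Proof. by []. Qed.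
Lemma SymHSZ a A x : (a *: A : SymHS H) x = a *: A x. Proof. by []. Qed.
Lemma SymHS0 x : (0 : SymHS H) x = 0. Proof. by []. Qed.

Lemma SymHS_ext A B : (forall x, A x = B x) -> A = B.
Proof. by move=> AB; apply/val_inj/funext. Qed.

Lemma SymHS_Sym A : Sym H A.
Proof. by have /set_mem[] := SymHSP A. Qed.

Lemma SymHS_sa A x y : inner (A x) y = inner x (A y).
Proof. exact: (Sym_sa (SymHS_Sym A)). Qed.

Lemma SymHS_lin A : linear A.
Proof. exact: (Sym_lin (SymHS_Sym A)). Qed.

Lemma hs_sum_ge0 X : (0 <= hs_sum X)%E.
Proof. by apply: nneseries_ge0 => k _ _; rewrite lee_fin sqr_ge0. Qed.

Lemma hs_sumE A : hs_sum A = (`|A| ^+ 2)%:E.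
Proof.
have /set_mem[_ [_ fA]] := SymHSP A.
have f : hs_sum A \is a fin_num by rewrite ge0_fin_numE ?hs_sum_ge0.
by rewrite SymHS_normE /hs_norm sqr_sqrtr ?fine_ge0 ?hs_sum_ge0// fineK.
Qed.

Lemma symhsI X M : Sym H X -> (hs_sum X <= M%:E)%E -> X \in @symhs R H.
Proof.
move=> SX XM; rewrite inE; split => //; split; first by case: SX.
by apply: le_lt_trans XM _; rewrite ltry.
Qed.

Lemma hs_norm_le A (M : R) : 0 <= M -> (hs_sum A <= (M ^+ 2)%:E)%E -> `|A| <= M.
Proof. by move=> M0; rewrite hs_sumE lee_fin ler_sqr ?nnegrE. Qed.

Lemma hs_sum_basis_sa X e : Sym H X -> is_onb e ->
  (\sum_(k <oo) (`|X (e k)| ^+ 2)%:E)%E = hs_sum X.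
Proof. by move=> SX oe; apply: (hs_sum_basis oe (@onbP R H)); exact: Sym_sa. Qed.

Lemma hs_series e A : is_onb e ->
  series (fun k => `|A (e k)| ^+ 2) @ \oo --> `|A| ^+ 2.
Proof.
move=> oe.
have := hs_sum_basis_sa (SymHS_Sym A) oe; rewrite hs_sumE => E.
have h : (fun n => \sum_(0 <= k < n) (`|A (e k)| ^+ 2)%:E)%E @ \oo --> (`|A| ^+ 2)%:E.
  by rewrite -E; apply: is_cvg_nneseries => k _ _; rewrite lee_fin sqr_ge0.
by move: h; under eq_fun do rewrite sumEFin; exact: fine_cvg.
Qed.

Arguments hs_series [e] A oe.

(** Parseval for [A x], with [A] moved onto the basis and Cauchy-Schwarz in each term. *)
Lemma hs_opb A : opb A `|A|.
Proof.
move=> x; rewrite -ler_sqr ?nnegrE ?mulr_ge0// exprMn.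
have h1 := @parseval _ _ _ (@onbP R H) (A x) (A x); rewrite inner_norm in h1.
have h2 : (fun n => series (fun k => `|A (onb H k)| ^+ 2) n * `|x| ^+ 2) @ \oo --> `|A| ^+ 2 * `|x| ^+ 2.
  by apply: cvgM; [exact: (hs_series _ (@onbP R H))|exact: cvg_cst].
apply: (cvg_le h1 h2) => n.
rewrite /series/= mulr_suml; apply: ler_sum => k _.
rewrite -expr2 SymHS_sa -exprMn -ler_sqrt ?sqr_ge0// !sqrtr_sqr.
rewrite [leRHS]ger0_norm ?mulr_ge0// mulrC.
exact: cauchy_schwarz.
Qed.

(** Defined by polarization of the norm, which makes continuity immediate; bilinearity then comes
    from the expansion in a basis, [hs_ip_series]. *)
Definition hs_ip A B : R := (`|A + B| ^+ 2 - `|A - B| ^+ 2) / 4.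

Lemma hs_ip_series e A B : is_onb e ->
  series (fun k => inner (A (e k)) (B (e k))) @ \oo --> hs_ip A B.
Proof.
move=> oe.
rewrite (_ : series _ = fun n =>
    (series (fun k => `|(A + B : SymHS H) (e k)| ^+ 2) n -
     series (fun k => `|(A - B : SymHS H) (e k)| ^+ 2) n) / 4); last first.
  apply/funext => n; rewrite /series /= -sumrB mulr_suml.
  by apply: eq_bigr => k _; rewrite !fctE normD_sqr normB_sqr; field.
by apply: cvgM; [apply: cvgB; exact: hs_series|exact: cvg_cst].
Qed.

Arguments hs_ip_series [e] A B oe.

Lemma hs_ipC A B : hs_ip A B = hs_ip B A.
Proof. by rewrite /hs_ip (addrC B A) -(normrN (B - A)) opprB. Qed.

Lemma hs_ip_linl B a A A' : hs_ip (a *: A + A') B = a * hs_ip A B + hs_ip A' B.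
Proof.
have oe := @onbP R H.
apply: (cvg_uniq (hs_ip_series _ _ oe)).
rewrite (_ : series _ = fun n => a * series (fun k => inner (A (onb H k)) (B (onb H k))) n +
     series (fun k => inner (A' (onb H k)) (B (onb H k))) n); last first.
  apply/funext => n; rewrite /series /= mulr_sumr -big_split.
  by apply: eq_bigr => k _ /=; rewrite innerDl innerZl.
apply: cvgD; last exact: hs_ip_series.
by apply: cvgM; [exact: cvg_cst|exact: hs_ip_series].
Qed.

Lemma hs_ip0l B : hs_ip 0 B = 0.
Proof. by have := hs_ip_linl B (-1) 0 0; rewrite scaler0 addr0 mulN1r addNr. Qed.

Lemma hs_ipZl a A B : hs_ip (a *: A) B = a * hs_ip A B.
Proof. by have := hs_ip_linl B a A 0; rewrite !addr0 hs_ip0l addr0. Qed.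

Lemma hs_ipDl A A' B : hs_ip (A + A') B = hs_ip A B + hs_ip A' B.
Proof. by have := hs_ip_linl B 1 A A'; rewrite scale1r mul1r. Qed.

Lemma hs_ipNl A B : hs_ip (- A) B = - hs_ip A B.
Proof. by rewrite -scaleN1r hs_ipZl mulN1r. Qed.

Lemma hs_ipBl A A' B : hs_ip (A - A') B = hs_ip A B - hs_ip A' B.
Proof. by rewrite hs_ipDl hs_ipNl. Qed.

Lemma hs_ipZr a A B : hs_ip B (a *: A) = a * hs_ip B A.
Proof. by rewrite hs_ipC hs_ipZl hs_ipC. Qed.

Lemma hs_ipDr A A' B : hs_ip B (A + A') = hs_ip B A + hs_ip B A'.
Proof. by rewrite hs_ipC hs_ipDl !(hs_ipC _ B). Qed.

Lemma hs_ipNr A B : hs_ip B (- A) = - hs_ip B A.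
Proof. by rewrite hs_ipC hs_ipNl hs_ipC. Qed.

Lemma hs_ipBr A A' B : hs_ip B (A - A') = hs_ip B A - hs_ip B A'.
Proof. by rewrite hs_ipDr hs_ipNr. Qed.

Lemma hs_ip_sumr I (r : seq I) (F : I -> SymHS H) B :
  hs_ip B (\sum_(i <- r) F i) = \sum_(i <- r) hs_ip B (F i).
Proof.
elim: r => [|i r ih]; first by rewrite !big_nil hs_ipC hs_ip0l.
by rewrite !big_cons hs_ipDr ih.
Qed.

Lemma hs_ip_norm A : hs_ip A A = `|A| ^+ 2.
Proof.
apply: (cvg_uniq (hs_ip_series A A (@onbP R H))).
under [X in X @ _ --> _]eq_fun do under eq_bigr do rewrite inner_norm.
exact: (hs_series _ (@onbP R H)).
Qed.

Lemma hs_ip_le A B : `|hs_ip A B| <= `|A| * `|B|.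
Proof.
have [->|B0] := eqVneq B 0; first by rewrite hs_ipC hs_ip0l !normr0 mulr0.
have nB0 : 0 < `|B| by rewrite normr_gt0.
rewrite -ler_sqr ?nnegrE ?mulr_ge0// real_normK ?num_real// [leRHS]exprMn.
have : 0 <= hs_ip (`|B| ^+ 2 *: A - hs_ip A B *: B) (`|B| ^+ 2 *: A - hs_ip A B *: B).
  by rewrite hs_ip_norm sqr_ge0.
rewrite !(hs_ipBl, hs_ipBr, hs_ipZl, hs_ipZr) (hs_ipC B A) !hs_ip_norm => h.
have {h} : 0 <= `|B| ^+ 2 * (`|A| ^+ 2 * `|B| ^+ 2 - hs_ip A B ^+ 2).
  apply: le_trans h _; rewrite le_eqVlt; apply/orP; left; apply/eqP.
  by ring.
by rewrite pmulr_rge0 ?exprn_gt0// subr_ge0.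
Qed.

Lemma cvg_hs_ip (u v : nat -> SymHS H) A B : u @ \oo --> A -> v @ \oo --> B ->
  hs_ip (u n) (v n) @[n --> \oo] --> hs_ip A B.
Proof.
move=> uA vB; rewrite /hs_ip; apply: cvgM; last exact: cvg_cst.
by apply: cvgB; apply: cvg_norm_sqr; [exact: cvgD|exact: cvgB].
Qed.

(** The default value is 0 when [X] is not self-adjoint and Hilbert-Schmidt, so membership is
    established at each use, through [mkHSE]. *)
Definition mkHS X : SymHS H := insubd 0 X.

Lemma mkHSE X : X \in @symhs R H -> mkHS X = X :> (H -> H).
Proof. by move=> hX; rewrite /mkHS; exact: (insubdK _ hX). Qed.

Lemma Sym_id : Sym H idfun.
Proof. by apply: (@SymI _ _ _ 1) => // x; rewrite mul1r. Qed.

Lemma opb_id : opb (idfun : H -> H) 1. Proof. by move=> x; rewrite mul1r. Qed.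

(** A left factor is bounded term by term; a right factor is brought to the left by [hs_sum_basis],
    [A \o Y] and [Y \o A] being adjoint to each other. *)
Lemma hs_sum_sandwich X Y (a b : R) A : Sym H X -> Sym H Y -> opb X a -> opb Y b ->
  0 <= a -> 0 <= b -> (hs_sum (X \o A \o Y) <= ((a * b * `|A|) ^+ 2)%:E)%E.
Proof.
move=> SX SY Xa Yb a0 b0.
have left (X' A' : H -> H) a' : opb X' a' -> 0 <= a' -> (hs_sum (X' \o A') <= (a' ^+ 2)%:E * hs_sum A')%E.
  move=> Xa' a0'; rewrite /hs_sum -nneseriesZl; last by move=> k _; rewrite lee_fin sqr_ge0.
  apply: lee_nneseries => k _; first by rewrite lee_fin sqr_ge0.
  by rewrite -EFinM lee_fin -exprMn ler_sqr ?nnegrE ?mulr_ge0//; exact: Xa'.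
apply: le_trans (left X (A \o Y) _ Xa a0) _.
have -> : hs_sum (A \o Y) = hs_sum (Y \o A).
  apply: (hs_sum_basis (@onbP R H) (@onbP R H)) => x y /=.
  by rewrite SymHS_sa (Sym_sa SY).
apply: le_trans (lee_pmul _ _ (lexx _) (left Y A _ Yb b0)) _.
- by rewrite lee_fin sqr_ge0.
- exact: hs_sum_ge0.
by rewrite hs_sumE -!EFinM lee_fin !exprMn mulrA.
Qed.

Definition hs_conj X A := mkHS (X \o A \o X).

Lemma hs_conj_symhs X A : Sym H X -> X \o A \o X \in @symhs R H.
Proof.
move=> SX; have [a a0 Xa] := Sym_opb SX.
apply: symhsI; last exact: (hs_sum_sandwich _ SX SX Xa Xa (ltW a0) (ltW a0)).
apply: (@SymI _ _ _ (a * (`|A| * a))).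
- by move=> b x y /=; rewrite (Sym_lin SX) SymHS_lin (Sym_lin SX).
- move=> x /=; apply: le_trans (Xa _) _; rewrite -!mulrA ler_wpM2l ?(ltW a0)//.
  by apply: le_trans (hs_opb _ _) _; rewrite ler_wpM2l.
- by move=> x y /=; rewrite (Sym_sa SX) SymHS_sa (Sym_sa SX).
Qed.

Lemma hs_conjE X A x : Sym H X -> hs_conj X A x = X (A (X x)).
Proof. by move=> SX; rewrite /hs_conj mkHSE ?hs_conj_symhs. Qed.

Lemma hs_conj_norm X A a : Sym H X -> opb X a -> 0 <= a -> `|hs_conj X A| <= a ^+ 2 * `|A|.
Proof.
move=> SX Xa a0; apply: hs_norm_le; first by rewrite mulr_ge0// sqr_ge0.
by rewrite /hs_conj mkHSE ?hs_conj_symhs// expr2; exact: hs_sum_sandwich.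
Qed.

Lemma hs_conj_lin X : Sym H X -> linear (hs_conj X).
Proof.
move=> SX a A B; apply: SymHS_ext => x.
by rewrite SymHSD SymHSZ !hs_conjE// SymHSD SymHSZ (Sym_lin SX).
Qed.

Lemma hs_conj_continuous X : Sym H X -> continuous (hs_conj X).
Proof.
move=> SX; have [a a0 Xa] := Sym_opb SX.
apply: (@lin_lipschitz_continuous _ _ _ _ (hs_conj_lin SX) (a ^+ 2)) => A.
by apply: hs_conj_norm => //; exact: ltW.
Qed.

Definition tens w := mkHS (tensor w w).

Lemma tensE w x : tens w x = inner w x *: w.
Proof.
rewrite /tens mkHSE//; apply: (@symhsI _ (`|w| ^+ 2 * `|w| ^+ 2)).
  apply: (@SymI _ _ _ (`|w| * `|w|)).
  - by move=> a x' y; rewrite /tensor innerDr innerZr scalerDl scalerA.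
  - move=> y; rewrite /tensor normrZ -mulrA mulrC -[leRHS]mulrC -!mulrA mulrC [leRHS]mulrC.
    by rewrite ler_wpM2r// mulrC; exact: cauchy_schwarz.
  - by move=> x' y; rewrite /tensor innerZl innerZr (innerC x') mulrC.
rewrite EFinM -[X in (_ <= _ * X)%E](parseval_sqr (@onbP R H)) -nneseriesZl; last first.
  by move=> k _; rewrite lee_fin sqr_ge0.
rewrite le_eqVlt; apply/orP; left; apply/eqP; apply: eq_eseriesr => k _.
by rewrite /tensor normrZ exprMn real_normK ?num_real// EFinM muleC.
Qed.

Lemma hs_ip_tens A w : hs_ip A (tens w) = inner (A w) w.
Proof.
apply: (cvg_uniq (hs_ip_series A (tens w) (@onbP R H))).
have := @parseval _ _ _ (@onbP R H) (A w) w.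
apply: cvg_trans; apply: near_eq_cvg; apply: nearW => n /=.
rewrite /series/=; apply: eq_bigr => k _.
by rewrite tensE innerZr mulrC (SymHS_sa A w) (innerC w (A _)).
Qed.

Lemma hs_conj_tens X w : Sym H X -> hs_conj X (tens w) = tens (X w).
Proof.
move=> SX; apply: SymHS_ext => x.
by rewrite hs_conjE// !tensE (linZ (Sym_lin SX)) (Sym_sa SX).
Qed.

(** With [p], [q] the squared norms, [c] the inner product and [s] the product of the norms, the
    claim squared is [p^2 + q^2 - 2 c^2 <= (p + q + 2 s) (p + q - 2 c)]. Replacing [s] by [c <= s]
    leaves [c^2 <= p q]. *)
Lemma tens_dist w w' : `|tens w - tens w'| <= (`|w| + `|w'|) * `|w - w'|.
Proof.
rewrite -ler_sqr ?nnegrE ?mulr_ge0 ?addr_ge0//.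
rewrite -hs_ip_norm hs_ipBl !hs_ipBr !hs_ip_tens !tensE !innerZl (innerC w' w).
rewrite exprMn normB_sqr sqrrD -!inner_norm.
have := cauchy_schwarz w w'; have := inner_le w w'.
rewrite -(@ler_sqr _ `|inner w w'|) ?nnegrE ?mulr_ge0// real_normK ?num_real//.
rewrite exprMn -!inner_norm.
set p := inner w w; set q := inner w' w'; set c := inner w w'.
move=> h1 h2; set s := `|w| * `|w'| in h1 *.
have h4 : 0 <= p - 2 * c + q by rewrite /p /q !inner_norm -normB_sqr sqr_ge0.
have : 2 * c * (p - 2 * c + q) <= s *+ 2 * (p - 2 * c + q).
  by rewrite ler_wpM2r// mulr2n; lra.
by rewrite expr2 in h2; rewrite mulr2n; nra.
Qed.

End hs_theory.
Arguments hs_series {R H e} A oe.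
Arguments hs_ip_series {R H e} A B oe.

(** * Finite combinations of rank-one operators *)

Section forms.
Context (R : realType) (H : sepHilbertType R).
Implicit Types (A B : SymHS H) (l : seq (R * H)) (x y z w : H).

(** Finite combinations are kept as lists of coefficients and vectors: the same list is read as an
    operator, a quadratic function of [x] or a number, according to [F]. In [form_op] the list holds
    [y] and not [Q y], since the random variables are the [inner x y]. *)
Definition lsum (V : lmodType R) (F : H -> V) l : V := \sum_(p <- l) p.1 *: F p.2.

Definition form_op (Q : H -> H) l : SymHS H := lsum (fun y => tens (Q y)) l.

Definition scale_list (a : R) l := [seq (a * p.1, p.2) | p <- l].

Lemma lsum_cat (V : lmodType R) (F : H -> V) l l' :
  lsum F (l ++ l') = lsum F l + lsum F l'.
Proof. exact: big_cat. Qed.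

Lemma lsum_scale (V : lmodType R) (F : H -> V) a l :
  lsum F (scale_list a l) = a *: lsum F l.
Proof.
by rewrite /lsum big_map scaler_sumr; apply: eq_bigr => p _; rewrite scalerA.
Qed.

Lemma lsum_cons (V : lmodType R) (F : H -> V) p l :
  lsum F (p :: l) = p.1 *: F p.2 + lsum F l.
Proof. exact: big_cons. Qed.

Lemma lsum_nil (V : lmodType R) (F : H -> V) : lsum F [::] = 0.
Proof. exact: big_nil. Qed.

(* By polarization, [lsum F (polar_list a y N)] is
   [\sum_(j, k < N) a j k *: B (y j) (y k)] when [F y = B y y] with [B] bilinear symmetric. *)
Definition polar_list (a : nat -> nat -> R) (y : nat -> H) N : seq (R * H) :=
  [seq (a j k / 4, y j + y k) | j <- index_iota 0 N, k <- index_iota 0 N] ++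
  [seq (- (a j k / 4), y j - y k) | j <- index_iota 0 N, k <- index_iota 0 N].

Lemma lsum_polar (V : lmodType R) (F : H -> V) a (y : nat -> H) N :
  lsum F (polar_list a y N) =
  \sum_(0 <= j < N) \sum_(0 <= k < N) (a j k / 4) *: (F (y j + y k) - F (y j - y k)).
Proof.
rewrite lsum_cat /lsum !big_allpairs_dep -big_split; apply: eq_bigr => j _ /=.
rewrite -big_split; apply: eq_bigr => k _ /=.
by rewrite scalerBr scaleNr.
Qed.

Lemma lsum_polar_bilin (F : H -> R^o) (B : H -> H -> R) a (y : nat -> H) N :
  (forall u v, F (u + v) - F (u - v) = 4 * B u v) ->
  lsum F (polar_list a y N) =
  \sum_(0 <= j < N) \sum_(0 <= k < N) a j k * B (y j) (y k).
Proof.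
move=> FB; rewrite lsum_polar; apply: eq_bigr => j _; apply: eq_bigr => k _.
by rewrite FB /GRing.scale/= mulrA divfK.
Qed.

Lemma hs_ip_form B Q l : hs_ip B (form_op Q l) = lsum (fun y => inner (B (Q y)) (Q y) : R^o) l.
Proof.
by rewrite /form_op /lsum hs_ip_sumr; apply: eq_bigr => p _; rewrite hs_ipZr hs_ip_tens.
Qed.

Section truncation.
Variables (e : nat -> H) (oe : is_onb e) (A : SymHS H).

(** The compression of [A] to the span of the first [N] basis vectors, written as a combination of
    [tens]. *)
Definition trunc N : SymHS H :=
  form_op idfun (polar_list (fun j k => inner (A (e j)) (e k)) e N).

Lemma hs_ip_trunc B N : hs_ip B (trunc N) =
  \sum_(0 <= j < N) \sum_(0 <= k < N) inner (A (e j)) (e k) * inner (B (e j)) (e k).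
Proof.
rewrite hs_ip_form (@lsum_polar_bilin _ (fun u v => inner (B u) v))// => u v /=.
rewrite (linB (SymHS_lin B)) (linD (SymHS_lin B)) !(innerDl, innerDr, innerNl, innerNr).
by rewrite [inner (B v) u]SymHS_sa (innerC v); ring.
Qed.

Let f N : R := \sum_(0 <= j < N) \sum_(0 <= k < N) inner (A (e j)) (e k) ^+ 2.

Let sum_delta i N (g : nat -> R) : (i < N)%N -> \sum_(0 <= j < N) (j == i)%:R * g j = g i.
Proof.
move=> iN; rewrite (bigD1_seq i)/= ?mem_index_iota ?iota_uniq// eqxx mul1r.
by rewrite big1 ?addr0// => j /negbTE ->; rewrite mul0r.
Qed.

(** The coefficient is the Hilbert-Schmidt inner product with the symmetrized product of [e i] and
    [e l], which polarization writes with two [tens]. *)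
Let trunc_coef (i l N : nat) : (i < N)%N -> (l < N)%N ->
  inner (trunc N (e i)) (e l) = inner (A (e i)) (e l).
Proof.
move=> iN lN.
have -> : inner (trunc N (e i)) (e l) =
    hs_ip (4^-1 *: (tens (e i + e l) - tens (e i - e l))) (trunc N).
  rewrite hs_ipC hs_ipZr hs_ipBr !hs_ip_tens.
  set T := trunc N; rewrite (linB (SymHS_lin T)) (linD (SymHS_lin T)).
  rewrite !(innerDl, innerDr, innerNl, innerNr).
  by rewrite [inner (T (e l)) (e i)]SymHS_sa (innerC (e l)); field.
rewrite hs_ip_trunc.
under eq_bigr => j _.
  under eq_bigr => k _.
    rewrite SymHSZ SymHSB !tensE innerZl innerBl !innerZl.
    rewrite !(innerDl, innerNl) !oe.1.
    rewrite (_ : _ * _ = (k == l)%:R * ((j == i)%:R * (inner (A (e j)) (e k) / 2)) +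
        (k == i)%:R * ((j == l)%:R * (inner (A (e j)) (e k) / 2))); last first.
      by rewrite !(eq_sym _ j) !(eq_sym _ k); field.
    over.
  rewrite big_split /= !sum_delta//; over.
rewrite big_split /= !sum_delta// [inner (A (e l)) _]SymHS_sa (innerC (e l)).
by field.
Qed.

Let trunc_norm N : `|trunc N| ^+ 2 = f N.
Proof.
rewrite -hs_ip_norm hs_ip_trunc; apply: eq_big_nat => i /andP[_ iN].
by apply: eq_big_nat => l /andP[_ lN]; rewrite trunc_coef.
Qed.

(** Pythagoras: [hs_ip A (trunc N)] equals the squared norm of [trunc N]. *)
Let trunc_dist N : `|trunc N - A| ^+ 2 = `|A| ^+ 2 - f N.
Proof.
rewrite -!hs_ip_norm hs_ipBl !hs_ipBr [hs_ip (trunc N) A]hs_ipC.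
have -> : hs_ip A (trunc N) = f N.
  by rewrite hs_ip_trunc; do 2 (apply: eq_bigr => ? _); rewrite expr2.
by rewrite hs_ip_norm trunc_norm; ring.
Qed.

Let f_nd : nondecreasing_seq f.
Proof.
move=> n m nm; rewrite /f [leRHS](@big_cat_nat _ _ _ n)//=.
rewrite ler_wpDr ?sumr_ge0//.
  by move=> j _; apply: sumr_ge0 => k _; exact: sqr_ge0.
apply: ler_sum => j _; rewrite [leRHS](@big_cat_nat _ _ _ n)//=.
by rewrite ler_wpDr ?sumr_ge0// => k _; exact: sqr_ge0.
Qed.

Let f_le N : f N <= `|A| ^+ 2.
Proof. by rewrite -subr_ge0 -trunc_dist sqr_ge0. Qed.

Lemma trunc_cvg : trunc @ \oo --> A.
Proof.
have cf : cvgn f.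
  by apply: nondecreasing_is_cvgn => //; exists (`|A| ^+ 2) => _ [n _ <-].
have lf n : f n <= limn f by exact: nondecreasing_cvgn_le.
have fA : limn f = `|A| ^+ 2.
  apply/eqP; rewrite eq_le; apply/andP; split.
    by apply: (cvg_le_cst cf); exact: nearW.
  (* For fixed [K], the sum of the first [K] rows is the limit of the sums over [j < K] and [k < n],
     each at most [f n] once [K <= n]. *)
  apply: (cvg_le_cst (hs_series A oe)); apply: nearW => K.
  have h : (fun n => \sum_(0 <= j < K) series (fun k => inner (A (e j)) (e k) ^+ 2) n) @ \oo -->
      series (fun k => `|A (e k)| ^+ 2) K.
    apply: cvg_big => [p|j _]; first exact: add_continuous.
    rewrite -inner_norm; exact: parseval.
  apply: (cvg_le_cst h).
  near=> n; apply: le_trans (lf n).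
  have Kn : (K <= n)%N by near: n; exact: nbhs_infty_ge.
  rewrite /f [leRHS](@big_cat_nat _ _ _ K)//= ler_wpDr ?sumr_ge0//.
  by move=> j _; apply: sumr_ge0 => k _; exact: sqr_ge0.
apply: (@cvg_dom0 _ _ _ _ (fun N => Num.sqrt (`|A| ^+ 2 - f N))).
  rewrite -[X in _ --> X]sqrtr0.
  apply: cvg_comp; last exact: sqrt_continuous.
  by rewrite -(subrr (`|A| ^+ 2)); apply: cvgB; [exact: cvg_cst|rewrite -fA].
by move=> n; rewrite -trunc_dist sqrtr_sqr ger0_norm.
Unshelve. all: by end_near. Qed.

End truncation.

Section density.
Variable Q : H -> H.
Hypotheses (PQ : SymP H Q) (Q_ker : forall x, Q x = 0 -> x = 0).

Let approx_form l (eps : R) : 0 < eps ->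
  exists l', `|form_op idfun l - form_op Q l'| < eps.
Proof.
elim: l eps => [|[a w] l ih] eps e0.
  by exists [::]; rewrite /form_op !lsum_nil subrr normr0.
have [l' hl'] := ih (eps / 2) (divr_gt0 e0 (ltr0n _ 2)).
(* When [Q y] is within 1 of [w], the factor of [tens_dist] is at most twice the norm of [w] plus 1;
   the last 1 makes [K] positive. *)
pose K := `|a| * (2 * `|w| + 1) + 1.
have K0 : 0 < K by rewrite ltr_wpDl// mulr_ge0// addr_ge0// mulr_ge0.
have d0 : 0 < Num.min 1 (eps / 2 / K) by rewrite lt_min ltr01/= !divr_gt0.
have [y yE] := range_dense PQ Q_ker w d0.
exists ((a, y) :: l'); rewrite /form_op !lsum_cons /= opprD addrACA.
rewrite -scalerBr; apply: le_lt_trans (ler_normD _ _) _.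
rewrite [ltRHS](splitr eps) ltr_leD//; last exact: ltW.
rewrite normrZ.
move: yE; rewrite lt_min => /andP[y1 y2].
have yw : `|Q y| <= `|w| + 1.
  rewrite -[Q y](subKr w) (le_trans (ler_normB _ _))// lerD2l; exact: ltW.
apply: (@le_lt_trans _ _ (`|a| * ((2 * `|w| + 1) * `|w - Q y|))).
  rewrite ler_wpM2l// (le_trans (tens_dist _ _))// ler_wpM2r//; lra.
rewrite mulrA; apply: (@le_lt_trans _ _ (K * `|w - Q y|)).
  by rewrite ler_wpM2r// lerDl.
by rewrite mulrC -ltr_pdivlMr.
Qed.

Lemma dense_forms A (eps : R) : 0 < eps -> exists l, `|A - form_op Q l| < eps.
Proof.
move=> e0; have e2 : 0 < eps / 2 by rewrite divr_gt0.
have /cvgrPdist_lt /(_ _ e2) [N _ /(_ N (leqnn N)) AN] := trunc_cvg (A := A) (@onbP R H).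
have [l hl] := approx_form (polar_list (fun j k => inner (A (onb H j)) (onb H k)) (onb H) N) e2.
exists l; apply: le_lt_trans (ler_distD (trunc (onb H) A N) _ _) _.
by rewrite [eps]splitr ltrD.
Qed.

End density.
End forms.

(** * The resolvent of I - S *)

Section ultra.

Lemma ultra_fmap (T U : Type) (f : T -> U) (F : set_system T) :
  UltraFilter F -> UltraFilter (f @ F).
Proof.
move=> FU; split; first exact: fmap_proper_filter.
move=> G GF FG; apply/seteqP; split; last exact: FG.
move=> A GA; have [//|nA] := in_ultra_setVsetC (f @^-1` A) FU.
have : G (~` A) by apply: FG.
by move=> /(filterI GA); rewrite setICr => /filter_ex[].
Qed.

Lemma ultra_bounded_cvg (R : realType) (T : Type) (F : set_system T) (f : T -> R) (M : R) :
  UltraFilter F -> (forall t, `|f t| <= M) -> exists l : R, f @ F --> l.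
Proof.
move=> FU fM; have := @segment_compact R (- M) M; rewrite compact_ultra.
move=> /(_ (f @ F) (ultra_fmap f FU)) [|l [_ fl]].
  by apply: (@filterE _ F) => t /=; rewrite in_itv /= -ler_norml.
by exists l.
Qed.

Lemma near_forall_ltn (T : Type) (F : set_system T) (P : nat -> T -> Prop) :
  Filter F -> (forall k, \forall t \near F, P k t) ->
  forall K, \forall t \near F, forall k, (k < K)%N -> P k t.
Proof.
move=> FF FP; elim=> [|K ih]; first exact: filterE.
apply: filterS2 ih (FP K) => t h1 h2 k.
by rewrite ltnS leq_eqVlt => /predU1P[->//|]; exact: h1.
Qed.

End ultra.

Section ltI.
Context (R : realType) (H : sepHilbertType R).
Implicit Types (S T V : SymHS H) (x y : H).

Lemma idB_Sym S : Sym H (idfun \- S).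
Proof.
apply: (@SymI _ _ _ (1 + `|S|)).
- by move=> a x y /=; rewrite SymHS_lin scalerBr opprD addrACA.
- move=> x /=; apply: le_trans (ler_normB _ _) _.
  by rewrite mulrDl mul1r lerD2l hs_opb.
- by move=> x y /=; rewrite innerBl innerBr SymHS_sa.
Qed.

(** The bound on the tail of the expansion of [S x] is uniform over bounded [x]: this is the form in
    which compactness of [S] is used. *)
Lemma hs_tail S x K : `|S x| ^+ 2 <= \sum_(0 <= k < K) inner (S x) (onb H k) ^+ 2 +
  `|x| ^+ 2 * (`|S| ^+ 2 - \sum_(0 <= k < K) `|S (onb H k)| ^+ 2).
Proof.
have h := @parseval _ _ _ (@onbP R H) (S x) (S x); rewrite inner_norm in h.
apply: (cvg_le_cst h); near=> n.
have Kn : (K <= n)%N by near: n; exact: nbhs_infty_ge.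
rewrite /series /= (@big_cat_nat _ _ _ K)//= lerD2l.
apply: (@le_trans _ _ (`|x| ^+ 2 * \sum_(K <= k < n) `|S (onb H k)| ^+ 2)).
  rewrite mulr_sumr; apply: ler_sum => k _; rewrite -expr2 SymHS_sa -exprMn.
  by rewrite -ler_sqrt ?sqr_ge0// !sqrtr_sqr [leRHS]ger0_norm ?mulr_ge0// cauchy_schwarz.
rewrite ler_wpM2l ?sqr_ge0// lerBrDl.
have nd : nondecreasing_seq (series (fun k => `|S (onb H k)| ^+ 2)).
  apply/nondecreasing_seqP => m; rewrite /series/= big_nat_recr//= lerDl.
  exact: sqr_ge0.
have c := hs_series S (@onbP R H).
have := nondecreasing_cvgn_le nd (cvgP _ c) n; rewrite (cvg_lim (@Rhausdorff R) c).
by rewrite /series/= (@big_cat_nat _ _ _ K).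
Unshelve. all: by end_near. Qed.

(* Convergence of all coordinates along an ultrafilter stands for the weak
   compactness of the unit ball. *)
Lemma hs_ultra_cvg S (x_ : nat -> H) (U : set_system nat) : UltraFilter U ->
  (forall n, `|x_ n| = 1) -> exists s : H, S (x_ n) @[n --> U] --> s.
Proof.
move=> UU x1; have PU : ProperFilter U by exact: ultra_proper.
suff : cauchy (S (x_ n) @[n --> U]) by move/cauchy_cvgP => c; exists (lim (S (x_ n) @[n --> U])).
apply: cauchy_exP => eps e0.
pose tau K := `|S| ^+ 2 - series (fun k => `|S (onb H k)| ^+ 2) K.
have tau0 : tau @ \oo --> 0.
  rewrite -(subrr (`|S| ^+ 2)); apply: cvgB; first exact: cvg_cst.
  exact: hs_series (@onbP R H).
(* The first [K] coordinates will contribute at most [eps ^+ 2 / 8], and the tail at most four times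
   that, two unit vectors being at distance at most 2. *)
have e8 : 0 < eps ^+ 2 / 8 by rewrite divr_gt0// exprn_gt0.
have /cvgrPdist_lt/(_ _ e8) [K _ /(_ K (leqnn K))] := tau0.
rewrite sub0r normrN => /(le_lt_trans (ler_norm _)) tauK.
have xi k : exists l : R, inner (S (x_ n)) (onb H k) @[n --> U] --> l.
  apply: (@ultra_bounded_cvg _ _ _ _ `|S|) => // n.
  apply: le_trans (cauchy_schwarz _ _) _.
  rewrite [X in _ * X](_ : _ = 1).
    by rewrite mulr1; apply: le_trans (hs_opb _ _) _; rewrite x1 mulr1.
  apply/eqP; rewrite -sqrp_eq1// -inner_norm (@onbP R H).1 eqxx; exact: eqxx.
have [l lP] : exists l : nat -> R, forall k, inner (S (x_ n)) (onb H k) @[n --> U] --> l k.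
  by exists (fun k => sval (cid (xi k))) => k; exact: svalP (cid (xi k)).
(* The budget shared among [K] coordinates; [K.+1] covers the case [K = 0]. *)
pose d := eps ^+ 2 / 8 / K.+1%:R.
have d0 : 0 < d by rewrite divr_gt0.
have sd2 : 0 < Num.sqrt d / 2 by rewrite divr_gt0// sqrtr_gt0.
have nU : \forall n \near U, forall k, (k < K)%N ->
    `|l k - inner (S (x_ n)) (onb H k)| < Num.sqrt d / 2.
  apply: near_forall_ltn => k.
  by have /cvgrPdist_lt := lP k; apply.
have [n0 hn0] := filter_ex nU.
exists (S (x_ n0)); apply: filterS nU => n hn.
rewrite /= -ball_normE /= -(linB (SymHS_lin S)) -ltr_sqr ?nnegrE ?(ltW e0)//.
apply: le_lt_trans (hs_tail S _ K) _.
have h1 : \sum_(0 <= k < K) inner (S (x_ n0 - x_ n)) (onb H k) ^+ 2 <= eps ^+ 2 / 8.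
  apply: (@le_trans _ _ (\sum_(0 <= k < K) d)); last first.
    rewrite sumr_const_nat subn0; apply: (@le_trans _ _ (d * K.+1%:R)).
      by rewrite -[leLHS]mulr_natr ler_wpM2l ?(ltW d0)// ler_nat.
    by rewrite divfK// pnatr_eq0.
  rewrite big_nat [leRHS]big_nat; apply: ler_sum => k /andP[_ kK].
  rewrite -[leRHS]sqr_sqrtr ?(ltW d0)// -ler_sqrt ?sqr_ge0// !sqrtr_sqr.
  rewrite [leRHS]ger0_norm ?sqrtr_ge0// (linB (SymHS_lin S)) innerBl.
  apply: ltW; rewrite [ltRHS]splitr; apply: le_lt_trans (ler_distD (l k) _ _) _.
  by rewrite ltrD ?hn// distrC hn0.
have h2 : `|x_ n0 - x_ n| ^+ 2 <= 4.
  have := ler_normB (x_ n0) (x_ n); rewrite !x1.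
  have := normr_ge0 (x_ n0 - x_ n); rewrite expr2; nra.
have h3 : `|x_ n0 - x_ n| ^+ 2 * tau K <= 4 * (eps ^+ 2 / 8).
  apply: le_trans (ler_wpM2l (sqr_ge0 _) (ltW tauK)) _.
  by rewrite ler_wpM2r// ltW.
apply: le_lt_trans (lerD h1 h3) _.
have := exprn_gt0 2 e0; lra.
Qed.

(** Otherwise there are unit vectors [x_ n] along which the form of [I - S] tends to 0, hence
    [(I - S) (x_ n)] tends to 0 by [psd_sqr_le]. Along an ultrafilter [S (x_ n)] converges, so
    [x_ n] converges to the same limit [s], a unit vector with [S s = s], against positivity. *)
Lemma ltI_coercive S : SymHS_ltI S -> exists2 c, 0 < c & coercive (idfun \- S) c.
Proof.
move=> [_ Spos]; apply: contrapT => /forall2NP nc.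
have ex n : exists x, `|x| = 1 /\ inner ((idfun \- S) x) x <= n.+1%:R^-1.
  have [|/existsNP[x]] := nc n.+1%:R^-1; first by rewrite invr_gt0 ltr0n.
  move=> /negP; rewrite -ltNge => hx.
  have [x0|x0] := eqVneq x 0.
    by move: hx; rewrite x0 inner0r normr0 expr0n/= mulr0 ltxx.
  have nx0 : 0 < `|x| by rewrite normr_gt0.
  exists (`|x|^-1 *: x); split.
    by rewrite normrZ ger0_norm ?invr_ge0// mulVf// gt_eqF.
  rewrite (linZ (Sym_lin (idB_Sym S))) innerZl innerZr mulrA -invfM mulrC.
  by rewrite ler_pdivrMr ?mulr_gt0// -expr2 ltW.
pose x_ n := sval (cid (ex n)).
have x1 n : `|x_ n| = 1 by have [] := svalP (cid (ex n)).
have xS n : inner ((idfun \- S) (x_ n)) (x_ n) <= n.+1%:R^-1.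
  by have [] := svalP (cid (ex n)).
have [U [UU sU]] := ultraFilterLemma (@eventually_filter).
have PU : ProperFilter U by exact: ultra_proper.
have [s sP] := hs_ultra_cvg S UU x1.
have S0 x : 0 <= inner ((idfun \- S) x) x.
  by have [->|x0] := eqVneq x 0; [rewrite inner0r|rewrite innerC ltW// Spos].
have [M M0 SM] := Sym_opb (idB_Sym S).
have lI := Sym_lin (idB_Sym S); have sI := Sym_sa (idB_Sym S).
have d0 : (idfun \- S) (x_ n) @[n --> \oo] --> (0 : H).
  apply: (@cvg_dom0 _ _ _ _ (fun n => Num.sqrt (M * n.+1%:R^-1))).
    rewrite -[X in _ --> X]sqrtr0 -[X in Num.sqrt X](mulr0 M).
    apply: cvg_comp; last exact: sqrt_continuous.
    by apply: cvgM; [exact: cvg_cst|exact: cvg_harmonic].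
  move=> n; rewrite subr0 -[leLHS]ger0_norm// -sqrtr_sqr ler_wsqrtr//.
  apply: le_trans (psd_sqr_le lI sI M0 S0 (fun x => opb_inner_le x SM) _) _.
  by rewrite ler_wpM2l// ltW.
have xs : x_ n @[n --> U] --> s.
  rewrite (_ : x_ = (fun n => (idfun \- S) (x_ n) + S (x_ n))); last first.
    by apply/funext => n /=; rewrite subrK.
  rewrite -[s]add0r; apply: cvgD => //.
  exact: cvg_trans (cvg_app _ sU) d0.
have hH := @norm_hausdorff _ H.
have Ss : S s = s.
  have h : S (x_ n) @[n --> U] --> S s.
    by apply: (cvg_comp x_ S xs); exact: (Sym_cont (SymHS_Sym S)).
  by rewrite -(cvg_lim hH h) (cvg_lim hH sP).
have s1 : `|s| = 1.
  have h : `|x_ n| @[n --> U] --> `|s| by exact: cvg_norm.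
  rewrite -(cvg_lim (@Rhausdorff R) h).
  by rewrite (_ : (fun n => `|x_ n|) = cst 1) ?lim_cst//; apply/funext => n; exact: x1.
have s0 : s != 0 by rewrite -normr_eq0 s1 oner_eq0.
by have := Spos _ s0; rewrite /= Ss subrr inner0r ltxx.
Qed.

Lemma coercive_ltI S c : 0 < c -> coercive (idfun \- S) c -> SymHS_ltI S.
Proof.
move=> c0 cS; split; first exact: (Sym_sa (idB_Sym S)).
move=> x x0; rewrite innerC; apply: lt_le_trans (cS x).
by rewrite mulr_gt0// exprn_gt0// normr_gt0.
Qed.

Lemma coercive_near S T c : coercive (idfun \- S) c -> `|T - S| <= c / 2 ->
  coercive (idfun \- T) (c / 2).
Proof.
move=> cS TS x; have := cS x; have := opb_inner_le x (@hs_opb _ _ (T - S)).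
rewrite SymHSB /= !innerBl.
have := ler_wpM2r (sqr_ge0 `|x|) TS.
set a := `|_| ^+ 2; set b := `|_|; lra.
Qed.

Lemma sqrt_idBP S : SymHS_ltI S -> SymP H (sqrt_op (idfun \- S)) /\
  forall x, sqrt_op (idfun \- S) (sqrt_op (idfun \- S) x) = x - S x.
Proof.
move=> SS; have := sqrt_opP (A := idfun \- S) _; apply; split; first exact: idB_Sym.
move=> x; have [->|x0] := eqVneq x 0; first by rewrite inner0r.
by rewrite innerC; apply: ltW; case: SS => _; apply.
Qed.

End ltI.

(** * Resolvent identities and the first-order expansion *)

Section resolvent.
Context (R : realType) (H : sepHilbertType R).
Implicit Types (S T V : SymHS H) (x y : H).

Definition res S : H -> H := inv_op (idfun \- S).

(** The identity has to be subtracted to obtain a Hilbert-Schmidt operator, equal to [S \o res S].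
    Differences of resolvents are differences of [rho]. *)
Definition rho S : SymHS H := mkHS (res S \- idfun).

Lemma res_Sym S : SymHS_ltI S -> Sym H (res S).
Proof. by move=> /ltI_coercive [c c0 cS]; exact: (inv_op_Sym (idB_Sym S) c0 cS). Qed.

Lemma resK S x : SymHS_ltI S -> res S x - S (res S x) = x.
Proof. by move=> /ltI_coercive [c c0 cS]; exact: (inv_opK (idB_Sym S) c0 cS). Qed.

Lemma resKl S x : SymHS_ltI S -> res S (x - S x) = x.
Proof. by move=> /ltI_coercive [c c0 cS]; exact: (inv_opKl (idB_Sym S) c0 cS). Qed.

Lemma res_opb S c : 0 < c -> coercive (idfun \- S) c -> opb (res S) c^-1.
Proof. by move=> c0 cS; exact: (inv_op_opb (idB_Sym S) c0 cS). Qed.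

Lemma rhoE S x : SymHS_ltI S -> rho S x = res S x - x.
Proof.
move=> SI; rewrite /rho mkHSE//.
have [c c0 cS] := ltI_coercive SI.
have SR := res_Sym SI; have Rb := res_opb c0 cS.
have E : res S \- idfun = idfun \o S \o res S.
  by apply/funext => y /=; rewrite -{2}[y](resK _ SI) opprB addrCA subrr addr0.
have ci0 : 0 <= c^-1 by rewrite invr_ge0 ltW.
apply: (symhsI (M := (1 * c^-1 * `|S|) ^+ 2)).
  apply: (@SymI _ _ _ (c^-1 + 1)).
  - by move=> a u v /=; rewrite (Sym_lin SR) scalerBr opprD addrACA.
  - move=> u /=; apply: le_trans (ler_normB _ _) _.
    by rewrite mulrDl mul1r lerD2r.
  - by move=> u v /=; rewrite innerBl innerBr (Sym_sa SR).
rewrite E; apply: hs_sum_sandwich => //; first exact: Sym_id.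
exact: opb_id.
Qed.

Lemma resE S x : SymHS_ltI S -> res S x = x + rho S x.
Proof. by move=> SI; rewrite rhoE// addrCA subrr addr0. Qed.

Lemma idB_opp_rho S : SymHS_ltI S -> idfun \- (- rho S : SymHS H) = res S.
Proof. by move=> SI; apply/funext => x; rewrite /= resE// fctE opprK. Qed.

Lemma opp_rho_ltI S : SymHS_ltI S -> SymHS_ltI (- rho S).
Proof.
move=> SI; have [c c0 cS] := ltI_coercive SI.
have [M M0 SM] := Sym_opb (idB_Sym S).
apply: (@coercive_ltI _ _ _ (c / M ^+ 2)); first by rewrite divr_gt0// exprn_gt0.
rewrite idB_opp_rho//; exact: (inv_op_coercive (idB_Sym S) c0 cS M0 SM).
Qed.

Lemma res_opp_rho S x : SymHS_ltI S -> res (- rho S) x = x - S x.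
Proof.
move=> SI; rewrite -{1}[x - S x](resKl _ (opp_rho_ltI SI)).
congr (res _ _); rewrite -[X in _ = X]/((idfun \- (- rho S : SymHS H)) (x - S x)).
by rewrite idB_opp_rho// resKl.
Qed.

(** So [S |-> - rho S] is an involution of [SymHS_ltI], and an operator with a prescribed resolvent
    [I + T > 0] is [- rho (- T)]. *)
Lemma rho_opp_rho S : SymHS_ltI S -> rho (- rho S) = - S.
Proof.
move=> SI; apply: SymHS_ext => x.
by rewrite rhoE ?res_opp_rho//; [rewrite addrAC subrr add0r|exact: opp_rho_ltI].
Qed.

(** The second resolvent identity. *)
Lemma rhoB S T x : SymHS_ltI S -> SymHS_ltI T ->
  (rho T - rho S : SymHS H) x = res T ((T - S : SymHS H) (res S x)).
Proof.
move=> SI TI; rewrite SymHSB !rhoE// opprB addrA subrK.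
have lT := Sym_lin (res_Sym TI).
rewrite SymHSB (linB lT).
rewrite -{1}[x](resK _ SI) (linB lT).
have E := resKl (res S x) TI; rewrite (linB lT) in E.
by rewrite -[X in _ - _ - X = _]E opprB addrC addrA subrK.
Qed.

(** Using [rhoB] twice, the remainder is [(rho T - rho S) (T - S) R], of second order. The radius
    [c / 2] leaves the coercivity constant [c / 2] for [T], so that [b] bounds [res T] uniformly. *)
Lemma rho_near S : SymHS_ltI S -> exists d K : R, [/\ 0 < d, 0 < K &
  forall T, `|T - S| <= d -> [/\ SymHS_ltI T,
    `|rho T - rho S| <= K * `|T - S| &
    `|rho T - rho S - hs_conj (res S) (T - S)| <= K * `|T - S| ^+ 2]].
Proof.
move=> SI; have [c c0 cS] := ltI_coercive SI.
have c20 : 0 < c / 2 by rewrite divr_gt0.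
pose a := c^-1; pose b := (c / 2)^-1.
have a0 : 0 < a by rewrite invr_gt0.
have b0 : 0 < b by rewrite invr_gt0.
have Sa : opb (res S) a by exact: res_opb.
have lipK T : `|T - S| <= c / 2 -> SymHS_ltI T /\ `|rho T - rho S| <= b * a * `|T - S|.
  move=> TS; have cT := coercive_near cS TS; have TI := coercive_ltI c20 cT.
  split => //; apply: hs_norm_le.
    by rewrite mulr_ge0// mulr_ge0// ltW.
  have -> : SymHS_op (rho T - rho S) = res T \o (T - S : SymHS H) \o res S.
    by apply/funext => x; exact: rhoB.
  by apply: hs_sum_sandwich => //; [exact: res_Sym|exact: res_Sym|exact: res_opb|exact: ltW|exact: ltW].
(* The first term of [K] serves the Lipschitz bound, the second the quadratic one. *)
exists (c / 2), (b * a + b * a * a); split => //.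
  by rewrite addr_gt0// !mulr_gt0.
move=> T TS; have [TI lip] := lipK T TS; split => //.
  by rewrite (le_trans lip)// ler_wpM2r// lerDl !mulr_ge0// ltW.
have -> : b * a + b * a * a = b * a * a + b * a by rewrite addrC.
rewrite mulrDl ler_wpDr ?mulr_ge0 ?sqr_ge0 ?(ltW a0) ?(ltW b0)//.
apply: le_trans (_ : `|rho T - rho S| * a * `|T - S| <= _); last first.
  rewrite expr2 [leRHS]mulrA ler_wpM2r//.
  have -> : b * a * a * `|T - S| = b * a * `|T - S| * a by ring.
  by rewrite ler_wpM2r// ltW.
apply: hs_norm_le; first by rewrite mulr_ge0// mulr_ge0// ltW.
have -> : SymHS_op (rho T - rho S - hs_conj (res S) (T - S)) =
    (rho T - rho S : SymHS H) \o (T - S : SymHS H) \o res S.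
  apply/funext => x; rewrite SymHSB hs_conjE; last exact: res_Sym.
  rewrite rhoB// -[RHS]/((rho T - rho S : SymHS H) ((T - S : SymHS H) (res S x))).
  move: ((T - S : SymHS H) (res S x)) => y.
  by rewrite SymHSB !rhoE// opprB addrA subrK.
apply: hs_sum_sandwich => //; [exact: SymHS_Sym|exact: res_Sym|exact: hs_opb|exact: ltW].
Qed.

Lemma rho_cvg (S_ : nat -> SymHS H) S : SymHS_ltI S -> S_ @ \oo --> S ->
  rho (S_ n) @[n --> \oo] --> rho S.
Proof.
move=> SI SS; have [d [K [d0 K0 near_S]]] := rho_near SI.
apply/cvgrPdist_lt => e e0.
have m0 : 0 < Num.min d (e / K) by rewrite lt_min d0 divr_gt0.
have /cvgrPdist_lt/(_ _ m0) := SS; apply: filterS => n.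
rewrite lt_min => /andP[h1 h2]; rewrite distrC.
have [|_ lip _] := near_S (S_ n); first by rewrite distrC ltW.
by apply: le_lt_trans lip _; rewrite mulrC -ltr_pdivlMr// distrC.
Qed.

(* By density of the span of the [tens w]. *)
Lemma hs_ip_conj X A B : Sym H X -> hs_ip (hs_conj X A) B = hs_ip A (hs_conj X B).
Proof.
move=> SX.
pose B_ := trunc (onb H) B.
have BB : B_ @ \oo --> B by exact: (trunc_cvg (@onbP R H)).
have c1 : hs_ip (hs_conj X A) (B_ n) @[n --> \oo] --> hs_ip (hs_conj X A) B.
  by apply: cvg_hs_ip => //; exact: cvg_cst.
have c2 : hs_ip A (hs_conj X (B_ n)) @[n --> \oo] --> hs_ip A (hs_conj X B).
  apply: cvg_hs_ip; first exact: cvg_cst.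
  by apply: (cvg_comp B_ (hs_conj X) BB); exact: hs_conj_continuous.
apply: (cvg_uniq c1); rewrite (_ : (fun n => _) = (fun n => hs_ip A (hs_conj X (B_ n))))//.
apply/funext => n; rewrite /B_.
rewrite /trunc /form_op /lsum.
rewrite (lin_sum (hs_conj_lin SX)) !hs_ip_sumr; apply: eq_bigr => p _.
rewrite (linZ (hs_conj_lin SX)) hs_ipZr [RHS]hs_ipZr (hs_conj_tens _ SX) !hs_ip_tens.
by rewrite (hs_conjE _ _ SX) (Sym_sa SX).
Qed.

End resolvent.

(** * Independence of the trace from the basis *)

Section trace_class.
Context (R : realType) (H : sepHilbertType R).
Implicit Types (A P X : H -> H) (x y : H).

(* Otherwise an approximate top eigenvector of [A - P], of eigenvalue [l > 0],
   would satisfy [`|A x| ^+ 2 = `|P x + l *: x| ^+ 2 > `|P x| ^+ 2]. *)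
Lemma abs_form_le A P : Sym H A -> SymP H P -> (forall x, `|A x| = `|P x|) ->
  forall x, inner (A x) x <= inner (P x) x.
Proof.
move=> SA [SP P0] AP x; rewrite leNgt; apply/negP => xM.
have [a a0 Aa] := Sym_opb SA; have [b b0 Pb] := Sym_opb SP.
pose E := [set inner (A y) y - inner (P y) y | y in [set y : H | `|y| = 1]].
have nx0 : 0 < `|x|.
  by rewrite normr_gt0; apply: contraTneq xM => ->; rewrite !inner0r ltxx.
have supE : has_sup E.
  split; first by exists (inner (A (`|x|^-1 *: x)) (`|x|^-1 *: x) - inner (P (`|x|^-1 *: x)) (`|x|^-1 *: x));
    exists (`|x|^-1 *: x) => //=; rewrite normrZ ger0_norm ?invr_ge0// mulVf// gt_eqF.
  exists a => _ [y /= y1 <-]; rewrite lerBlDr ler_wpDr//.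
  by have := opb_inner_le y Aa; rewrite y1 expr1n mulr1.
pose l := sup E.
have El y : inner (A y) y - inner (P y) y <= l * `|y| ^+ 2.
  have [->|y0] := eqVneq y 0; first by rewrite !inner0r subrr normr0 expr0n mulr0.
  have ny0 : 0 < `|y| by rewrite normr_gt0.
  rewrite -ler_pdivrMr ?exprn_gt0//.
  apply: sup_upper_bound => //; exists (`|y|^-1 *: y).
    by rewrite /= normrZ ger0_norm ?invr_ge0// mulVf// gt_eqF.
  rewrite (linZ (Sym_lin SA)) (linZ (Sym_lin SP)) !innerZl !innerZr.
  by rewrite -!mulrBr mulrA -invfM mulrC expr2.
have l0 : 0 < l.
  have : 0 < l * `|x| ^+ 2 by apply: lt_le_trans (El x); rewrite subr_gt0.
  by rewrite pmulr_lgt0// exprn_gt0.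
pose N y := l *: y - (A y - P y).
have lN : linear N.
  move=> c u v; rewrite /N (Sym_lin SA) (Sym_lin SP) scalerDr !scalerBr !scalerA.
  rewrite (mulrC l c) (_ : c *: A u + A v - _ = (c *: A u - c *: P u) + (A v - P v)).
    by rewrite opprD addrACA.
  by rewrite opprD addrACA.
have sN : self_adjoint N.
  by move=> u v; rewrite /N !(innerBl, innerBr) innerZl innerZr (Sym_sa SA) (Sym_sa SP).
have N0 y : 0 <= inner (N y) y.
  by rewrite /N !innerBl innerZl subr_ge0 inner_norm.
pose K := l + a + b + 1.
have K0 : 0 < K by rewrite !addr_gt0.
have NK y : inner (N y) y <= K * `|y| ^+ 2.
  rewrite /N !innerBl innerZl inner_norm.
  have h1 := opb_inner_le y Pb.
  have h2 : - inner (A y) y <= a * `|y| ^+ 2.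
    apply: le_trans (ler_norm _) _; rewrite normrN.
    apply: le_trans (cauchy_schwarz _ _) _.
    by rewrite expr2 mulrA ler_wpM2r.
  have h3 := sqr_ge0 `|y|.
  by rewrite /K; move: (`|y| ^+ 2) h1 h2 h3 => t; lra.
have NN := psd_sqr_le lN sN K0 N0 NK.
(* Expanding the square of [A y = P y + l y - N y], the cross term with [N y] is at most [c] times
   the norm of [N y], while [l ^+ 2] is left over. The tolerance [(l ^+ 2 / c) ^+ 2 / K] on the form
   of [N] makes this cross term smaller than [l ^+ 2]. *)
pose c := 2 * (b + l).
have c0 : 0 < c by rewrite mulr_gt0// addr_gt0.
have e0 : 0 < (l ^+ 2 / c) ^+ 2 / K by rewrite divr_gt0// exprn_gt0// divr_gt0// exprn_gt0.
have [_ [y /= y1 <-] yl] := sup_adherent e0 supE.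
have Ny : inner (N y) y < (l ^+ 2 / c) ^+ 2 / K.
  rewrite /N !innerBl innerZl inner_norm y1 expr1n mulr1.
  by move: yl; rewrite -/l; lra.
have {}Ny : `|N y| < l ^+ 2 / c.
  rewrite -ltr_sqr ?nnegrE ?divr_ge0 ?sqr_ge0 ?(ltW c0)//.
  by apply: le_lt_trans (NN y) _; rewrite mulrC -ltr_pdivlMr.
have AyE : A y = (P y + l *: y) - N y.
  by rewrite /N opprB [_ - _ - _]addrC addrA addrK addrC subrK.
have := AP y; rewrite AyE => /(congr1 (fun t => t ^+ 2)).
rewrite normB_sqr normD_sqr innerZr normrZ (gtr0_norm l0) y1 mulr1.
have h1 := P0 y.
have h2 : inner (P y + l *: y) (N y) <= (b + l) * `|N y|.
  apply: le_trans (inner_le _ _) _; rewrite ler_wpM2r//.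
  apply: le_trans (ler_normD _ _) _; rewrite normrZ (gtr0_norm l0) y1 mulr1.
  by rewrite lerD2r; have := Pb y; rewrite y1 mulr1.
have h3 : c * `|N y| < l ^+ 2 by rewrite mulrC -ltr_pdivlMr.
have h4 := mulr_ge0 (ltW l0) h1; have h5 := sqr_ge0 `|N y|.
move: h3; rewrite /c -mulrA => h3.
move: (inner (P y) y) (`|N y| ^+ 2) (`|P y| ^+ 2) ((b + l) * `|N y|) (inner (P y + _) _) h1 h2 h3 h4 h5 => *.
lra.
Qed.

(** Write [V = (Q1 ^ 2 - Q2 ^ 2) / 2] with [Q1], [Q2] the roots of [P + V] and [P - V], where [P] is
    the absolute value of [V]. Both exist by [abs_form_le] and are Hilbert-Schmidt since their
    squares are at most [2 P]; their norms do not depend on the basis. *)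
Lemma trace_basis V : Tr H V -> Sym H V ->
  exists t : R, forall e, is_onb e -> series (fun k => inner (V (e k)) (e k)) @ \oo --> t.
Proof.
move=> [_ trV] SV; have lV := Sym_lin SV; have sV := Sym_sa SV.
(* [adjoint] is obtained by [get]; [V] is a witness, and an adjoint is unique. *)
have adjV : adjoint V = V.
  have [_ adjP] := @getI _ [set B | bounded_op B /\ forall x y, inner (V x) y = inner x (B y)] V (conj SV.1 SV.2).
  apply/funext => x; apply: inner_ext => y.
  by rewrite sV innerC -adjP innerC.
pose P := abs_op V.
have [SP PP] : SymP H P /\ forall x, P (P x) = V (V x).
  rewrite /P /abs_op adjV; have [c c0 Vc] := Sym_opb SV.
  apply: (@sqrt_opP _ _ (V \o V)); split; last by move=> x; rewrite /= sV inner_ge0.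
  apply: (@SymI _ _ _ (c * c)).
  - by move=> a x y /=; rewrite !lV.
  - by move=> x /=; rewrite -mulrA (le_trans (Vc _))// ler_wpM2l ?(ltW c0).
  - by move=> x y /=; rewrite !sV.
have VP x : `|V x| = `|P x|.
  apply/eqP; rewrite -(@eqrXn2 _ 2)// -!inner_norm sV (Sym_sa SP.1).
  by rewrite PP.
have SVN : Sym H (fun x => - V x).
  have [c c0 Vc] := Sym_opb SV; apply: (@SymI _ _ _ c).
  - by move=> a x y; rewrite lV opprD scalerN.
  - by move=> x; rewrite normrN.
  - by move=> x y; rewrite innerNl innerNr sV.
have VleP := abs_form_le SV SP VP.
have NVleP : forall x, - inner (V x) x <= inner (P x) x.
  by move=> x; rewrite -innerNl; apply: (abs_form_le SVN SP) => y; rewrite normrN.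
have root (s : R) : `|s| = 1 -> exists Q : SymHS H,
    forall x, `|Q x| ^+ 2 = inner (P x) x + s * inner (V x) x.
  move=> s1.
  have sle x : - inner (P x) x <= s * inner (V x) x <= inner (P x) x.
    rewrite -ler_norml normrM s1 mul1r ler_norml lerNl NVleP VleP.
    by [].
  have [c c0 Vc] := Sym_opb SV; have [d d0 Pd] := Sym_opb SP.1.
  have [[SQ Q0] QQ] : SymP H (sqrt_op (fun x => P x + s *: V x)) /\
      forall x, sqrt_op (fun x => P x + s *: V x) (sqrt_op (fun x => P x + s *: V x) x) = P x + s *: V x.
    apply: sqrt_opP; split; last first.
      by move=> x; rewrite innerDl innerZl addrC -lerBlDr sub0r; have /andP[] := sle x.
    apply: (@SymI _ _ _ (d + c)).
    - move=> a x y; rewrite lV (Sym_lin SP.1) !scalerDr !scalerA (mulrC s) addrACA.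
      by [].
    - move=> x; apply: le_trans (ler_normD _ _) _.
      by rewrite normrZ s1 mul1r mulrDl lerD.
    - by move=> x y; rewrite innerDl innerDr innerZl innerZr sV (Sym_sa SP.1).
  set Q := sqrt_op _ in SQ Q0 QQ.
  have QE x : `|Q x| ^+ 2 = inner (P x) x + s * inner (V x) x.
    by rewrite -inner_norm (Sym_sa SQ) innerC QQ innerDl innerZl.
  have QHS : Q \in @symhs R H.
    rewrite inE; split => //; split; first by case: SQ.
    apply: (@le_lt_trans _ _ (2%:E * \sum_(k <oo) (inner (P (onb H k)) (onb H k))%:E)%E).
      rewrite -nneseriesZl; last by move=> k _; rewrite lee_fin; exact: SP.2.
      apply: lee_nneseries => k _; first by rewrite lee_fin sqr_ge0.
      by rewrite QE -EFinM lee_fin; have /andP[_] := sle (onb H k); lra.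
    by rewrite lte_mul_pinfty.
  by exists (mkHS Q) => x; rewrite mkHSE// QE.
have [Q1 Q1E] := root 1 (normr1 _).
have [Q2 Q2E] := root (-1) (normrN1 _).
exists ((`|Q1| ^+ 2 - `|Q2| ^+ 2) / 2) => e oe.
rewrite (_ : series _ = fun n => (series (fun k => `|Q1 (e k)| ^+ 2) n -
    series (fun k => `|Q2 (e k)| ^+ 2) n) / 2); last first.
  apply/funext => n; rewrite /series /= -sumrB mulr_suml.
  by apply: eq_bigr => k _; rewrite Q1E Q2E; field.
by apply: cvgM; [apply: cvgB; exact: hs_series|exact: cvg_cst].
Qed.

End trace_class.

(** * One-dimensional Gaussian integrals *)

Section real_integrable.
Context d (T : measurableType d) (R : realType) (mu : {measure set T -> \bar R}).
Implicit Types f g : T -> R.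

Lemma integrableRD f g : mu.-integrable setT (EFin \o f) -> mu.-integrable setT (EFin \o g) ->
  mu.-integrable setT (EFin \o (fun x => f x + g x)).
Proof.
move=> If Ig; rewrite (_ : _ \o _ = (EFin \o f) \+ (EFin \o g))%E//.
exact: integrableD.
Qed.

Lemma integrableRB f g : mu.-integrable setT (EFin \o f) -> mu.-integrable setT (EFin \o g) ->
  mu.-integrable setT (EFin \o (fun x => f x - g x)).
Proof.
move=> If Ig; rewrite (_ : _ \o _ = (EFin \o f) \- (EFin \o g))%E//.
exact: integrableB.
Qed.

Lemma integrableRZ a f : mu.-integrable setT (EFin \o f) ->
  mu.-integrable setT (EFin \o (fun x => a * f x)).
Proof.
move=> If; rewrite (_ : _ \o _ = (fun x => a%:E * (EFin \o f) x)%E)//.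
exact: integrableZl.
Qed.

End real_integrable.

Section density.
Context d (T : measurableType d) (R : realType).
Variables (mu : {sigma_finite_measure set T -> \bar R}) (nu : {finite_measure set T -> \bar R}).
Variable p : T -> R.
Hypotheses (mp : measurable_fun setT p) (p0 : forall x, 0 <= p x).
Hypothesis nuE : forall A, measurable A -> nu A = (\int[mu]_(x in A) (p x)%:E)%E.

Lemma density_dominates : nu `<< mu.
Proof.
apply/null_content_dominatesP => A mA muA; rewrite nuE//.
by apply: null_set_integral => //; exact/measurable_funTS/measurable_EFinP.
Qed.

Lemma density_integrable_pdf : mu.-integrable setT (EFin \o p).
Proof.
apply/integrableP; split; first exact/measurable_EFinP.
rewrite (eq_integral (EFin \o p)); last by move=> x _ /=; rewrite ger0_norm.
by rewrite -nuE// -ge0_fin_numE// fin_num_measure.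
Qed.

(** Change of variables for the Radon-Nikodym derivative, which is almost everywhere [p] because
    both have the same integrals on measurable sets. *)
Lemma ge0_density_integral (f : T -> \bar R) : measurable_fun setT f -> (forall x, 0 <= f x)%E ->
  (\int[nu]_x f x = \int[mu]_x (f x * (p x)%:E))%E.
Proof.
move=> mf f0.
have D := density_dominates.
rewrite -(Radon_Nikodym_SigmaFinite.change_of_variables D)//.
have mg := measurable_int _ (Radon_Nikodym_SigmaFinite.f_integrable D).
apply: ae_eq_integral => //.
- exact: emeasurable_funM.
- by apply: emeasurable_funM => //; exact/measurable_EFinP.
apply: ae_eqe_mul2l; apply: integral_ae_eq => //.
- exact: Radon_Nikodym_SigmaFinite.f_integrable.
- exact/measurable_EFinP.
by move=> A _ mA; rewrite -nuE// (Radon_Nikodym_SigmaFinite.f_integral D).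
Qed.

Lemma density_integrable (f : T -> R) : measurable_fun setT f ->
  nu.-integrable setT (EFin \o f) <-> mu.-integrable setT (fun x => (f x * p x)%:E).
Proof.
move=> mf; have mfp : measurable_fun setT (fun x => (f x * p x)%:E).
  by apply/measurable_EFinP; exact: measurable_funM.
have E : (\int[nu]_x `|(f x)%:E| = \int[mu]_x `|(f x * p x)%:E|)%E.
  rewrite ge0_density_integral//; last by apply/measurableT_comp => //; exact/measurable_EFinP.
  by apply: eq_integral => x _; rewrite EFinM abseM (@gee0_abs _ (p x)%:E) ?lee_fin.
split=> /integrableP[m1 m2]; apply/integrableP; split => //.
- by rewrite -E.
- exact/measurable_EFinP.
- by rewrite E.
Qed.

Lemma density_Rintegral (f : T -> R) : measurable_fun setT f ->
  \int[nu]_x f x = \int[mu]_x (f x * p x).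
Proof.
move=> mf; rewrite /Rintegral; congr fine.
have mef : measurable_fun setT (EFin \o f) by exact/measurable_EFinP.
rewrite integralE [RHS]integralE !ge0_density_integral//;
  [|exact: measurable_funeneg|exact: measurable_funepos].
congr (_ - _)%E; apply: eq_integral => x _.
  rewrite !funeposE -!EFin_max -EFinM; congr EFin.
  by rewrite maxr_pMl// mul0r.
rewrite !funenegE -!EFinN -!EFin_max -EFinM; congr EFin.
by rewrite maxr_pMl// mul0r mulNr.
Qed.

End density.

(** * Integration by parts against a Gaussian weight *)

Section gauss1.
Context (R : realType).
Local Notation leb := (@lebesgue_measure R).

(** The fundamental theorem of calculus on growing intervals, with dominated convergence. *)
Lemma integral_derive_eq0 (F f : R -> R) :
  (forall x : R, is_derive x (1 : R) F (f x)) -> continuous f ->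
  leb.-integrable setT (EFin \o f) ->
  F n%:R @[n --> \oo] --> (0 : R) -> F (- n%:R) @[n --> \oo] --> (0 : R) ->
  \int[leb]_x f x = 0.
Proof.
move=> dF cf If Fy FNy.
have cF : continuous F.
  by move=> x; apply/differentiable_continuous/derivable1_diffP; case: (dF x).
(* [n.+1] keeps the intervals nondegenerate. *)
pose f_ n := (EFin \o f) \_ (`[- n.+1%:R, n.+1%:R]%classic : set R).
have [_ _ h1] : [/\ leb.-integrable setT (EFin \o f), (fun n => \int[leb]_x `|f_ n x - (EFin \o f) x|)%E @ \oo --> 0%E &
    (fun n => \int[leb]_x f_ n x)%E @ \oo --> (\int[leb]_x (EFin \o f) x)%E].
  apply: (@dominated_convergence _ _ _ leb _ measurableT f_ (EFin \o f) (abse \o (EFin \o f))).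
  - move=> n; apply/(measurable_restrictT _ _).1 => //.
    by apply: measurable_funTS; exact: (measurable_int _ If).
  - exact: (measurable_int _ If).
  - apply: aeW => x _; apply: cvg_near_cst; near=> n.
    rewrite /f_ patchE ifT// inE /= in_itv /= -ler_norml.
    apply: (@le_trans _ _ n%:R); last by rewrite ler_nat.
    by near: n; exact: nbhs_infty_ger.
  - exact: integrable_abse.
  - apply: aeW => x n _; rewrite /f_ patchE; case: ifP => //= _.
    by rewrite normr0 lee_fin.
have E n : (\int[leb]_x f_ n x = (F n.+1%:R - F (- n.+1%:R))%:E)%E.
  rewrite -integral_mkcond EFinB; apply: continuous_FTC2.
  - by rewrite -subr_gt0 opprK addr_gt0.
  - exact: continuous_subspaceT.
  - split; [by move=> x _; case: (dF x)| |].
    + exact/cvg_at_right_filter/cF.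
    + exact/cvg_at_left_filter/cF.
  - by move=> x _; rewrite derive1E; case: (dF x).
have h2 : (F n.+1%:R - F (- n.+1%:R))%:E @[n --> \oo] --> 0%:E.
  apply: cvg_EFin; first exact: nearW.
  rewrite -(subr0 0); apply: cvgB.
    by move: Fy; rewrite -(cvg_shiftS (fun n => F n%:R)).
  by move: FNy; rewrite -(cvg_shiftS (fun n => F (- n%:R))).
have h3 : (fun n => \int[leb]_x f_ n x)%E @ \oo --> 0%:E.
  by under eq_fun do rewrite E.
rewrite /Rintegral -[X in fine X](cvg_lim _ h1)// (cvg_lim _ h3)//.
Unshelve. all: by end_near. Qed.

Variable v : R.
Hypothesis v0 : 0 < v.
Let g x := expR (- x ^+ 2 / (v *+ 2)).
Let C := 1 + 64 * v ^+ 2.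
(** The weight with doubled variance, so that [g] is the square of [k]: one factor absorbs growth up
    to degree 4, the other is integrable and vanishes at infinity. *)
Let k x := expR (- x ^+ 2 / (v *+ 4)).

Let g_bound x : (1 + x ^+ 4) * g x <= C * k x.
Proof.
pose t := x ^+ 2 / (v *+ 4).
have t0 : 0 <= t by rewrite divr_ge0 ?sqr_ge0// mulrn_wge0// ltW.
have -> : g x = expR (- t) * expR (- t).
  by rewrite -expRD; congr expR; rewrite /t; field; rewrite gt_eqF.
have -> : k x = expR (- t) by congr expR; rewrite /t mulNr.
have -> : x ^+ 4 = 16 * v ^+ 2 * t ^+ 2 by rewrite /t; field; rewrite gt_eqF.
rewrite mulrA ler_wpM2r ?expR_ge0// mulrDl mul1r lerD//.
  by rewrite -expR0 ler_expR oppr_le0.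
(* From [exp (t / 2) >= 1 + t / 2]. Together with [x ^+ 4 = 16 v ^ 2 t ^ 2] this is the origin of
   the 64 in [C]. *)
have : t ^+ 2 * expR (- t) <= 4.
  rewrite expRN ler_pdivrMr ?expR_gt0//.
  have h := expR_ge1Dx (t / 2).
  have -> : expR t = expR (t / 2) ^+ 2.
    by rewrite expr2 -expRD -splitr.
  have : (1 + t / 2) ^+ 2 <= expR (t / 2) ^+ 2.
    by rewrite ler_sqr ?nnegrE ?expR_ge0// addr_ge0// divr_ge0.
  rewrite (_ : 4 * expR (t / 2) ^+ 2 = 4 * (expR (t / 2) ^+ 2))//.
  move: (expR (t / 2) ^+ 2) => E; rewrite !expr2; nra.
move=> h; apply: (@le_trans _ _ (16 * v ^+ 2 * 4)).
  by rewrite -(mulrA (16 * v ^+ 2)) ler_wpM2l// mulr_ge0// sqr_ge0.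
by rewrite le_eqVlt; apply/orP; left; apply/eqP; ring.
Qed.

Let k_integrable : leb.-integrable setT (EFin \o k).
Proof.
pose s := Num.sqrt (v *+ 2).
have s2 : s ^+ 2 = v *+ 2 by rewrite sqr_sqrtr// mulrn_wge0// ltW.
have s0 : s != 0 by rewrite gt_eqF// sqrtr_gt0 mulrn_wgt0.
rewrite (_ : _ \o _ = fun x => ((normal_peak s)^-1)%:E * (normal_pdf 0 s x)%:E)%E.
  by apply: integrableZl => //; exact: integrable_normal_pdf.
apply/funext => x; rewrite /= normal_pdfE// -EFinM mulKf ?gt_eqF ?normal_peak_gt0//.
by congr EFin; rewrite /k /normal_fun subr0 s2 -mulrnA.
Qed.

Let k_cvg : k n%:R @[n --> \oo] --> (0 : R).
Proof.
pose q := expR (- (v *+ 4)^-1).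
have v4 : 0 < v *+ 4 by rewrite mulrn_wgt0.
have q1 : `|q| < 1.
  rewrite ger0_norm ?expR_ge0// -expR0 ltr_expR oppr_lt0 invr_gt0//.
apply: (@squeeze_cvgr _ _ _ _ (fun=> 0) (fun n => q ^+ n)).
- apply: nearW => n; rewrite expR_ge0/= /k /q -expRM_natl ler_expR.
  rewrite mulrN mulNr lerN2 ler_wpM2r ?invr_ge0 ?(ltW v4)//.
  by rewrite -natrX ler_nat; case: n => // n; rewrite expnS leq_pmulr.
- exact: cvg_cst.
- exact: cvg_expr.
Qed.

Let g_ge0 x : 0 <= g x. Proof. exact: expR_ge0. Qed.

Let g_derive (x : R) : is_derive x (1 : R) g (- (x / v) * g x).
Proof.
have -> : g = expR \o (fun x => - (v *+ 2)^-1 * x ^+ 2).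
  by apply/funext => y /=; congr expR; rewrite mulNr mulrC mulNr.
apply: is_derive_eq; rewrite /= /GRing.scale /= mulr1.
rewrite mulrC; congr (_ * _); field; rewrite gt_eqF//.
Qed.

Let g_cont : continuous g.
Proof.
move=> x; apply/differentiable_continuous/derivable1_diffP.
by case: (g_derive x).
Qed.

Lemma poly4_gauss_integrable (m : R -> R) K : continuous m -> (forall x, `|m x| <= K * (1 + x ^+ 4)) ->
  leb.-integrable setT (fun x => (m x * g x)%:E).
Proof.
move=> cm mK.
have K0 : 0 <= K by have := le_trans (normr_ge0 _) (mK 0); rewrite expr0n addr0 mulr1.
apply: (@le_integrable _ _ _ leb setT measurableT _ (fun x => (K * C)%:E * (EFin \o k) x)%E).
- apply/measurable_EFinP; apply: measurable_funM; exact: continuous_measurable_fun.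
- move=> x _; rewrite -EFinM /= lee_fin normrM (ger0_norm (g_ge0 x)).
  apply: le_trans (ler_norm _); apply: le_trans (ler_wpM2r (g_ge0 x) (mK x)) _.
  by rewrite -!mulrA ler_wpM2l// g_bound.
- exact: integrableZl.
Qed.

Section stein.
Variables (h h' : R -> R) (K : R).
Hypotheses (dh : forall x : R, is_derive x (1 : R) h (h' x)) (ch' : continuous h').
Hypotheses (hK : forall x, `|h x| <= K * (1 + x ^+ 4)) (h'K : forall x, `|h' x| <= K * (1 + x ^+ 4)).
Hypothesis xhK : forall x, `|x * h x| <= K * (1 + x ^+ 4).

Let ch : continuous h.
Proof.
move=> x; apply/differentiable_continuous/derivable1_diffP.
by case: (dh x).
Qed.

Let K0 : 0 <= K.
Proof. by have := le_trans (normr_ge0 _) (hK 0); rewrite expr0n addr0 mulr1. Qed.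

(** Stein's identity: [(h' - x h / v) g] is the derivative of [h g], which vanishes at infinity. It
    yields the moments and the differential equation of the characteristic function. *)
Lemma stein : v * \int[leb]_x (h' x * g x) = \int[leb]_x (x * h x * g x).
Proof.
have cxh : continuous (fun x : R => x * h x).
  by move=> x; apply: cvgM; [exact: cvg_id|exact: ch].
have I1 := poly4_gauss_integrable ch' h'K.
have I2 := poly4_gauss_integrable cxh xhK.
have Fx x : `|h x * g x| <= K * C * k x.
  rewrite normrM (ger0_norm (g_ge0 x)).
  apply: le_trans (ler_wpM2r (g_ge0 x) (hK x)) _.
  by rewrite -!mulrA ler_wpM2l// g_bound.
have kN x : k (- x) = k x by rewrite /k sqrrN.
have KCk : K * C * k n%:R @[n --> \oo] --> (0 : R).
  by rewrite -(mulr0 (K * C)); apply: cvgM; [exact: cvg_cst|exact: k_cvg].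
have I3 : leb.-integrable setT (fun x => (v^-1 * (x * h x * g x))%:E).
  exact: (integrableRZ _ I2).
have E : \int[leb]_x (h' x * g x - v^-1 * (x * h x * g x)) = 0.
  apply: (@integral_derive_eq0 (fun x => h x * g x)).
  - move=> x; have dhx := dh x; have dgx := g_derive x.
    apply: is_derive_eq; rewrite /GRing.scale/=; field.
    by rewrite gt_eqF.
  - move=> x; apply: cvgB; apply: cvgM; [exact: ch'|exact: g_cont|exact: cvg_cst|].
    by apply: cvgM; [exact: cxh|exact: g_cont].
  - exact: (integrableRB I1 I3).
  - by apply: (cvg_dom0 KCk) => n; rewrite subr0.
  - by apply: (cvg_dom0 KCk) => n; rewrite subr0 -kN.
move: E; rewrite RintegralB// RintegralZl// => /eqP; rewrite subr_eq0 => /eqP ->.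
by rewrite mulrA mulfV ?mul1r// gt_eqF.
Qed.

End stein.

End gauss1.

Lemma prob_Rintegral_cst d (T : measurableType d) (R : realType) (P : probability T R) (r : R) :
  \int[P]_x r = r.
Proof.
rewrite Rintegral_cst// -[RHS]mulr1; congr (_ * _).
exact: (congr1 fine (probability_setT P)).
Qed.

Section gauss_moments.
Context (R : realType) (v : R).
Hypothesis v0 : 0 < v.
Local Notation leb := (@lebesgue_measure R).

Let g (x : R) : R := expR (- x ^+ 2 / (v *+ 2)).
Let s := Num.sqrt v.
Let c := normal_peak s.

Let s_neq0 : s != 0. Proof. by rewrite gt_eqF// sqrtr_gt0. Qed.

Let c0 : 0 < c. Proof. exact: normal_peak_gt0. Qed.

Let pdfE : normal_pdf 0 s = fun x => c * g x.
Proof.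
apply/funext => x; rewrite normal_pdfE//; congr (_ * _).
by rewrite /normal_fun subr0 sqr_sqrtr// ltW.
Qed.

Local Notation N := (normal_prob 0 (Num.sqrt v)).

Let NE (A : set R) : measurable A -> N A = (\int[leb]_(x in A) (c * g x)%:E)%E.
Proof. by move=> mA; rewrite /normal_prob pdfE. Qed.

Let mp : measurable_fun setT (fun x => c * g x).
Proof. rewrite -pdfE; exact: measurable_normal_pdf. Qed.

Let p0 x : 0 <= c * g x. Proof. by rewrite mulr_ge0 ?expR_ge0 ?ltW. Qed.

Lemma normal_integrable (m : R -> R) K : continuous m -> (forall x, `|m x| <= K * (1 + x ^+ 4)) ->
  N.-integrable setT (EFin \o m).
Proof.
move=> cm mK; apply/(density_integrable (mu := leb) mp p0 NE).
  exact: continuous_measurable_fun.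
rewrite (_ : (fun x => _) = EFin \o (fun x => c * (m x * g x))).
  by apply: integrableRZ; exact: (poly4_gauss_integrable v0).
by apply/funext => x /=; rewrite mulrCA.
Qed.

Lemma normal_stein (h h' : R -> R) K :
  (forall x : R, is_derive x (1 : R) h (h' x)) -> continuous h' ->
  (forall x, `|h x| <= K * (1 + x ^+ 4)) -> (forall x, `|h' x| <= K * (1 + x ^+ 4)) ->
  (forall x, `|x * h x| <= K * (1 + x ^+ 4)) ->
  v * \int[N]_x h' x = \int[N]_x (x * h x).
Proof.
move=> dh ch' hK h'K xhK.
have ch : continuous h.
  by move=> x; apply/differentiable_continuous/derivable1_diffP; case: (dh x).
have cxh : continuous (fun x : R => x * h x).
  by move=> x; apply: cvgM; [exact: cvg_id|exact: ch].
rewrite !(density_Rintegral (mu := leb) mp p0 NE); try exact: continuous_measurable_fun.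
have E (f : R -> R) : continuous f -> (forall x, `|f x| <= K * (1 + x ^+ 4)) ->
    \int[leb]_x (f x * (c * g x)) = c * \int[leb]_x (f x * g x).
  move=> cf fK; rewrite -RintegralZl//; last first.
    exact: (poly4_gauss_integrable v0 cf fK).
  by apply: eq_Rintegral => x _; rewrite mulrCA.
by rewrite !E// mulrCA (stein v0 dh ch' hK h'K xhK).
Qed.

Let mean1 : \int[N]_x (1 : R) = 1.
Proof. exact: (prob_Rintegral_cst (normal_prob 0 (Num.sqrt v)) 1). Qed.

Let le_poly4_cst (x : R) : 1 <= 1 + x ^+ 4.
Proof. by rewrite lerDl -[4%N]/(2 * 2)%N exprM sqr_ge0. Qed.

Let le_poly4_sqr (x : R) : x ^+ 2 <= 1 + x ^+ 4.
Proof.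
rewrite -[4%N]/(2 * 2)%N exprM; move: (x ^+ 2) => t.
by have := sqr_ge0 (t - 1); rewrite sqrrB; have := sqr_ge0 t; nra.
Qed.

Let le_poly4_abs (x : R) : `|x| <= 2 * (1 + x ^+ 4).
Proof.
have := le_poly4_sqr x; have := le_poly4_cst x.
have := sqr_ge0 (`|x| - 1); rewrite sqrrB real_normK ?num_real//.
by move: `|x| => t; lra.
Qed.

Let le_poly4_cube (x : R) : `|x ^+ 3| <= 2 * (1 + x ^+ 4).
Proof.
have := le_poly4_sqr x; have := le_poly4_cst x.
rewrite [x ^+ 3]exprS normrM (ger0_norm (sqr_ge0 x)) -[4%N]/(2 * 2)%N exprM.
have := sqr_ge0 (x ^+ 2 - `|x|); rewrite sqrrB real_normK ?num_real//.
rewrite [x ^+ 2 * `|x|]mulrC; move: (`|x| * x ^+ 2) (x ^+ 2) => t u; lra.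
Qed.

Lemma normal_sqr : \int[N]_x (x * x) = v.
Proof.
have <- : v * \int[N]_x (1 : R) = \int[N]_x (x * x).
  apply: (@normal_stein id (fun=> 1) 2) => x; first exact: cvg_cst.
  - exact: le_poly4_abs.
  - by rewrite normr1; have := le_poly4_cst x; lra.
  - rewrite -expr2 ger0_norm ?sqr_ge0//.
    by have := le_poly4_sqr x; have := le_poly4_cst x; lra.
by rewrite mean1 mulr1.
Qed.

Lemma normal_sqr_integrable : N.-integrable setT (EFin \o (fun x : R => x * x)).
Proof.
apply: (@normal_integrable _ 1) => [|x]; first exact: (@exprn_continuous _ 2).
by rewrite -expr2 mul1r ger0_norm ?sqr_ge0.
Qed.

Lemma normal_pow4_integrable : N.-integrable setT (EFin \o (fun x : R => x ^+ 4)).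
Proof.
apply: (@normal_integrable _ 1) => [|x]; first exact: (@exprn_continuous _ 4).
rewrite mul1r ger0_norm ?lerDr//.
by rewrite -[4%N]/(2 * 2)%N exprM sqr_ge0.
Qed.

Lemma normal_pow4 : \int[N]_x (x ^+ 4) = 3 * v ^+ 2.
Proof.
have <- : v * \int[N]_x (3 * (x * x)) = \int[N]_x (x ^+ 4).
  apply: (@normal_stein (fun x => x ^+ 3) (fun x => 3 * (x * x)) 6) => x.
  - by apply: is_derive_eq; rewrite /GRing.scale /=; ring.
  - by apply: cvgM; [exact: cvg_cst|exact: (@exprn_continuous _ 2)].
  - by have := le_poly4_cube x; have := le_poly4_cst x; lra.
  - rewrite -expr2 ger0_norm; last exact: mulr_ge0 (sqr_ge0 _).
    by have := le_poly4_sqr x; have := le_poly4_cst x; lra.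
  - rewrite -exprS ger0_norm; last by rewrite -[4%N]/(2 * 2)%N exprM sqr_ge0.
    by have := le_poly4_cst x; lra.
rewrite RintegralZl//; last exact: normal_sqr_integrable.
by rewrite normal_sqr expr2 mulrCA.
Qed.

Let chf (F : R -> R) : (forall r : R, is_derive r (1 : R) F (- v * r * F r)) ->
  forall r, F r = F 0 * expR (- v * r ^+ 2 / 2).
Proof.
move=> dF r; pose G r := F r * expR (v * r ^+ 2 / 2).
have dG (x : R) : is_derive x (1 : R) G 0.
  have dFx := dF x.
  by apply: is_derive_eq; rewrite /GRing.scale /=; field.
have : G r = G 0 by exact: is_derive_0_is_cst.
rewrite /G expr0n /= mulr0 mul0r expR0 mulr1 => <-.
rewrite -mulrA -expRD (_ : _ + _ = 0) ?expR0 ?mulr1//.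
by field.
Qed.

Let cos_cont (q : R) : continuous (fun x : R => cos (q * x)).
Proof.
move=> x; apply: (cvg_comp (fun x => q * x) cos); last exact: continuous_cos.
exact: mulrl_continuous.
Qed.

Let sin_cont (q : R) : continuous (fun x : R => sin (q * x)).
Proof.
move=> x; apply: (cvg_comp (fun x => q * x) sin); last exact: continuous_sin.
exact: mulrl_continuous.
Qed.

Lemma normal_cos_integrable r : N.-integrable setT (EFin \o (fun x : R => cos (r * x))).
Proof.
by apply: (@normal_integrable _ 1) => [|x]; [exact: cos_cont|rewrite mul1r (le_trans (cos_max _))].
Qed.

Lemma normal_sin_integrable r : N.-integrable setT (EFin \o (fun x : R => sin (r * x))).
Proof.
by apply: (@normal_integrable _ 1) => [|x]; [exact: sin_cont|rewrite mul1r (le_trans (sin_max _))].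
Qed.

Let abs_integrable : N.-integrable setT (EFin \o (fun x : R => `|x|)).
Proof.
apply: (@normal_integrable _ 2) => [x|x]; first exact: norm_continuous.
by rewrite normr_id le_poly4_abs.
Qed.

Let derive_under (f f' : R -> R -> R) (a : R) :
  (forall r, N.-integrable setT (EFin \o f r)) ->
  (forall r x : R, is_derive r (1 : R) (f^~ x) (f' r x)) ->
  (forall r x, `|f' r x| <= `|x|) ->
  is_derive a (1 : R) (fun r => \int[N]_x f r x) (\int[N]_x f' a x).
Proof.
move=> If df f'x.
have d1E r x : partial1of2 f r x = f' r x.
  by rewrite partial1of2E; case: (df r x).
have aI : `]a - 1, a + 1[%classic a.
  by rewrite /= in_itv /= ltrBlDr ltrDl ltr01.
have H1 : derivable (fun r => \int[N]_x f r x) a 1.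
  apply: (@derivable_under_integral _ _ _ N f setT measurableT a (a - 1) (a + 1) aI
    (fun r _ => If r) _ (fun x => `|x|)) => //.
  by move=> r x _ _; rewrite d1E.
have H2 : 'D_1 (fun r => \int[N]_x f r x) a = \int[N]_x f' a x.
  rewrite -derive1E (@differentiation_under_integral _ _ _ N f setT measurableT a (a - 1) (a + 1) aI
    (fun r _ => If r) _ (fun x => `|x|))//.
  - by apply: eq_Rintegral => x _; rewrite d1E.
  - by move=> r x _ _; rewrite d1E.
by rewrite -H2; exact: DeriveDef.
Qed.

Let le_poly4_linear (q x : R) : 1 <= (2 + `|q|) * (1 + x ^+ 4) /\
  `|q| <= (2 + `|q|) * (1 + x ^+ 4) /\ `|x| <= (2 + `|q|) * (1 + x ^+ 4).
Proof.
have h1 := le_poly4_cst x; have h2 := le_poly4_abs x.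
have h3 := ler_wpM2l (normr_ge0 q) h1.
have h4 := mulr_ge0 (normr_ge0 q) (le_trans ler01 h1).
by rewrite mulrDl; rewrite mulr1 in h3; split; [|split]; lra.
Qed.

Let stein_sin q : v * \int[N]_x (q * cos (q * x)) = \int[N]_x (x * sin (q * x)).
Proof.
apply: (@normal_stein (fun x => sin (q * x)) (fun x => q * cos (q * x)) (2 + `|q|)) => x.
- by apply: is_derive_eq; rewrite /GRing.scale/= mulr1 mulrC.
- by apply: cvgM; [exact: cvg_cst|exact: cos_cont].
- by have [h _] := le_poly4_linear q x; rewrite (le_trans (sin_max _)).
- have [_ [h _]] := le_poly4_linear q x.
  by rewrite normrM (le_trans _ h)// ler_piMr// cos_max.
- have [_ [_ h]] := le_poly4_linear q x.
  by rewrite normrM (le_trans _ h)// ler_piMr// sin_max.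
Qed.

Let stein_cos q : v * \int[N]_x (- q * sin (q * x)) = \int[N]_x (x * cos (q * x)).
Proof.
apply: (@normal_stein (fun x => cos (q * x)) (fun x => - q * sin (q * x)) (2 + `|q|)) => x.
- by apply: is_derive_eq; rewrite /GRing.scale/= mulr1 mulrC mulrN mulNr.
- by apply: cvgM; [exact: cvg_cst|exact: sin_cont].
- by have [h _] := le_poly4_linear q x; rewrite (le_trans (cos_max _)).
- have [_ [h _]] := le_poly4_linear q x.
  by rewrite normrM normrN (le_trans _ h)// ler_piMr// sin_max.
- have [_ [_ h]] := le_poly4_linear q x.
  by rewrite normrM (le_trans _ h)// ler_piMr// cos_max.
Qed.

(** Differentiation under the integral and Stein's identity for [sin (q * x)] give [F' = - v q F],
    with [F 0 = 1]. *)
Lemma normal_cos r : \int[N]_x cos (r * x) = expR (- v * r ^+ 2 / 2).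
Proof.
pose F r := \int[N]_x cos (r * x).
have dF (q : R) : is_derive q (1 : R) F (- v * q * F q).
  have -> : - v * q * F q = \int[N]_x (- 1 * (x * sin (q * x))).
    rewrite RintegralZl//.
      rewrite -stein_sin RintegralZl//; last exact: normal_cos_integrable.
      by rewrite /F; move: (\int[N]_x cos (q * x)) => t; ring.
    apply: (@normal_integrable _ (2 + `|q|)) => x.
      by apply: cvgM; [exact: cvg_id|exact: sin_cont].
    have [_ [_ h]] := le_poly4_linear q x.
    by rewrite normrM (le_trans _ h)// ler_piMr// sin_max.
  apply: (@derive_under (fun r x => cos (r * x)) (fun r x => - 1 * (x * sin (r * x)))).
  - exact: normal_cos_integrable.
  - by move=> a x; apply: is_derive_eq; rewrite /GRing.scale/= mulr1; ring.
  - by move=> a x; rewrite mulN1r normrN normrM ler_piMr// sin_max.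
rewrite -[LHS]/(F r) (chf dF) (_ : F 0 = 1) ?mul1r//.
by rewrite -mean1; apply: eq_Rintegral => x _; rewrite mul0r cos0.
Qed.

Lemma normal_sin r : \int[N]_x sin (r * x) = 0.
Proof.
pose F r := \int[N]_x sin (r * x).
have dF (q : R) : is_derive q (1 : R) F (- v * q * F q).
  have -> : - v * q * F q = \int[N]_x (x * cos (q * x)).
    rewrite -stein_cos RintegralZl//; last exact: normal_sin_integrable.
    by rewrite /F; move: (\int[N]_x sin (q * x)) => t; ring.
  apply: (@derive_under (fun r x => sin (r * x)) (fun r x => x * cos (r * x))).
  - exact: normal_sin_integrable.
  - by move=> a x; apply: is_derive_eq; rewrite /GRing.scale/= mulr1; ring.
  - by move=> a x; rewrite normrM ler_piMr// cos_max.
have F0 : F 0 = 0.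
  apply: etrans (prob_Rintegral_cst (normal_prob 0 (Num.sqrt v)) 0).
  by apply: eq_Rintegral => x _; rewrite mul0r sin0.
by rewrite -[LHS]/(F r) (chf dF) F0 mul0r.
Qed.

(** Completing the square: up to a constant factor, the integrand times the density is the density
    of [N(r w, w)], where [w = v / (1 + a v)]. *)
Lemma normal_expR_quadratic (a r : R) : 0 <= a ->
  (\int[N]_x (expR (r * x - a * x ^+ 2 / 2))%:E =
   ((Num.sqrt (1 + a * v))^-1 * expR (r ^+ 2 * v / (2 * (1 + a * v))))%:E)%E.
Proof.
move=> a0; have av : 0 < 1 + a * v by rewrite ltr_wpDr// mulr_ge0// ltW.
pose w := v / (1 + a * v); have w0 : 0 < w by rewrite divr_gt0.
pose K := (Num.sqrt (1 + a * v))^-1 * expR (r ^+ 2 * v / (2 * (1 + a * v))).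
have mf : measurable_fun setT (fun x : R => expR (r * x - a * x ^+ 2 / 2)).
  apply: measurableT_comp => //; apply: measurable_funB; first exact: measurable_funM.
  by apply: measurable_funM => //; apply: measurable_funM => //; exact: measurable_funX.
rewrite (ge0_density_integral (mu := leb) mp NE); last 2 first.
- exact/measurable_EFinP.
- by move=> x; rewrite lee_fin expR_ge0.
rewrite -[RHS]mule1 -(integral_normal_pdf (r * w) (Num.sqrt w)).
have sw0 : Num.sqrt w != 0 by rewrite gt_eqF// sqrtr_gt0.
rewrite -ge0_integralZl//; last 2 first.
- by apply/measurable_EFinP; exact: measurable_normal_pdf.
- by move=> x _; rewrite lee_fin normal_pdf_ge0.
apply: eq_integral => x _; rewrite -!EFinM; congr EFin.
rewrite normal_pdfE// /normal_fun sqr_sqrtr ?(ltW w0)//.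
have q0 : Num.sqrt (1 + a * v) != 0 by rewrite gt_eqF// sqrtr_gt0.
have -> : normal_peak (Num.sqrt w) = c * Num.sqrt (1 + a * v).
  rewrite /c /normal_peak !sqr_sqrtr ?(ltW w0) ?(ltW v0)//.
  have pi0 := pi_gt0 R.
  have -> : v * pi *+ 2 = w * pi *+ 2 * (1 + a * v) by rewrite /w; field; rewrite gt_eqF.
  rewrite [Num.sqrt (_ * (1 + a * v))]sqrtrM; last by rewrite mulrn_wge0// mulr_ge0 ?ltW.
  by rewrite invfM -[RHS]mulrA mulVf// mulr1.
have E : expR (r * x - a * x ^+ 2 / 2) * g x =
    expR (r ^+ 2 * v / (2 * (1 + a * v))) * expR (- (x - r * w) ^+ 2 / (w *+ 2)).
  by rewrite -!expRD; congr expR; rewrite /w; field; rewrite !gt_eqF.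
rewrite mulrCA E; set A := expR _; set B := expR _; field.
by rewrite q0.
Qed.

End gauss_moments.

(** * Trigonometric integrals determine a measure *)

Section finite_measure_integrals.
Context d (T : measurableType d) (R : realType) (mu : {finite_measure set T -> \bar R}).

Lemma bounded_integrable (f : T -> R) M : measurable_fun setT f -> (forall x, `|f x| <= M) ->
  mu.-integrable setT (EFin \o f).
Proof.
move=> mf fM; apply: measurable_bounded_integrable => //; first exact: fin_num_fun_lty.
exists M; split; first exact: num_real.
by move=> y My x _; apply: le_trans (fM x) (ltW My).
Qed.

Lemma Rintegral_bounded_cvg (f_ : nat -> T -> R) (f : T -> R) M :
  (forall n, measurable_fun setT (f_ n)) -> measurable_fun setT f ->
  (forall x, f_ n x @[n --> \oo] --> f x) -> (forall n x, `|f_ n x| <= M) ->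
  \int[mu]_x f_ n x @[n --> \oo] --> \int[mu]_x f x.
Proof.
move=> mf_ mf ff fM.
have [If _ h] : [/\ mu.-integrable setT (EFin \o f), (fun n => \int[mu]_x `|(EFin \o f_ n) x - (EFin \o f) x|)%E @ \oo --> 0%E &
    (fun n => \int[mu]_x (EFin \o f_ n) x)%E @ \oo --> (\int[mu]_x (EFin \o f) x)%E].
  apply: (@dominated_convergence _ _ _ mu _ measurableT (fun n => EFin \o f_ n) _ (EFin \o cst M)).
  - by move=> n; exact/measurable_EFinP.
  - exact/measurable_EFinP.
  - by apply: aeW => x _; apply: cvg_comp (ff x) _.
  - by apply: (@bounded_integrable _ `|M|) => //.
  - by apply: aeW => x n _; rewrite lee_fin.
by apply: fine_cvg; rewrite fineK ?integrable_fin_num.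
Qed.

End finite_measure_integrals.

Section sign_limit.
Context (R : realType).

(* Its iterates converge to the sign on [-1, 1], so that half-space indicators are
   bounded limits of trigonometric polynomials. *)
Definition sgn_step (u : R) : R := (3 * u - u * u * u) / 2.

Lemma sgn_step_bound (u : R) : `|u| <= 1 -> `|sgn_step u| <= 1.
Proof.
rewrite !ler_norml => /andP[h1 h2]; rewrite /sgn_step.
have a := mulr_ge0 (_ : 0 <= 1 - u) (sqr_ge0 (1 + u)).
have b := mulr_ge0 (_ : 0 <= 1 + u) (sqr_ge0 (1 - u)).
have {}a : 0 <= (1 - u) * (1 + u) ^+ 2 by apply: a; lra.
have {}b : 0 <= (1 + u) * (1 - u) ^+ 2 by apply: b; lra.
(* This product and the next are [2 * (1 - sgn_step u)] and [2 * (1 + sgn_step u)]. *)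
have c : 0 <= (1 - u) * (1 - u) * (2 + u) by rewrite mulr_ge0// -?expr2 ?sqr_ge0//; lra.
have d : 0 <= (1 + u) * (1 + u) * (2 - u) by rewrite mulr_ge0// -?expr2 ?sqr_ge0//; lra.
apply/andP; split; nra.
Qed.

Lemma iter_sgn_step_bound (u : R) n : `|u| <= 1 -> `|iter n sgn_step u| <= 1.
Proof. by move=> u1; elim: n => //= n; exact: sgn_step_bound. Qed.

Lemma iter_sgn_step_cvg (u : R) : `|u| <= 1 -> iter n sgn_step u @[n --> \oo] --> Num.sg u.
Proof.
wlog u0 : u / 0 <= u => [W u1|].
  have [u0|/ltW u0] := leP 0 u; first exact: W.
  have itN n : iter n sgn_step (- u) = - iter n sgn_step u.
    by elim: n => //= n ->; rewrite /sgn_step; field.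
  have := W (- u); rewrite oppr_ge0 normrN sgrN => /(_ u0 u1).
  move=> h; rewrite -[Num.sg u]opprK.
  rewrite (_ : (fun n => _) = fun n => - iter n sgn_step (- u)); first exact: cvgN.
  by apply/funext => n; rewrite itN opprK.
move=> u1; have [->|un0] := eqVneq u 0.
  have -> : (fun n => iter n sgn_step (0 : R)) = cst 0.
    by apply/funext; elim=> //= n ->; rewrite /sgn_step /= !mul0r mulr0 subrr mul0r.
  by rewrite sgr0; exact: cvg_cst.
have {un0}u0 : 0 < u by rewrite lt_neqAle eq_sym un0.
rewrite gtr0_sg//; move: u1; rewrite gtr0_norm// => u1.
pose a n := iter n sgn_step u.
have a01 n : u <= a n <= 1.
  elim: n => [|n /andP[h1 h2]]; first by rewrite lexx u1.
  have an0 : 0 <= a n by exact: le_trans (ltW u0) h1.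
  have h3 : `|sgn_step (a n)| <= 1 by apply: sgn_step_bound; rewrite ger0_norm.
  rewrite [a _]/= -/(a n) (le_trans (ler_norm _) h3) andbT.
  apply: le_trans h1 _; rewrite /sgn_step.
  have : 0 <= a n * (1 - a n) * (1 + a n) by rewrite !mulr_ge0//; lra.
  nra.
have a_nd : nondecreasing_seq a.
  apply/nondecreasing_seqP => n; rewrite [a n.+1]/= -/(a n) /sgn_step.
  have /andP[h1 h2] := a01 n.
  have : 0 <= a n * (1 - a n) * (1 + a n) by rewrite !mulr_ge0//; lra.
  nra.
have ca : cvgn a.
  by apply: nondecreasing_is_cvgn => //; exists 1 => _ [n _ <-]; have /andP[] := a01 n.
have h1 : a n.+1 @[n --> \oo] --> limn a by move: ca; rewrite -(cvg_shiftS a).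
have h2 : a n.+1 @[n --> \oo] --> sgn_step (limn a).
  apply: cvgM; last exact: cvg_cst.
  by apply: cvgB; [apply: cvgM => //; exact: cvg_cst|do 2 apply: cvgM => //].
(* The limit is at least [u > 0] and is a fixed point of the step, whose fixed points are -1, 0 and
   1. *)
have E := cvg_uniq h1 h2.
have ul : u <= limn a by apply: limr_ge => //; apply: nearW => n; have /andP[] := a01 n.
suff <- : limn a = 1 by [].
move: E ul; rewrite /sgn_step; move: (limn a) => l E ul.
have l0 : 0 < l by exact: lt_le_trans ul.
have : l * ((1 - l) * (1 + l)) = 0 by nra.
move/eqP; rewrite !mulf_eq0 gt_eqF//= subr_eq0 => /orP[/eqP//|/eqP h].
exfalso; lra.
Qed.

End sign_limit.

Section cramer_wold.
Context (R : realType) (H : sepHilbertType R).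
Implicit Types (x y z : H).

Lemma measurable_inner y : measurable_fun setT (fun x : borel H => inner (x : H) y).
Proof.
move=> mT; apply: (measurability _ (RGenOInfty.measurableE R)) => // _ [_ [a ->] <-].
apply: sub_sigma_algebra; rewrite setTI.
apply: open_comp; last exact: rray_open.
by move=> x _; exact: inner_continuousl.
Qed.

Variables mu nu : {finite_measure set (borel H) -> \bar R}.

Let bmeas (f : borel H -> R) := measurable_fun setT f /\ exists M, forall x, `|f x| <= M.

(** The weights against which all trigonometric integrals agree; the phase [b] covers sines and
    cosines at once. *)
Let W (w : borel H -> R) := bmeas w /\ forall y b,
  \int[mu]_x (w x * cos (inner (x : H) y + b)) = \int[nu]_x (w x * cos (inner (x : H) y + b)).

(** Being a multiplier of [W], rather than a member, is stable under products. The multipliers form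
    an algebra closed under uniformly bounded pointwise limits, and they contain the cosines. *)
Let Mul (f : borel H -> R) := bmeas f /\ forall w, W w -> W (fun x => w x * f x).

Let bmeasM f g : bmeas f -> bmeas g -> bmeas (fun x => f x * g x).
Proof.
move=> [mf [M fM]] [mg [K gK]]; split; first exact: measurable_funM.
by exists (M * K) => x; rewrite normrM ler_pM.
Qed.

Let bmeasD f g a : bmeas f -> bmeas g -> bmeas (fun x => a * f x + g x).
Proof.
move=> [mf [M fM]] [mg [K gK]]; split.
  by apply: measurable_funD => //; exact: measurable_funM.
exists (`|a| * M + K) => x; apply: le_trans (ler_normD _ _) _.
by rewrite normrM lerD// ler_wpM2l.
Qed.

Let bmeas_cos y b : bmeas (fun x : borel H => cos (inner (x : H) y + b)).
Proof.
split; last by exists 1 => x; exact: cos_max.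
apply: (measurableT_comp (continuous_measurable_fun (@continuous_cos R))); apply: measurable_funD => //.
exact: measurable_inner.
Qed.

Let bint (m : {finite_measure set (borel H) -> \bar R}) f : bmeas f -> m.-integrable setT (EFin \o f).
Proof. by move=> [mf [M fM]]; exact: (bounded_integrable _ mf fM). Qed.

Let eq_intD a f g : bmeas f -> bmeas g ->
  \int[mu]_x f x = \int[nu]_x f x -> \int[mu]_x g x = \int[nu]_x g x ->
  \int[mu]_x (a * f x + g x) = \int[nu]_x (a * f x + g x).
Proof.
move=> bf bg Ef Eg.
rewrite !RintegralD//; try exact: bint; try exact: (integrableRZ _ (bint _ bf)).
by rewrite !RintegralZl// ?Ef ?Eg//; exact: bint.
Qed.

Let eq_int f g : g =1 f -> \int[mu]_x f x = \int[nu]_x f x ->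
  \int[mu]_x g x = \int[nu]_x g x.
Proof. by move=> /funext ->. Qed.

Let W_lin a f g : W f -> W g -> W (fun x => a * f x + g x).
Proof.
move=> [bf cf] [bg cg]; split=> [|y b]; first exact: bmeasD.
apply: (eq_int (f := fun x => a * (f x * cos (inner (x : H) y + b)) + g x * cos (inner (x : H) y + b))).
  by move=> x; rewrite mulrDl mulrA.
by apply: eq_intD => //; exact: bmeasM.
Qed.

Let bmeas0 : bmeas (fun=> 0).
Proof. by split => //; exists 0 => x; rewrite normr0. Qed.

(** A product of two cosines is a half sum of cosines, and [W] quantifies over all frequencies and
    phases. *)
Let Mul_cos z c : Mul (fun x : borel H => cos (inner (x : H) z + c)).
Proof.
split=> // w [bw cw]; split=> [|y b]; first exact: bmeasM.
apply: (eq_int (f := fun x => 2^-1 * (w x * cos (inner (x : H) (z + y) + (c + b))) +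
   (2^-1 * (w x * cos (inner (x : H) (z - y) + (c - b))) + 0))).
  move=> x; rewrite innerDr innerBr addr0.
  have -> : inner x z + inner x y + (c + b) = inner x z + c + (inner x y + b) by ring.
  have -> : inner x z - inner x y + (c - b) = inner x z + c - (inner x y + b) by ring.
  by move: (inner _ z + c) (inner _ y + b) => p q; rewrite cosD cosB; field.
apply: (eq_intD _ (bmeasM _ _)) => //.
  by apply: bmeasD => //; exact: bmeasM.
by apply: (@eq_intD _ _ (fun=> 0)) => //; [exact: bmeasM|rewrite !Rintegral_cst// !mul0r].
Qed.

Let Mul_lin a f g : Mul f -> Mul g -> Mul (fun x => a * f x + g x).
Proof.
move=> [bf Mf] [bg Mg]; split=> [|w Ww]; first exact: bmeasD.
rewrite (_ : (fun x => _) = fun x => a * (w x * f x) + w x * g x).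
  by apply: W_lin; [exact: Mf|exact: Mg].
by apply/funext => x; ring.
Qed.

Let Mul_mul f g : Mul f -> Mul g -> Mul (fun x => f x * g x).
Proof.
move=> [bf Mf] [bg Mg]; split=> [|w Ww]; first exact: bmeasM.
rewrite (_ : (fun x => _) = fun x => w x * f x * g x); first by apply: Mg; exact: Mf.
by apply/funext => x; rewrite mulrA.
Qed.

Let Mul_lim (f_ : nat -> borel H -> R) (f : borel H -> R) : (forall n, Mul (f_ n)) ->
  (forall n (x : borel H), `|f_ n x| <= 1) ->
  (forall x : borel H, f_ n x @[n --> \oo] --> f x) -> Mul f.
Proof.
move=> Mf_ f1 ff.
have mf : measurable_fun setT f.
  by apply: (measurable_fun_cvg (fun n => (Mf_ n).1.1)) => x _; exact: ff.
have fx x : `|f x| <= 1.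
  by apply: (cvg_le_cst (cvg_norm (ff x))); exact: nearW.
have bf : bmeas f by split => //; exists 1.
split=> // w [bw cw]; split=> [|y b]; first exact: bmeasM.
have [mw [K wK]] := bw.
have cv (m : {finite_measure set (borel H) -> \bar R}) :
    \int[m]_x (w x * f_ n x * cos (inner (x : H) y + b)) @[n --> \oo] -->
    \int[m]_x (w x * f x * cos (inner (x : H) y + b)).
  apply: (@Rintegral_bounded_cvg _ _ _ m _ _ (K * 1 * 1)).
  - by move=> n; have [] := bmeasM (bmeasM bw (Mf_ n).1) (bmeas_cos y b).
  - by have [] := bmeasM (bmeasM bw bf) (bmeas_cos y b).
  - by move=> x; apply: cvgM; [apply: cvgM => //|]; exact: cvg_cst.
  - move=> n x; rewrite !normrM !ler_pM// ?mulr_ge0//; exact: cos_max.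
apply: (cvg_uniq (cv mu)); rewrite (_ : (fun n => _) = fun n =>
  \int[nu]_x (w x * f_ n x * cos (inner (x : H) y + b))); first exact: cv.
by apply/funext => n; have [_ /(_ w (conj bw cw)) [_ ->]] := Mf_ n.
Qed.

Let Mul_sgn (s : borel H -> R) : Mul s -> (forall x, `|s x| <= 1) -> Mul (fun x => Num.sg (s x)).
Proof.
move=> Ms s1; apply: (@Mul_lim (fun n x => iter n (@sgn_step R) (s x))).
- elim=> //= n ih; set u := fun x => iter n (@sgn_step R) (s x) in ih.
  rewrite (_ : (fun x => _) = fun x => - 2^-1 * (u x * u x * u x) + (2^-1 * u x + u x)).
    exact: (Mul_lin _ (Mul_mul (Mul_mul ih ih) ih) (Mul_lin _ ih ih)).
  by apply/funext => x; rewrite /sgn_step /u; field.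
- by move=> n x; exact: iter_sgn_step_bound.
- by move=> x; exact: iter_sgn_step_cvg.
Qed.

(** The sign of [t] is the limit of the sign of [sin (t / n)], the two being equal once [t / n] lies
    within [pi] of 0; and [sin (t / n)] is a cosine with a shifted phase. *)
Let Mul_halfspace z a : Mul (\1_[set x : borel H | a < inner (x : H) z]).
Proof.
have Ms : Mul (fun x => Num.sg (inner (x : H) z - a)).
  apply: (@Mul_lim (fun n x => Num.sg (sin (n.+1%:R^-1 * (inner (x : H) z - a))))).
  - move=> n; apply: Mul_sgn; last by move=> x; exact: sin_max.
    rewrite (_ : (fun x => _) = fun x : borel H => cos (inner (x : H) (n.+1%:R^-1 *: z) + (- n.+1%:R^-1 * a - pi / 2))).
      exact: Mul_cos.
    by apply/funext => x; rewrite innerZr addrA cosBpihalf; congr sin; ring.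
  - by move=> n x; rewrite normr_sg; case: eqP.
  - move=> x; set t := inner x z - a.
    apply: cvg_near_cst; near=> n.
    have n0 : 0 < n.+1%:R^-1 :> R by rewrite invr_gt0.
    have tn : `|n.+1%:R^-1 * t| < pi.
      rewrite normrM gtr0_norm// mulrC ltr_pdivrMr//.
      apply: (@lt_le_trans _ _ (1 * n.+1%:R)); last first.
        by rewrite ler_wpM2r// (le_trans _ (pi_ge2 _))// ler1n.
      rewrite mul1r; apply: (@lt_trans _ _ n%:R); last by rewrite ltr_nat.
      by near: n; exact: nbhs_infty_gtr.
    have [t0|t0|<-] := ltgtP 0 t.
    + rewrite gtr0_sg; last first.
        apply: sin_gt0_pi; rewrite mulr_gt0//=.
        by apply: le_lt_trans tn; exact: ler_norm.
      by rewrite gtr0_sg.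
    + rewrite ltr0_sg; last first.
        rewrite -oppr_gt0 -sinN; apply: sin_gt0_pi.
        rewrite oppr_gt0 pmulr_rlt0// t0 /=.
        by apply: le_lt_trans tn; rewrite -normrN; exact: ler_norm.
      by rewrite ltr0_sg.
    + by rewrite mulr0 sin0 sgr0.
(* The indicator is [(s ^ 2 + s) / 2] for the sign [s], arranged in the shape of [Mul_lin]. *)
rewrite (_ : \1_ _ = fun x : borel H =>
    2^-1 * (Num.sg (inner (x : H) z - a) * Num.sg (inner (x : H) z - a)) +
    (- 2^-1 * Num.sg (inner (x : H) z - a) + Num.sg (inner (x : H) z - a))).
  exact: (Mul_lin _ (Mul_mul Ms Ms) (Mul_lin _ Ms Ms)).
apply/funext => x; rewrite indicE.
have [h|h|h] := ltgtP a (inner x z).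
- by rewrite mem_set//= gtr0_sg ?subr_gt0//; field.
- rewrite memNset/=; last by apply/negP; rewrite -leNgt ltW.
  by rewrite ltr0_sg ?subr_lt0//; field.
- by rewrite memNset/= h ?ltxx// subrr sgr0; field.
Unshelve. all: by end_near. Qed.

Hypothesis cosE : forall y, \int[mu]_x cos (inner (x : H) y) = \int[nu]_x cos (inner (x : H) y).
Hypothesis sinE : forall y, \int[mu]_x sin (inner (x : H) y) = \int[nu]_x sin (inner (x : H) y).

Let W1 : W (fun=> 1).
Proof.
split=> [|y b]; first by split => //; exists 1 => x; rewrite normr1.
apply: (eq_int (f := fun x => cos b * cos (inner (x : H) y + 0) + (- sin b * cos (inner (x : H) y + (- (pi / 2))) + 0))).
  by move=> x; rewrite cosBpihalf addr0 mul1r cosD; ring.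
apply: (eq_intD _ (bmeas_cos _ _)).
- by apply: bmeasD.
- by under eq_Rintegral do rewrite addr0; rewrite cosE; apply: eq_Rintegral => x _; rewrite addr0.
apply: (@eq_intD _ _ (fun=> 0)) => //; last by rewrite !Rintegral_cst// !mul0r.
under eq_Rintegral do rewrite cosBpihalf; rewrite sinE.
by apply: eq_Rintegral => x _; rewrite cosBpihalf.
Qed.

(** A pi-system, since multipliers are stable under products; it contains the half-spaces, and these
    generate the Borel sets. *)
Let good : set (set (borel H)) := [set A | measurable A /\ Mul (\1_A)].

Let good_eq A : good A -> mu A = nu A.
Proof.
move=> [mA MA]; have [b1 /(_ 0 0)] := MA.2 _ W1.
have E (m : {finite_measure set (borel H) -> \bar R}) :
    \int[m]_x (1 * \1_A x * cos (inner (x : H) 0 + 0)) = fine (m A).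
  rewrite (_ : (fun x : borel H => _) = fun x => \1_A x).
    by rewrite /Rintegral integral_indic// setIT.
  by apply/funext => x; rewrite inner0r addr0 cos0 mulr1 mul1r.
by rewrite (E mu) (E nu) => h; rewrite -[LHS]fineK ?fin_num_measure// h fineK// fin_num_measure.
Qed.

Let dseq_ex : exists d : nat -> H, dense (range d).
Proof.
have [D cD dD] := @separable R H.
have [f finj] := countable_injP _ cD.
exists (fun n => xget 0 [set x | D x /\ f x = n]) => U U0 oU.
have [x [Ux Dx]] := dD U U0 oU; exists x; split => //.
exists (f x) => //; case: xgetP => [y -> [Dy fyx]|/(_ x)[]//].
by apply: finj => //; rewrite inE.
Qed.

Let half_measurable z a : good.-sigma.-measurable [set x : H | a < inner x z].
Proof.
apply: sub_sigma_algebra; split; last exact: Mul_halfspace.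
have := measurable_inner z measurableT (measurable_itv `]a, +oo[).
by rewrite setTI; congr measurable; apply/seteqP; split => x /=; rewrite in_itv /= andbT.
Qed.

(** A closed ball is a countable intersection of half-spaces: a point [x] outside is separated by
    the direction [x - c], hence by all nearby directions, among them some [d n]. *)
Let cball_measurable c (r : R) : 0 <= r -> good.-sigma.-measurable [set x : H | `|x - c| <= r].
Proof.
move=> r0; have [d dd] := dseq_ex.
have -> : [set x : H | `|x - c| <= r] =
    \bigcap_n ~` [set x : H | r * `|d n| + inner c (d n) < inner x (d n)].
  apply/seteqP; split => x /= xr.
    move=> n _ /=; apply/negP; rewrite -leNgt -lerBlDr -innerBl.
    by apply: le_trans (inner_le _ _) _; rewrite ler_wpM2r.
  rewrite leNgt; apply/negP => rx.
  pose U := [set y : H | r * `|y| + inner c y < inner x y].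
  have oU : open U.
    rewrite (_ : U = (fun y => inner (x - c) y - r * `|y|) @^-1` `]0, +oo[%classic).
      apply: open_comp; last exact: rray_open.
      move=> y _; apply: cvgB; first exact: inner_continuousr.
      by apply: cvgM; [exact: cvg_cst|exact: norm_continuous].
    apply/seteqP; split => y /=; rewrite /U /= in_itv/= andbT innerBl => h; lra.
  have U0 : U !=set0.
    exists (x - c); rewrite /U /= -ltrBrDr -innerBl inner_norm expr2.
    by rewrite ltr_pM2r// (le_lt_trans r0 rx).
  have [y [Uy [n _ ny]]] := dd U U0 oU.
  by move: Uy; rewrite -ny => Uy; exact: (xr n).
apply: bigcapT_measurable => n; apply: measurableC; exact: half_measurable.
Qed.

(** Countably many closed balls, centered in a dense sequence and with radii [1 / (k + 1)], exhaust
    an open set. *)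
Let open_measurable (U : set H) : open U -> good.-sigma.-measurable U.
Proof.
move=> oU; have [d dd] := dseq_ex.
pose B n k := [set x : H | `|x - d n| <= k.+1%:R^-1].
have -> : U = \bigcup_n \bigcup_(k in [set k | B n k `<=` U]) B n k.
  apply/seteqP; split => x; last by move=> [n _ [k /= BU Bx]]; exact: BU.
  move=> Ux; have /nbhs_ballP [e /= e0 eU] := open_nbhs_nbhs (conj oU Ux).
  have [k ke] : exists k : nat, 2 * k.+1%:R^-1 < e.
    have /cvgrPdist_lt/(_ (e / 2)) := @cvg_harmonic R.
    rewrite divr_gt0// => /(_ isT) [k _ /(_ k (leqnn k))].
    rewrite /= sub0r normrN ger0_norm ?invr_ge0// => h; exists k.
    by rewrite mulrC -ltr_pdivlMr.
  have k0 : 0 < k.+1%:R^-1 :> R by rewrite invr_gt0.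
  have [||y0 [xn [n _ nE]]] := dd (ball x k.+1%:R^-1).
  - by exists x; exact: ballxx.
  - exact: ball_open.
  move: xn; rewrite -nE -ball_normE /= => xn.
  exists n => //; exists k; last by rewrite /B /= ltW.
  move=> y /= yn; apply: eU; rewrite -ball_normE /=.
  apply: le_lt_trans ke; rewrite -(subrK (d n) x) -addrA.
  by apply: le_trans (ler_normD _ _) _; rewrite (distrC (d n)); move: yn (ltW xn); rewrite /B /=;
    move: (k.+1%:R^-1) => t h1 h2; lra.
apply: bigcupT_measurable => n; apply: bigcup_measurable => k _.
by apply: cball_measurable; rewrite invr_ge0.
Qed.

Lemma cramer_wold A : measurable A -> mu A = nu A.
Proof.
apply: (measure_unique good (fun=> setT)).
- apply/seteqP; split.
    apply: smallest_sub; first exact: smallest_sigma_algebra.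
    by move=> U oU; exact: open_measurable.
  apply: smallest_sub; first exact: sigma_algebra_measurable.
  by move=> U [].
- move=> X Y [mX MX] [mY MY]; split; first exact: measurableI.
  by rewrite indicI; exact: Mul_mul.
- move=> _; split; first exact: measurableT.
  rewrite (_ : \1_setT = fun=> 1); last by apply/funext => x; rewrite indicT.
  split=> [|w Ww]; first by case: W1.
  by rewrite (_ : (fun x => _) = w)//; apply/funext => x; rewrite mulr1.
- by rewrite bigcup_const.
- exact: good_eq.
- by move=> _; rewrite -ge0_fin_numE// fin_num_measure.
Qed.

End cramer_wold.

(** * Square integrable functions *)

Section L2_theory.
Context d (T : measurableType d) (R : realType) (mu : probability T R).
Implicit Types f g h : T -> R.
Local Notation L2 := (Lfun mu 2%:E).
Local Notation cl := (L2_class mu).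

Lemma L2_measurable f : f \in L2 -> measurable_fun setT f.
Proof. exact: (@Lfun_measurable _ _ _ mu 2%:E). Qed.

Lemma L2_sqr_integrable f : f \in L2 -> mu.-integrable setT (EFin \o (fun x => f x * f x)).
Proof. exact: Lfun2_integrable_sqr. Qed.

Lemma L2_mul_integrable f g : f \in L2 -> g \in L2 ->
  mu.-integrable setT (EFin \o (fun x => f x * g x)).
Proof. by move=> f2 g2; apply/Lfun1_integrable; exact: Lfun2_mul_Lfun1. Qed.

Let sqrE f x : (`|(EFin \o f) x| `^ 2)%E = (f x * f x)%:E.
Proof. by rewrite [LHS]poweR_EFin powR_mulrn// real_normK ?num_real. Qed.

Lemma L2I f : measurable_fun setT f -> mu.-integrable setT (EFin \o (fun x => f x * f x)) ->
  f \in L2.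
Proof.
move=> mf /integrableP[_ If]; rewrite inE; apply/andP; split; rewrite inE//=.
rewrite /finite_norm unlock /=; apply: poweR_lty.
apply: le_lt_trans If; rewrite le_eqVlt; apply/orP; left; apply/eqP.
apply: eq_integral => x _; rewrite -[LHS]/(`|(EFin \o f) x| `^ 2)%E sqrE /=.
by rewrite ger0_norm// -expr2 sqr_ge0.
Qed.

Lemma L2_cst c : cst c \in L2.
Proof. exact: Lfun_cst. Qed.

Lemma L2_class_norm f : f \in L2 -> `|cl f| ^+ 2 = \int[mu]_x (f x * f x).
Proof.
move=> f2; have f2' := Lspace_funP (cl f).
have E : 'N[mu]_2%:E[EFin \o Lspace_fun (cl f)]%E = 'N[mu]_2%:E[EFin \o f]%E.
  apply: (Lnorm_ae (p := 2%:E) (lee1n 2)).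
  - exact: L2_measurable.
  - exact: L2_measurable.
  - exact: to_LspaceE.
rewrite -[`|cl f|]/(fine ('N[mu]_2%:E[EFin \o Lspace_fun (cl f)]%E)) E.
have fin : 'N[mu]_2%:E[EFin \o f]%E \is a fin_num.
  by rewrite ge0_fin_numE ?Lnorm_ge0//; exact: Lfun_finite.
have /= := @powR_Lnorm _ _ _ mu (EFin \o f) 2 (ltac:(by rewrite pnatr_eq0)).
rewrite -[in LHS](fineK fin) poweR_EFin powR_mulrn ?fine_ge0 ?Lnorm_ge0// => h.
rewrite /Rintegral -[LHS]/(fine (_ %:E)) h; congr fine.
by apply: eq_integral => x _; exact: sqrE.
Qed.

Lemma L2_class_ae f g : f \in L2 -> g \in L2 -> f = g %[ae mu] -> cl f = cl g.
Proof.
move=> f2 g2 fg; apply: Lspace_eq.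
apply: (ae_eq_trans (to_LspaceE _ f2)); apply: (ae_eq_trans fg).
by apply: ae_eq_sym; exact: to_LspaceE.
Qed.

Lemma L2_class_inj f g : f \in L2 -> g \in L2 -> cl f = cl g -> f = g %[ae mu].
Proof.
move=> f2 g2 fg; apply: (ae_eq_trans (ae_eq_sym (to_LspaceE (lee1n 2) f2))).
by rewrite -[to_Lspace _ _ f]/(cl f) fg; exact: to_LspaceE.
Qed.

Lemma L2_classK (u : LspaceType2 mu) : cl (Lspace_fun u) = u.
Proof. by apply: Lspace_eq; apply: to_LspaceE; exact: Lspace_funP. Qed.

Lemma L2_lin a f g : f \in L2 -> g \in L2 -> (fun x => a * f x + g x) \in L2.
Proof.
by move=> f2 g2; have := (Lfun_submod_closed mu (lee1n 2)).2 a f g f2 g2.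
Qed.

Lemma L2_class_lin a f g : f \in L2 -> g \in L2 ->
  cl (fun x => a * f x + g x) = a *: cl f + cl g.
Proof.
move=> f2 g2; apply: Lspace_eq.
apply: (ae_eq_trans (to_LspaceE _ (L2_lin a f2 g2))); apply: ae_eq_sym.
apply: (filterS _ (filterI (filterI (filterI (Lspace_funD (a *: cl f) (cl g))
   (Lspace_funZ a (cl f))) (to_LspaceE (lee1n 2) f2)) (to_LspaceE (lee1n 2) g2))).
by move=> x [[[/(_ I) -> /(_ I) ->] /(_ I) h1] /(_ I) h2] _; rewrite -h1 -h2.
Qed.

Lemma L2_B f g : f \in L2 -> g \in L2 -> (fun x => f x - g x) \in L2.
Proof.
move=> f2 g2; rewrite (_ : (fun x => _) = fun x => -1 * g x + f x); first exact: L2_lin.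
by apply/funext => x; rewrite mulN1r addrC.
Qed.

Lemma L2_class_B f g : f \in L2 -> g \in L2 -> cl (fun x => f x - g x) = cl f - cl g.
Proof.
move=> f2 g2; rewrite (_ : (fun x => _) = fun x => -1 * g x + f x).
  by rewrite L2_class_lin// scaleN1r addrC.
by apply/funext => x; rewrite mulN1r addrC.
Qed.

Lemma L2_class0 : cl (cst 0) = 0.
Proof.
apply/eqP; rewrite -normr_eq0 -sqrf_eq0 L2_class_norm ?L2_cst//; apply/eqP.
by apply: etrans (prob_Rintegral_cst mu 0); apply: eq_Rintegral => x _; rewrite mulr0.
Qed.

Lemma L2_dist f g : f \in L2 -> g \in L2 ->
  `|cl f - cl g| ^+ 2 = \int[mu]_x ((f x - g x) * (f x - g x)).
Proof. by move=> f2 g2; rewrite -L2_class_B// L2_class_norm//; exact: L2_B. Qed.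

(** The variance of the absolute value of [f] is nonnegative. *)
Lemma L2_abs_le f : f \in L2 -> (\int[mu]_x `|(f x)%:E| <= `|cl f|%:E)%E.
Proof.
move=> f2.
have If : mu.-integrable setT (EFin \o f).
  apply/Lfun1_integrable.
  apply: Lfun_subset12 => //.
  by rewrite fin_num_measure.
have Ia : mu.-integrable setT (EFin \o (fun x => `|f x|)) by exact: (integrable_abse If).
have -> : (\int[mu]_x `|(f x)%:E| = (\int[mu]_x `|f x|)%:E)%E.
  by rewrite /Rintegral fineK//; exact: integrable_fin_num.
rewrite lee_fin; set m := \int[mu]_x _.
have m0 : 0 <= m by apply: Rintegral_ge0.
rewrite -ler_sqr ?nnegrE// L2_class_norm//.
have : 0 <= \int[mu]_x ((`|f x| - m) * (`|f x| - m)).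
  by apply: Rintegral_ge0 => x _; rewrite -expr2 sqr_ge0.
have -> : \int[mu]_x ((`|f x| - m) * (`|f x| - m)) =
    \int[mu]_x (f x * f x - 2 * m * `|f x| + m * m).
  apply: eq_Rintegral => x _; rewrite -[f x * f x]expr2 -[f x ^+ 2]real_normK ?num_real//.
  ring.
have I1 := L2_sqr_integrable f2.
have I2 := integrableRZ (2 * m) Ia.
have I3 : mu.-integrable setT (EFin \o (fun=> m * m)).
  by apply: (@bounded_integrable _ _ _ _ _ `|m * m|).
rewrite RintegralD//; last exact: (integrableRB I1 I2).
rewrite RintegralB// RintegralZl// (prob_Rintegral_cst mu) -/m.
by rewrite expr2; lra.
Qed.

End L2_theory.

Section fatou_real.
Context d (T : measurableType d) (R : realType) (mu : {measure set T -> \bar R}).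

(** The bound lives in the extended reals, so that integrability of the limit can be a
    conclusion. *)
Lemma fatou_le (h_ : nat -> T -> R) (h : T -> R) (C : \bar R) :
  (forall n, measurable_fun setT (h_ n)) -> measurable_fun setT h ->
  (forall n x, 0 <= h_ n x) -> (forall x, 0 <= h x) ->
  {ae mu, forall x, h_ n x @[n --> \oo] --> h x} ->
  (\forall n \near \oo, (\int[mu]_x (h_ n x)%:E <= C)%E) ->
  (\int[mu]_x (h x)%:E <= C)%E.
Proof.
move=> mh_ mh h_0 h0 hh hC.
have mE n : measurable_fun setT (EFin \o h_ n) by exact/measurable_EFinP.
have -> : (\int[mu]_x (h x)%:E = \int[mu]_x limn_einf (fun n => (h_ n x)%:E))%E.
  apply: ge0_ae_eq_integral => //.
  - exact/measurable_EFinP.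
  - apply: measurableT_comp => //; apply: measurable_fun_limn_esup => n.
    by apply: measurableT_comp => //; exact: mE.
  - by move=> x _; rewrite lee_fin.
  - move=> x _; rewrite limn_einf_lim; apply: lime_ge; first exact: is_cvg_einfs.
    apply: nearW => n; apply: le_ereal_inf_tmp => _ [m _ <-].
    by rewrite lee_fin.
  - apply: filterS hh => x hx _.
    have hE : (h_ n x)%:E @[n --> \oo] --> (h x)%:E by apply: cvg_EFin => //; exact: nearW.
    by have [-> _] := cvg_limn_einf_sup hE.
apply: le_trans (fatou _ measurableT mE _) _.
  by move=> n x _; rewrite lee_fin.
rewrite limn_einf_lim; apply: lime_le; first exact: is_cvg_einfs.
near=> n; apply: (@le_trans _ _ (\int[mu]_x (h_ n x)%:E)%E).
  by apply: ereal_inf_lbound; exists n => /=.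
by near: n.
Unshelve. all: by end_near. Qed.

End fatou_real.

(** * Almost sure limits of fast L2 Cauchy sequences *)

Section riesz_fischer.
Context d (T : measurableType d) (R : realType) (mu : probability T R).
Local Notation L2 := (Lfun mu 2%:E).
Local Notation cl := (L2_class mu).
Variables (f : nat -> T -> R) (K : R).
Hypotheses (f2 : forall n, f n \in L2).
Hypothesis (fK : forall m n, `|cl (f m) - cl (f n)| <= K * (2^-1 ^+ m + 2^-1 ^+ n)).

(** Built pointwise from the sequence alone: the same function serves every measure under which the
    sequence is fast. *)
Let F x := fine (limn_esup (fun n => (f n x)%:E)).

Lemma fast_measurable : measurable_fun setT F.
Proof.
apply: measurableT_comp => //; apply: measurable_fun_limn_esup => n.
by apply/measurable_EFinP; exact: L2_measurable.
Qed.

Let K0 : 0 <= K.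
Proof. by have := le_trans (normr_ge0 _) (fK 0 0); rewrite !expr0; lra. Qed.

Let fS n : (\int[mu]_x `|(f n.+1 x - f n x)%:E| <= (2 * K * 2^-1 ^+ n)%:E)%E.
Proof.
apply: le_trans (L2_abs_le (L2_B (f2 n.+1) (f2 n))) _.
rewrite lee_fin L2_class_B//; apply: le_trans (fK _ _) _.
rewrite exprS; have : 0 <= (2^-1 : R) ^+ n by apply: exprn_ge0.
move: (_ ^+ n) => t t0; have := mulr_ge0 K0 t0; nra.
Qed.

(** The increments have summable L1 norms, so the sum of their absolute values is integrable, hence
    finite almost everywhere. *)
Lemma fast_ae_cvg : {ae mu, forall x, f n x @[n --> \oo] --> F x}.
Proof.
pose g n x := `|(f n.+1 x - f n x)%:E|%E.
have mg n : measurable_fun setT (g n).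
  apply: measurableT_comp => //; apply/measurable_EFinP.
  by apply: measurable_funB; exact: L2_measurable.
have g0 n x : setT x -> (0 <= g n x)%E by move=> _; exact: abse_ge0.
pose G x := (\sum_(n <oo) g n x)%E.
have IG : mu.-integrable setT G.
  apply/integrableP; split.
    by apply: ge0_emeasurable_sum => // n x _ _; exact: g0.
  have -> : (\int[mu]_x `|G x| = \int[mu]_x G x)%E.
    by apply: eq_integral => x _; rewrite gee0_abs//; apply: nneseries_ge0 => n _ _; exact: g0.
  rewrite (integral_nneseries mu measurableT mg g0).
  apply: (@le_lt_trans _ _ (\sum_(n <oo) (2 * K * 2^-1 ^+ n)%:E)%E).
    by apply: lee_nneseries => n _ *; [apply: integral_ge0 => x _; exact: abse_ge0|exact: fS].
  apply: (@le_lt_trans _ _ (2 * (2 * K))%:E); last exact: ltry.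
  apply: lime_le.
    apply: is_cvg_nneseries => n _ _; rewrite lee_fin !mulr_ge0 ?exprn_ge0//.
  apply: nearW => n; rewrite sumEFin lee_fin -mulr_sumr mulrC ler_wpM2r ?mulr_ge0//.
  elim: n => [|n ih]; first by rewrite big_geq.
  rewrite big_nat_recl// expr0 (eq_bigr (fun i => 2^-1 * 2^-1 ^+ i)); last first.
    by move=> i _; rewrite exprS.
  by rewrite -mulr_sumr; lra.
have := integrable_ae measurableT IG; apply: filterS => x /(_ I) Gx.
have cs : cvgn (series (telescope (f ^~ x))).
  apply: normed_cvg; apply: nondecreasing_is_cvgn.
    by apply/nondecreasing_series => i _ _; exact: normr_ge0.
  exists (fine (G x)) => _ [n _ <-]; rewrite -lee_fin fineK//.
  rewrite /series /= -sumEFin; apply: nneseries_lim_ge => i _.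
  by rewrite lee_fin.
have fl : cvgn (f ^~ x).
  rewrite (_ : f ^~ x = fun n => f 0%N x + series (telescope (f ^~ x)) n).
    by apply: is_cvgD => //; exact: is_cvg_cst.
  by apply/funext => n; exact: eq_sum_telescope.
have lE : (f n x)%:E @[n --> \oo] --> (limn (f ^~ x))%:E by apply: cvg_EFin => //; exact: nearW.
by rewrite /F; have [_ ->] := cvg_limn_einf_sup lE.
Qed.

Let fast_dist_int n :
  (\int[mu]_x ((F x - f n x) * (F x - f n x))%:E <= ((2 * K * 2^-1 ^+ n) ^+ 2)%:E)%E.
Proof.
have mB (a b : T -> R) : measurable_fun setT a -> measurable_fun setT b ->
    measurable_fun setT (fun x => (a x - b x) * (a x - b x)).
  by move=> ma mb; apply: measurable_funM; exact: measurable_funB.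
apply: (@fatou_le _ _ _ _ (fun m x => (f m x - f n x) * (f m x - f n x))).
- by move=> m; apply: mB; exact: L2_measurable.
- by apply: mB; [exact: fast_measurable|exact: L2_measurable].
- by move=> m x; rewrite -expr2 sqr_ge0.
- by move=> x; rewrite -expr2 sqr_ge0.
- apply: filterS fast_ae_cvg => x fx.
  by apply: cvgM; apply: cvgB => //; exact: cvg_cst.
near=> m.
have -> : (\int[mu]_x ((f m x - f n x) * (f m x - f n x))%:E =
    (\int[mu]_x ((f m x - f n x) * (f m x - f n x)))%:E)%E.
  rewrite /Rintegral fineK//; apply: integrable_fin_num => //.
  exact: (L2_sqr_integrable (L2_B (f2 m) (f2 n))).
rewrite lee_fin -L2_dist// ler_sqr ?nnegrE ?mulr_ge0 ?exprn_ge0//.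
apply: le_trans (fK m n) _.
have : (2^-1 : R) ^+ m <= 2^-1 ^+ n.
  apply: ler_wiXn2l => //; first by rewrite invr_le1 ?unitfE// ler1n.
  by near: m; exact: nbhs_infty_ge.
move: (_ ^+ m) (_ ^+ n) (K0) => s t k0 st; nra.
Unshelve. all: by end_near. Qed.

Lemma fast_L2 : F \in L2.
Proof.
suff h : (fun x => F x - f 0%N x) \in L2.
  rewrite (_ : F = fun x => 1 * (F x - f 0%N x) + f 0%N x); first exact: L2_lin.
  by apply/funext => x; rewrite mul1r subrK.
have mB : measurable_fun setT (fun x => F x - f 0%N x).
  by apply: measurable_funB; [exact: fast_measurable|exact: L2_measurable].
apply: L2I => //; apply/integrableP; split.
  by apply/measurable_EFinP; exact: measurable_funM.
apply: le_lt_trans (ltry ((2 * K * 2^-1 ^+ 0) ^+ 2)).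
apply: le_trans (fast_dist_int 0); rewrite le_eqVlt; apply/orP; left; apply/eqP.
by apply: eq_integral => x _ /=; rewrite ger0_norm// -expr2 sqr_ge0.
Qed.

Lemma fast_dist n : `|cl F - cl (f n)| <= 2 * K * 2^-1 ^+ n.
Proof.
rewrite -ler_sqr ?nnegrE ?mulr_ge0 ?exprn_ge0// L2_dist//; last exact: fast_L2.
rewrite -lee_fin /Rintegral fineK//; apply: integrable_fin_num => //.
exact: (L2_sqr_integrable (L2_B fast_L2 (f2 n))).
Qed.

End riesz_fischer.

(** * Gaussian quadratic forms *)

Section integral_lin.
Context d (T : measurableType d) (R : realType) (mu : {measure set T -> \bar R}).
Implicit Types f g : T -> R.

Lemma Rintegral_lin a f g : mu.-integrable setT (EFin \o f) -> mu.-integrable setT (EFin \o g) ->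
  \int[mu]_x (a * f x + g x) = a * \int[mu]_x f x + \int[mu]_x g x.
Proof.
move=> If Ig; rewrite (@RintegralD _ _ _ mu setT (fun x => a * f x) g)//; last exact: integrableRZ.
by rewrite (@RintegralZl _ _ _ mu setT f a).
Qed.

Lemma integrable_lin a f g : mu.-integrable setT (EFin \o f) -> mu.-integrable setT (EFin \o g) ->
  mu.-integrable setT (EFin \o (fun x => a * f x + g x)).
Proof. by move=> If Ig; apply: integrableRD => //; exact: integrableRZ. Qed.

End integral_lin.

Section law.
Context d d' (T : measurableType d) (Y : measurableType d') (R : realType).
Variables (mu : {measure set T -> \bar R}) (nu : {measure set Y -> \bar R}) (X : T -> Y).
Hypotheses (mX : measurable_fun setT X) (XE : forall A, measurable A -> mu (X @^-1` A) = nu A).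

Lemma law_ge0_integral (f : Y -> \bar R) : measurable_fun setT f -> (forall y, 0 <= f y)%E ->
  (\int[mu]_x f (X x) = \int[nu]_y f y)%E.
Proof.
move=> mf f0; have /= <- := @ge0_integral_pushforward _ _ _ _ R X mX mu setT f measurableT mf (fun y _ => f0 y).
by apply: eq_measure_integral => A mA _; exact: XE.
Qed.

Lemma law_integrable (f : Y -> R) : measurable_fun setT f -> nu.-integrable setT (EFin \o f) ->
  mu.-integrable setT (EFin \o (fun x => f (X x))).
Proof.
move=> mf /integrableP[_ If]; apply/integrableP; split.
  by apply/measurable_EFinP; apply: measurableT_comp mX.
apply: le_lt_trans If; rewrite -(law_ge0_integral (f := fun y => `|(f y)%:E|%E))//.
by apply: measurableT_comp => //; exact/measurable_EFinP.
Qed.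

Lemma law_Rintegral (f : Y -> R) : measurable_fun setT f ->
  \int[mu]_x f (X x) = \int[nu]_y f y.
Proof.
move=> mf; have mE : measurable_fun setT (EFin \o f) by exact/measurable_EFinP.
rewrite /Rintegral; congr fine; rewrite integralE [RHS]integralE; congr (_ - _)%E.
- rewrite -(law_ge0_integral (f := (EFin \o f)^\+%E)) => [||y].
  + by apply: eq_integral => x _; rewrite !funeposE.
  + exact: measurable_funepos.
  + exact: funepos_ge0.
- rewrite -(law_ge0_integral (f := (EFin \o f)^\-%E)) => [||y].
  + by apply: eq_integral => x _; rewrite !funenegE.
  + exact: measurable_funeneg.
  + exact: funeneg_ge0.
Qed.

End law.

(** * One-dimensional marginals and moments *)

Section marginal.
Context (R : realType) (H : sepHilbertType R) (C : H -> H) (P : probability (borel H) R).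
Hypothesis gP : gaussian C P.
Local Notation v y := (inner (C y) y).

Let N y := normal_prob (R := R) 0 (Num.sqrt (v y)).

Let law y : v y != 0 -> forall A, measurable A ->
  P ((fun x : borel H => inner (x : H) y) @^-1` A) = N y A.
Proof. by move=> vy A mA; apply: (etrans (gP y mA)); rewrite /centered_normal (negbTE vy). Qed.

Section positive_variance.
Variable y : H.
Hypothesis vy : 0 < v y.
Let mX := @measurable_inner R H y.
Let yl := law (lt0r_neq0 vy).

Lemma gauss_integrable (f : R -> R) : measurable_fun setT f ->
  (normal_prob 0 (Num.sqrt (v y))).-integrable setT (EFin \o f) ->
  P.-integrable setT (EFin \o (fun x : borel H => f (inner (x : H) y))).
Proof. by move=> mf If; exact: (@law_integrable _ _ _ _ _ _ (N y) _ mX yl f mf If). Qed.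

Lemma gauss_Rintegral (f : R -> R) : measurable_fun setT f ->
  \int[P]_x f (inner (x : H) y) = \int[normal_prob 0 (Num.sqrt (v y))]_t f t.
Proof. by move=> mf; exact: (@law_Rintegral _ _ _ _ _ _ (N y) _ mX yl f mf). Qed.

End positive_variance.

Hypothesis v_gt0 : forall y, y != 0 -> 0 < v y.

Let v0 : v 0 = 0. Proof. exact: inner0r. Qed.

Let mpow n : measurable_fun setT (fun x : R => x ^+ n).
Proof. exact: exprn_measurable. Qed.

Lemma gauss_sqr y : \int[P]_x (inner (x : H) y ^+ 2) = v y.
Proof.
have [->|/v_gt0 y0] := eqVneq y 0.
  rewrite v0; under eq_Rintegral do rewrite inner0r expr0n /=.
  exact: prob_Rintegral_cst.
rewrite (@gauss_Rintegral y y0 (fun x => x ^+ 2))// -[RHS](normal_sqr y0).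
by apply: eq_Rintegral => x _; rewrite expr2.
Qed.

Lemma gauss_pow4 y : \int[P]_x (inner (x : H) y ^+ 4) = 3 * v y ^+ 2.
Proof.
have [->|/v_gt0 y0] := eqVneq y 0.
  rewrite v0 expr0n mulr0; under eq_Rintegral do rewrite inner0r expr0n /=.
  exact: prob_Rintegral_cst.
by rewrite (@gauss_Rintegral y y0 (fun x => x ^+ 4))//; exact: normal_pow4.
Qed.

Lemma gauss_pow4_integrable y :
  P.-integrable setT (EFin \o (fun x : borel H => inner (x : H) y ^+ 4)).
Proof.
have [->|/v_gt0 y0] := eqVneq y 0.
  apply: (@bounded_integrable _ _ _ _ _ 0) => [|x]; last by rewrite inner0r expr0n normr0.
  exact: measurableT_comp (mpow 4) (measurable_inner 0).
apply: (@gauss_integrable y y0 (fun x => x ^+ 4)) => //; exact: normal_pow4_integrable.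
Qed.

Lemma gauss_cos y : \int[P]_x cos (inner (x : H) y) = expR (- v y / 2).
Proof.
have [->|/v_gt0 y0] := eqVneq y 0.
  rewrite v0 oppr0 mul0r expR0; under eq_Rintegral do rewrite inner0r cos0.
  exact: prob_Rintegral_cst.
rewrite (@gauss_Rintegral y y0 cos)//; last first.
  by apply: continuous_measurable_fun => x; exact: continuous_cos.
have := normal_cos y0 1; rewrite expr1n mulr1 => <-.
by apply: eq_Rintegral => x _; rewrite mul1r.
Qed.

Lemma gauss_sin y : \int[P]_x sin (inner (x : H) y) = 0.
Proof.
have [->|/v_gt0 y0] := eqVneq y 0.
  under eq_Rintegral do rewrite inner0r sin0.
  exact: prob_Rintegral_cst.
rewrite (@gauss_Rintegral y y0 sin)//; last first.
  by apply: continuous_measurable_fun => x; exact: continuous_sin.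
apply: (etrans _ (normal_sin y0 1)).
by apply: eq_Rintegral => x _; rewrite mul1r.
Qed.

Lemma gauss_sqr_L2 y : (fun x : borel H => inner (x : H) y ^+ 2) \in Lfun P 2%:E.
Proof.
apply: L2I; first exact: measurableT_comp (mpow 2) (measurable_inner y).
apply: eq_integrable (gauss_pow4_integrable y) => // x _ /=.
by rewrite -exprD.
Qed.

Hypotheses (lC : linear C) (saC : self_adjoint C).

(** Wick's formula, obtained from one-dimensional marginals only: [(X + Y) ^ 4 + (X - Y) ^ 4]
    isolates [12 X ^ 2 Y ^ 2] among fourth moments of single variables. *)
Lemma gauss_sqr_mul y z : \int[P]_x (inner (x : H) y ^+ 2 * inner (x : H) z ^+ 2) =
  v y * v z + 2 * inner (C y) z ^+ 2.
Proof.
pose X y (x : borel H) := inner (x : H) y.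
have I4 u : P.-integrable setT (EFin \o (fun x => X u x ^+ 4)) by exact: gauss_pow4_integrable.
have I22 : P.-integrable setT (EFin \o (fun x => X y x ^+ 2 * X z x ^+ 2)).
  exact: L2_mul_integrable (gauss_sqr_L2 y) (gauss_sqr_L2 z).
have h : \int[P]_x (X (y + z) x ^+ 4 + X (y - z) x ^+ 4) =
    \int[P]_x (12 * (X y x ^+ 2 * X z x ^+ 2) + (2 * X y x ^+ 4 + (2 * X z x ^+ 4 + 0))).
  by apply: eq_Rintegral => x _; rewrite /X innerDr innerBr; ring.
have I0 : P.-integrable setT (EFin \o (fun=> 0)) 
  by apply: (@bounded_integrable _ _ _ _ _ 0) => // x; rewrite normr0.
move: h; rewrite RintegralD//.
rewrite (Rintegral_lin 12 I22 (integrable_lin 2 (I4 y) (integrable_lin 2 (I4 z) I0))).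
rewrite (Rintegral_lin 2 (I4 y) (integrable_lin 2 (I4 z) I0)) (Rintegral_lin 2 (I4 z) I0).
rewrite (prob_Rintegral_cst P).
have hp : v (y + z) = v y + v z + 2 * inner (C y) z.
  by rewrite (linD lC) !innerDl !innerDr (saC z) (innerC z); ring.
have hm : v (y - z) = v y + v z - 2 * inner (C y) z.
  by rewrite (linB lC) !innerBl !innerBr (saC z) (innerC z); ring.
by rewrite /X !gauss_pow4 hp hm => h; lra.
Qed.

End marginal.

Section lsum_integral.
Context d (T : measurableType d) (R : realType) (H : sepHilbertType R) (P : probability T R).
Variable F : H -> T -> R.
Hypothesis F2 : forall y, F y \in Lfun P 2%:E.

Lemma lsum_L2 l : (fun x => lsum (fun y => F y x : R^o) l) \in Lfun P 2%:E.
Proof.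
elim: l => [|p l ih].
  by rewrite (_ : (fun x => _) = cst 0) ?L2_cst//; apply/funext => x; rewrite lsum_nil.
rewrite (_ : (fun x => _) = fun x => p.1 * F p.2 x + lsum (fun y => F y x : R^o) l).
  exact: L2_lin.
by apply/funext => x; rewrite lsum_cons.
Qed.

Lemma lsum_mul_integral g l : g \in Lfun P 2%:E ->
  \int[P]_x (lsum (fun y => F y x : R^o) l * g x) =
  lsum (fun y => \int[P]_x (F y x * g x) : R^o) l.
Proof.
move=> g2; elim: l => [|p l ih].
  rewrite lsum_nil; under eq_Rintegral do rewrite lsum_nil mul0r.
  exact: prob_Rintegral_cst.
rewrite lsum_cons -ih -(Rintegral_lin p.1 (L2_mul_integrable (F2 p.2) g2)).
  by apply: eq_Rintegral => x _; rewrite lsum_cons mulrDl mulrA.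
exact: L2_mul_integrable (lsum_L2 l) g2.
Qed.

End lsum_integral.

Section L2_mean.
Context d (T : measurableType d) (R : realType) (P : probability T R).
Implicit Types f g : T -> R.

Lemma L2_integrable f : f \in Lfun P 2%:E -> P.-integrable setT (EFin \o f).
Proof. by move=> f2; apply/Lfun1_integrable; apply: Lfun_subset12 => //; rewrite fin_num_measure. Qed.

Lemma L2_mean_dist f g : f \in Lfun P 2%:E -> g \in Lfun P 2%:E ->
  `|\int[P]_x f x - \int[P]_x g x| <= `|L2_class P f - L2_class P g|.
Proof.
move=> f2 g2; have If := L2_integrable f2; have Ig := L2_integrable g2.
rewrite -L2_class_B// -RintegralB//.
apply: le_trans (le_normr_Rintegral measurableT (integrableRB If Ig)) _.
rewrite -lee_fin; apply: le_trans (L2_abs_le (L2_B f2 g2)).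
rewrite /Rintegral fineK//; apply: integrable_fin_num => //.
exact: integrable_norm (integrableRB If Ig).
Qed.

End L2_mean.

Section covariance.
Context (R : realType) (H : sepHilbertType R) (C0 : H -> H).
Hypothesis PC0 : SymP H C0.
Hypothesis C0_ker : forall x, C0 x = 0 -> x = 0.
Local Notation Q := (sqrt_op C0).

Lemma sqrt_op_SymP : SymP H Q. Proof. by case: (sqrt_opP PC0). Qed.
Let SQ : Sym H Q. Proof. by case: sqrt_op_SymP. Qed.

Lemma sqrt_op_ker x : Q x = 0 -> x = 0.
Proof.
by move=> Qx; apply: C0_ker; case: (sqrt_opP PC0) => _ <-; rewrite Qx; exact: lin0 (Sym_lin SQ).
Qed.

Lemma cov_inner S y z : inner (cov C0 S y) z = inner (Q y) (Q z) - inner (S (Q y)) (Q z).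
Proof. by rewrite [LHS](Sym_sa SQ) -innerBl. Qed.

Lemma cov_lin S : linear (cov C0 S).
Proof.
have lQ := Sym_lin SQ; have lS := Sym_lin (idB_Sym S).
by move=> a x y; rewrite -lQ -lS -lQ.
Qed.

Lemma cov_sa S : self_adjoint (cov C0 S).
Proof. by move=> x y; rewrite [RHS]innerC !cov_inner [inner (S (Q x)) _]SymHS_sa (innerC (Q y)) (innerC (S _)). Qed.

Lemma cov_gt0 S y : SymHS_ltI S -> y != 0 -> 0 < inner (cov C0 S y) y.
Proof.
move=> [_ SS] y0; rewrite cov_inner -innerBl innerC; apply: SS.
by apply: contra_neq y0; exact: sqrt_op_ker.
Qed.

End covariance.

(** * Finite quadratic forms under one Gaussian measure *)

Section quadratic_forms.
Context (R : realType) (H : sepHilbertType R) (C0 : H -> H).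
Hypothesis PC0 : SymP H C0.
Hypothesis C0_ker : forall x, C0 x = 0 -> x = 0.
Local Notation Q := (sqrt_op C0).
Implicit Types (l : seq (R * H)) (A : SymHS H).

(** The centering is the variance of [inner x y] under [N(0, C0)] and not under [P], since the
    function has to be the same for all [S]. *)
Definition gform l (x : borel H) : R :=
  lsum (fun y => inner (x : H) y ^+ 2 - `|Q y| ^+ 2 : R^o) l.

Variables (S : SymHS H) (P : probability (borel H) R).
Hypotheses (SS : SymHS_ltI S) (gP : gaussian (cov C0 S) P).
Local Notation cl := (L2_class P).
Local Notation C := (cov C0 S).
Local Notation B := (sqrt_op (idfun \- S)).
Let v_gt0 y : y != 0 -> 0 < inner (C y) y. Proof. exact: cov_gt0. Qed.

(** Centered under [P]; it exceeds the corresponding term of [gform] by [inner (S (Q y)) (Q y)],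
    which accounts for the mean in [gform_mean]. *)
Let Z y (x : borel H) : R := inner (x : H) y ^+ 2 - inner (C y) y.

Let sqr2 y : (fun x : borel H => inner (x : H) y ^+ 2) \in Lfun P 2%:E.
Proof. exact: (gauss_sqr_L2 gP v_gt0). Qed.

Let Z2 y : Z y \in Lfun P 2%:E.
Proof. by apply: L2_B => //; exact: L2_cst. Qed.

Lemma gform_L2 l : gform l \in Lfun P 2%:E.
Proof.
apply: (lsum_L2 (F := fun y (x : borel H) => inner (x : H) y ^+ 2 - `|Q y| ^+ 2)) => y.
by apply: L2_B => //; exact: L2_cst.
Qed.

Let Z_mean y : \int[P]_x Z y x = 0.
Proof.
rewrite /Z (@RintegralB _ _ _ P setT (fun x : borel H => inner (x : H) y ^+ 2) (fun=> inner (C y) y))//.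
- by rewrite (gauss_sqr gP v_gt0) (prob_Rintegral_cst P) subrr.
- exact: L2_integrable.
- by apply: L2_integrable; exact: L2_cst.
Qed.

Let Z_mul y z : \int[P]_x (Z y x * Z z x) = 2 * inner (C y) z ^+ 2.
Proof.
have -> : \int[P]_x (Z y x * Z z x) = \int[P]_x (- inner (C z) z * Z y x +
    (- inner (C y) y * inner (x : H) z ^+ 2 + inner (x : H) y ^+ 2 * inner (x : H) z ^+ 2)).
  by apply: eq_Rintegral => x _; rewrite /Z; ring.
have I1 := L2_integrable (Z2 y); have I2 := L2_integrable (sqr2 z).
have I3 := L2_mul_integrable (sqr2 y) (sqr2 z).
rewrite (Rintegral_lin _ I1 (integrable_lin _ I2 I3)) (Rintegral_lin _ I2 I3) Z_mean.
rewrite (gauss_sqr gP v_gt0) (gauss_sqr_mul gP v_gt0 (cov_lin PC0 S) (cov_sa PC0 S)); ring.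
Qed.

Let gformE l x : gform l x = lsum (fun y => Z y x : R^o) l - hs_ip S (form_op Q l).
Proof.
rewrite hs_ip_form /gform /lsum -sumrB; apply: eq_bigr => p _.
rewrite -scalerBr; congr (_ *: _); rewrite /Z cov_inner// inner_norm; ring.
Qed.

Let SB : Sym H B. Proof. by case: (sqrt_idBP SS) => [[]]. Qed.

Let covE y z : inner (C y) z = inner (B (Q y)) (B (Q z)).
Proof. by rewrite cov_inner// -innerBl -(sqrt_idBP SS).2 (Sym_sa SB). Qed.

Let hs_conj_form l : hs_conj B (form_op Q l) = form_op (B \o Q) l.
Proof.
elim: l => [|p l ih]; first by rewrite /form_op !lsum_nil (lin0 (hs_conj_lin SB)).
by rewrite /form_op !lsum_cons (hs_conj_lin SB) hs_conj_tens// -/(form_op Q l) ih.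
Qed.

Let lsumZ_mean l : \int[P]_x lsum (fun y => Z y x : R^o) l = 0.
Proof.
have := lsum_mul_integral Z2 l (L2_cst P 1).
have -> : \int[P]_x (lsum (fun y => Z y x : R^o) l * cst 1 x) = \int[P]_x lsum (fun y => Z y x : R^o) l.
  by apply: eq_Rintegral => x _; rewrite mulr1.
move=> ->; rewrite /lsum big1// => p _.
rewrite (_ : \int[P]_x _ = 0) ?scaler0// -[RHS](Z_mean p.2).
by apply: eq_Rintegral => x _; rewrite mulr1.
Qed.

(** Since [C = Q B ^ 2 Q], the covariances [2 * inner (C y) z ^+ 2] are twice the Hilbert-Schmidt
    inner products of the [tens (B (Q y))]. *)
Let lsumZ_sqr l : \int[P]_x (lsum (fun y => Z y x : R^o) l * lsum (fun y => Z y x : R^o) l) =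
  2 * `|hs_conj B (form_op Q l)| ^+ 2.
Proof.
rewrite (lsum_mul_integral Z2)//; last exact: lsum_L2.
rewrite hs_conj_form -hs_ip_norm hs_ip_form /lsum mulr_sumr; apply: eq_bigr => p _.
rewrite -[RHS]scalerAr; congr (_ *: _).
have -> : \int[P]_x (Z p.2 x * lsum (fun y => Z y x : R^o) l) =
  \int[P]_x (lsum (fun y => Z y x : R^o) l * Z p.2 x).
  by apply: eq_Rintegral => x _; rewrite mulrC.
rewrite (lsum_mul_integral Z2)//.
rewrite -hs_ip_tens hs_ipC hs_ip_form /lsum mulr_sumr; apply: eq_bigr => q _.
rewrite -[RHS]scalerAr; congr (_ *: _).
by rewrite Z_mul tensE innerZl covE innerC.
Qed.

Lemma gform_mean l : \int[P]_x gform l x = - hs_ip S (form_op Q l).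
Proof.
have -> : \int[P]_x gform l x = \int[P]_x (lsum (fun y => Z y x : R^o) l - hs_ip S (form_op Q l)).
  by apply: eq_Rintegral => x _; exact: gformE.
rewrite RintegralB//.
- by rewrite lsumZ_mean (prob_Rintegral_cst P) sub0r.
- exact: L2_integrable (lsum_L2 Z2 l).
- by apply: L2_integrable; exact: L2_cst.
Qed.

Lemma gform_norm l : `|cl (gform l)| ^+ 2 =
  2 * `|hs_conj B (form_op Q l)| ^+ 2 + hs_ip S (form_op Q l) ^+ 2.
Proof.
rewrite L2_class_norm ?gform_L2//; set s := hs_ip S _.
pose F (x : borel H) : R := lsum (fun y => Z y x : R^o) l.
have F2 : F \in Lfun P 2%:E by exact: lsum_L2.
have -> : \int[P]_x (gform l x * gform l x) = \int[P]_x (- 2 * s * F x + (1 * (F x * F x) + s ^+ 2)).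
  by apply: eq_Rintegral => x _; rewrite gformE -/(F x) -/s; ring.
have I1 := L2_integrable F2; have I2 := L2_mul_integrable F2 F2.
have I3 := L2_integrable (L2_cst P (s ^+ 2)).
rewrite (Rintegral_lin _ I1 (integrable_lin _ I2 I3)) (Rintegral_lin _ I2 I3).
rewrite [\int[P]_x F x]lsumZ_mean [\int[P]_x (F x * F x)]lsumZ_sqr (prob_Rintegral_cst P); ring.
Qed.

End quadratic_forms.

(** * The field indexed by Hilbert-Schmidt operators *)

Section gaussian_field.
Context (R : realType) (H : sepHilbertType R) (C0 : H -> H).
Hypothesis PC0 : SymP H C0.
Hypothesis C0_ker : forall x, C0 x = 0 -> x = 0.
Local Notation Q := (sqrt_op C0).
Implicit Types (l : seq (R * H)) (A : SymHS H).

(** The geometric rate makes the images under [gform] fast Cauchy in every L2 considered, whatever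
    the Lipschitz constant, which depends on [S]. *)
Definition approx A n : seq (R * H) := xget [::] [set l | `|A - form_op Q l| <= 2^-1 ^+ n].

Lemma approxP A n : `|A - form_op Q (approx A n)| <= 2^-1 ^+ n.
Proof.
have e0 : 0 < (2^-1 : R) ^+ n by rewrite exprn_gt0.
have [l hl] := dense_forms (sqrt_op_SymP PC0) (sqrt_op_ker PC0 C0_ker) A e0.
by apply: (@xgetPex _ [::] [set l | `|A - form_op Q l| <= 2^-1 ^+ n]); exists l; exact: ltW.
Qed.

Lemma approx_cvg A : form_op Q (approx A n) @[n --> \oo] --> A.
Proof.
apply: (@cvg_dom0 _ _ _ _ (fun n => 2^-1 ^+ n)) => [|n]; first exact: half_pow_cvg.
by rewrite distrC; exact: approxP.
Qed.

(* The choice of the approximating lists does not depend on the measure: for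
   every [S] with [I - S > 0] the sequence converges almost surely under
   [N(0, cov C0 S)]. *)
Definition gfield A (x : borel H) : R :=
  fine (limn_esup (fun n => (gform C0 (approx A n) x)%:E)).

Variables (S : SymHS H) (P : probability (borel H) R).
Hypotheses (SS : SymHS_ltI S) (gP : gaussian (cov C0 S) P).
Local Notation cl := (L2_class P).
Local Notation B := (sqrt_op (idfun \- S)).

Let SB : Sym H B. Proof. by case: (sqrt_idBP SS) => [[]]. Qed.

Let g2 l : gform C0 l \in Lfun P 2%:E. Proof. exact: (gform_L2 PC0 C0_ker SS gP). Qed.

Let g_bound : exists2 K, 0 <= K & forall l, `|cl (gform C0 l)| <= K * `|form_op Q l|.
Proof.
have [M /ltW M0 BM] := Sym_opb SB.
exists (2 * M ^+ 2 + `|S|) => [|l]; first by rewrite addr_ge0// mulr_ge0// sqr_ge0.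
rewrite -ler_sqr ?nnegrE ?mulr_ge0 ?addr_ge0 ?mulr_ge0 ?sqr_ge0//.
rewrite (gform_norm PC0 C0_ker SS gP); set a := form_op _ _.
have h1 := hs_conj_norm a SB BM M0; have h2 : hs_ip S a ^+ 2 <= (`|S| * `|a|) ^+ 2.
  rewrite -[leLHS]real_normK ?num_real// ler_sqr ?nnegrE ?mulr_ge0//; exact: hs_ip_le.
have h3 : `|hs_conj B a| ^+ 2 <= (M ^+ 2 * `|a|) ^+ 2.
  by rewrite ler_sqr ?nnegrE ?mulr_ge0 ?sqr_ge0.
have := normr_ge0 S; have := normr_ge0 a; have := sqr_ge0 M; move: h2 h3.
move: (`|hs_conj B a| ^+ 2) (hs_ip S a ^+ 2) (M ^+ 2) `|S| `|a| => u v m s t h2 h3 m0 t0 s0.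
have : 0 <= m * s * t ^+ 2 by rewrite !mulr_ge0// sqr_ge0.
have : 0 <= (m * t) ^+ 2 by rewrite sqr_ge0.
move: h2 h3; rewrite !expr2; nra.
Qed.

Let g_sub l l' : cl (gform C0 l) - cl (gform C0 l') = cl (gform C0 (l ++ scale_list (-1) l')).
Proof.
rewrite -L2_class_B//; congr L2_class; apply/funext => x.
by rewrite /gform lsum_cat lsum_scale scaleN1r.
Qed.

Let f_sub l l' : form_op Q l - form_op Q l' = form_op Q (l ++ scale_list (-1) l').
Proof. by rewrite /form_op lsum_cat lsum_scale scaleN1r. Qed.

Let K_ex : exists K, forall A m n,
  `|cl (gform C0 (approx A m)) - cl (gform C0 (approx A n))| <= K * (2^-1 ^+ m + 2^-1 ^+ n).
Proof.
have [K K0 hK] := g_bound; exists K => A m n; rewrite g_sub.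
apply: le_trans (hK _) _; apply: ler_wpM2l => //; rewrite -f_sub.
apply: le_trans (ler_distD A _ _) _; apply: lerD; last exact: approxP.
by rewrite distrC; exact: approxP.
Qed.

Lemma gfield_L2 A : gfield A \in Lfun P 2%:E.
Proof. by have [K hK] := K_ex; apply: fast_L2 (hK A) => n. Qed.

Lemma gfield_dist_form : exists2 K, 0 <= K &
  forall A l, `|cl (gfield A) - cl (gform C0 l)| <= K * `|A - form_op Q l|.
Proof.
have [K hK] := K_ex; have [K' K'0 hK'] := g_bound; exists K' => // A l.
have h n : `|cl (gfield A) - cl (gform C0 l)| <=
    (2 * K + K') * 2^-1 ^+ n + K' * `|A - form_op Q l|.
  apply: le_trans (ler_distD (cl (gform C0 (approx A n))) _ _) _.
  rewrite mulrDl -addrA; apply: lerD; first by apply: fast_dist (hK A) n => m.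
  rewrite g_sub -mulrDr; apply: le_trans (hK' _) (ler_wpM2l K'0 _).
  rewrite -f_sub; apply: le_trans (ler_distD A _ _) _.
  by rewrite lerD2r distrC approxP.
apply: (cvg_le (cvg_cst _) _ h).
rewrite -[X in _ --> X]add0r -(mulr0 (2 * K + K')).
by apply: cvgD; [apply: cvgMr; exact: half_pow_cvg|exact: cvg_cst].
Qed.

(** Only almost everywhere, as [approx (form_op Q l)] need not return [l]; the Lipschitz bound at
    distance zero identifies the classes. *)
Lemma gfield_form l : gfield (form_op Q l) = gform C0 l %[ae P].
Proof.
apply: L2_class_inj => //; first exact: gfield_L2.
have [K _ hK] := gfield_dist_form; apply/eqP.
have := hK (form_op Q l) l; rewrite (subrr (form_op Q l)) normr0 mulr0 => h.
by rewrite -subr_eq0 -normr_eq0 eq_le h normr_ge0.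
Qed.

Lemma gfield_cvg (l_ : nat -> seq (R * H)) A : form_op Q (l_ n) @[n --> \oo] --> A ->
  cl (gform C0 (l_ n)) @[n --> \oo] --> cl (gfield A).
Proof.
move=> lA; have [K K0 hK] := gfield_dist_form.
apply: (@cvg_dom0 _ _ _ _ (fun n => K * `|form_op Q (l_ n) - A|)) => [|n].
  by rewrite -(mulr0 K); apply: cvgMr; exact: cvg_dist0.
by rewrite distrC [X in K * X]distrC.
Qed.

Lemma gfield_class_lin a A A' :
  cl (gfield (a *: A + A')) = a *: cl (gfield A) + cl (gfield A').
Proof.
pose l_ n := scale_list a (approx A n) ++ approx A' n.
have lA : form_op Q (l_ n) @[n --> \oo] --> a *: A + A'.
  rewrite (_ : (fun n => _) = fun n => a *: form_op Q (approx A n) + form_op Q (approx A' n)).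
    by apply: cvgD; [apply: cvgZl_tmp|]; exact: approx_cvg.
  by apply/funext => n; rewrite /form_op lsum_cat lsum_scale.
apply: cvg_uniq (gfield_cvg lA) _.
rewrite (_ : (fun n => _) = fun n => a *: cl (gform C0 (approx A n)) + cl (gform C0 (approx A' n))).
  by apply: cvgD; [apply: cvgZl_tmp|]; apply: gfield_cvg; exact: approx_cvg.
apply/funext => n; rewrite -L2_class_lin//; congr L2_class; apply/funext => x.
by rewrite /gform lsum_cat lsum_scale.
Qed.

Lemma gfield_classB A A' : cl (gfield (A - A')) = cl (gfield A) - cl (gfield A').
Proof.
have -> : A - A' = -1 *: A' + A by rewrite scaleN1r (addrC A).
apply: (etrans (gfield_class_lin (-1) A' A)).
by rewrite scaleN1r; exact: addrC.
Qed.

Lemma gfield_mean A : \int[P]_x gfield A x = - hs_ip S A.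
Proof.
have h : \int[P]_x gform C0 (approx A n) x @[n --> \oo] --> \int[P]_x gfield A x.
  apply: (@cvg_dom0 _ _ _ _ (fun n => `|cl (gform C0 (approx A n)) - cl (gfield A)|)) => [|n].
    by apply: cvg_dist0; apply: gfield_cvg; exact: approx_cvg.
  by apply: L2_mean_dist => //; exact: gfield_L2.
apply: cvg_uniq h _.
rewrite (_ : (fun n => _) = fun n => - hs_ip S (form_op Q (approx A n))).
  by apply: cvgN; apply: cvg_hs_ip; [exact: cvg_cst|exact: approx_cvg].
by apply/funext => n; rewrite (gform_mean PC0 C0_ker SS gP).
Qed.

Lemma gfield_norm A :
  `|cl (gfield A)| ^+ 2 = 2 * `|hs_conj B A| ^+ 2 + hs_ip S A ^+ 2.
Proof.
have h : `|cl (gform C0 (approx A n))| ^+ 2 @[n --> \oo] --> `|cl (gfield A)| ^+ 2.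
  by apply: cvg_norm_sqr; apply: gfield_cvg; exact: approx_cvg.
apply: cvg_uniq h _.
rewrite (_ : (fun n => _) = fun n => 2 * `|hs_conj B (form_op Q (approx A n))| ^+ 2 +
    hs_ip S (form_op Q (approx A n)) ^+ 2); last first.
  by apply/funext => n; rewrite (gform_norm PC0 C0_ker SS gP).
apply: cvgD.
  have h2 : hs_conj B (form_op Q (approx A n)) @[n --> \oo] --> hs_conj B A.
    apply: (@cvg_comp _ _ _ (fun n => form_op Q (approx A n)) (hs_conj B) _ (nbhs A)).
      exact: approx_cvg.
    exact: hs_conj_continuous.
  exact: cvgMr (cvg_norm_sqr h2).
have hh : hs_ip S (form_op Q (approx A n)) @[n --> \oo] --> hs_ip S A.
  by apply: cvg_hs_ip; [exact: cvg_cst|exact: approx_cvg].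
by apply: cvgM.
Qed.

Lemma gfield_dist : exists2 K, 0 <= K & forall A, `|cl (gfield A)| <= K * `|A|.
Proof.
have [K K0 hK] := gfield_dist_form; exists K => // A.
have := hK A [::]; rewrite /form_op lsum_nil subr0.
have -> : gform C0 [::] = cst 0 by apply/funext => x; rewrite /gform lsum_nil.
by rewrite L2_class0 subr0.
Qed.

End gaussian_field.

(** * Measures with an exponential density *)

Section tilt.
Context d (T : measurableType d) (R : realType).
Implicit Types (P : probability T R) (f g : T -> R).

(** Writing the density as an exponential makes it positive, so the relation is symmetric and the
    measures are equivalent. *)
Definition tilt P P' f : Prop := measurable_fun setT f /\
  forall A, measurable A -> P' A = (\int[P]_(x in A) (expR (f x))%:E)%E.

Let mexp f : measurable_fun setT f -> measurable_fun setT (fun x => expR (f x)).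
Proof. by move=> mf; apply: measurableT_comp mf. Qed.

Lemma tilt_ge0_integral P P' f (g : T -> \bar R) : tilt P P' f -> measurable_fun setT g ->
  (forall x, 0 <= g x)%E -> (\int[P']_x g x = \int[P]_x (g x * (expR (f x))%:E))%E.
Proof.
move=> [mf h]; apply: (ge0_density_integral (mexp mf) h).
Qed.

Lemma tilt_integrable P P' f g : tilt P P' f -> measurable_fun setT g ->
  P'.-integrable setT (EFin \o g) <-> P.-integrable setT (EFin \o (fun x => g x * expR (f x))).
Proof. by move=> [mf h] mg; apply: (density_integrable (mexp mf) _ h mg) => x; exact: expR_ge0. Qed.

Lemma tilt_Rintegral P P' f g : tilt P P' f -> measurable_fun setT g ->
  \int[P']_x g x = \int[P]_x (g x * expR (f x)).
Proof. by move=> [mf h] mg; apply: (density_Rintegral (mexp mf) _ h mg) => x; exact: expR_ge0. Qed.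

Lemma tilt_dominates P P' f : tilt P P' f -> P' `<< P.
Proof. by move=> [mf h]; apply: (density_dominates (mexp mf) h). Qed.

Lemma tilt_ae P P' f g : tilt P P' f -> measurable_fun setT g -> f = g %[ae P] -> tilt P P' g.
Proof.
move=> [mf h] mg fg; split=> // A mA; rewrite h//; apply: ae_eq_integral => //.
- by apply/measurable_EFinP; apply: measurable_funTS; exact: mexp.
- by apply/measurable_EFinP; apply: measurable_funTS; exact: mexp.
by apply: filterS fg => x /(_ I) -> _.
Qed.

Lemma tilt_trans P P' P'' f g : tilt P P' f -> tilt P' P'' g -> tilt P P'' (fun x => f x + g x).
Proof.
move=> fP [mg gP]; have [mf _] := fP; split; first exact: measurable_funD.
move=> A mA; rewrite gP// integral_mkcond epatch_indic.
rewrite (tilt_ge0_integral fP)/=; last 2 first.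
- apply: emeasurable_funM; first by apply/measurable_EFinP; exact: mexp.
  by apply/measurable_EFinP; exact: measurable_indic.
- by move=> x; rewrite mule_ge0// lee_fin ?expR_ge0// indicE.
rewrite [RHS]integral_mkcond epatch_indic; apply: eq_integral => x _ /=.
by rewrite -!EFinM expRD; congr EFin; ring.
Qed.

Lemma tilt_sym P P' f : tilt P P' f -> tilt P' P (fun x => - f x).
Proof.
move=> fP; have [mf _] := fP; have mNf := measurable_funN mf.
split=> // A mA; rewrite integral_mkcond epatch_indic.
rewrite (tilt_ge0_integral fP)/=; last 2 first.
- apply: emeasurable_funM; first by apply/measurable_EFinP; exact: mexp.
  by apply/measurable_EFinP; exact: measurable_indic.
- by move=> x; rewrite mule_ge0// lee_fin ?expR_ge0// indicE.
rewrite -[A in LHS]setIT -integral_indic//; apply: eq_integral => x _ /=.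
by rewrite -!EFinM mulrAC -expRD addNr expR0 mul1r.
Qed.

Lemma tilt_dominatesr P P' f : tilt P P' f -> P `<< P'.
Proof. by move/tilt_sym/tilt_dominates. Qed.

Lemma tilt_exp_integrable P P' f : tilt P P' f -> P.-integrable setT (EFin \o (fun x => expR (f x))).
Proof.
by move=> [mf h]; apply: (density_integrable_pdf (mexp mf) _ h) => x; exact: expR_ge0.
Qed.

Lemma tilt_exp_integral P P' f : tilt P P' f -> \int[P]_x expR (f x) = 1.
Proof.
move=> fP; have := tilt_Rintegral fP (@measurable_cst _ _ T R setT 1).
move=> h; apply: etrans (etrans (esym h) (prob_Rintegral_cst P' 1)).
by apply: eq_Rintegral => x _; rewrite mul1r.
Qed.

(** Jensen's inequality in the form [f <= exp f - 1], whose right side has mean zero. *)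
Lemma tilt_mean_le0 P P' f : tilt P P' f -> P.-integrable setT (EFin \o f) ->
  \int[P]_x f x <= 0.
Proof.
move=> fP If; have Ie := tilt_exp_integrable fP.
have I1 : P.-integrable setT (EFin \o cst (-1)) by apply: L2_integrable; exact: L2_cst.
have h : \int[P]_x (expR (f x) + cst (-1) x) = 0.
  by rewrite RintegralD// (tilt_exp_integral fP) (prob_Rintegral_cst P) subrr.
rewrite -h; apply: le_Rintegral => //; first exact: integrableRD.
by move=> x _ /=; have := expR_ge1Dx (f x); lra.
Qed.

(** If [a] and [b] differ by at most [eta], the first term suffices; otherwise their distance
    divided by [eta] exceeds 1, and multiplying by it gives the second. *)
Let tv_pointwise (a b eta : R) : 0 < eta ->
  `|expR a - expR b| <= eta * (expR a + expR b) + eta^-1 * ((expR a - expR b) * (a - b)).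
Proof.
move=> eta0; wlog ab : a b / b <= a => [hw|].
  have [/hw//|/ltW /hw] := leP b a.
  by rewrite distrC (addrC (expR b)) -[(expR b - _) * _]mulrNN !opprB.
have p0 := expR_gt0 a; have q0 := expR_gt0 b.
have pq : expR b <= expR a by rewrite ler_expR.
rewrite ger0_norm ?subr_ge0//.
have i0 : 0 < eta^-1 by rewrite invr_gt0.
have [le|gt] := leP (a - b) eta.
  have h : expR a - expR b <= eta * expR a.
    have -> : expR b = expR a * expR (- (a - b)) by rewrite -expRD; congr expR; ring.
    have := expR_ge1Dx (- (a - b)); move: (expR (- (a - b))) => t ht; nra.
  apply: (le_trans h); rewrite mulrDr -addrA lerDl addr_ge0//.
    by rewrite mulr_ge0 ?ltW.
  by rewrite mulr_ge0 ?mulr_ge0 ?subr_ge0// ltW.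
apply: (@le_trans _ _ (eta^-1 * ((expR a - expR b) * (a - b)))); last first.
  by rewrite lerDr mulr_ge0 ?addr_ge0// ltW.
rewrite mulrCA ler_peMr ?subr_ge0// mulrC ler_pdivlMr// mul1r ltW//.
Qed.

(* As [f1] and [f2] are log-densities, the last factor is the symmetrized relative
   entropy of [P1] and [P2]. *)
Lemma tilt_tv P P1 P2 f1 f2 eta : 0 < eta -> tilt P P1 f1 -> tilt P P2 f2 ->
  P1.-integrable setT (EFin \o (fun x => f1 x - f2 x)) ->
  P2.-integrable setT (EFin \o (fun x => f1 x - f2 x)) ->
  \int[P]_x `|expR (f1 x) - expR (f2 x)| <= 2 * eta +
    eta^-1 * (\int[P1]_x (f1 x - f2 x) - \int[P2]_x (f1 x - f2 x)).
Proof.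
move=> eta0 t1 t2 I1 I2; have [mf1 _] := t1; have [mf2 _] := t2.
have mB := measurable_funB mf1 mf2.
have e1 := tilt_exp_integrable t1; have e2 := tilt_exp_integrable t2.
have J1 : P.-integrable setT (EFin \o (fun x => (f1 x - f2 x) * expR (f1 x))).
  exact: (tilt_integrable t1 mB).1.
have J2 : P.-integrable setT (EFin \o (fun x => (f1 x - f2 x) * expR (f2 x))).
  exact: (tilt_integrable t2 mB).1.
rewrite (tilt_Rintegral t1 mB) (tilt_Rintegral t2 mB).
have K1 := integrableRD e1 e2; have K2 := integrableRB J1 J2.
have -> : 2 * eta = eta * \int[P]_x (expR (f1 x) + expR (f2 x)).
  by rewrite RintegralD// (tilt_exp_integral t1) (tilt_exp_integral t2); ring.
rewrite -RintegralB//.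
have <- : \int[P]_x (eta^-1 * ((f1 x - f2 x) * expR (f1 x) - (f1 x - f2 x) * expR (f2 x))) =
    eta^-1 * \int[P]_x ((f1 x - f2 x) * expR (f1 x) - (f1 x - f2 x) * expR (f2 x)).
  by rewrite (@RintegralZl _ _ _ P setT _ eta^-1 _ K2).
rewrite -(Rintegral_lin eta K1 (integrableRZ eta^-1 K2)).
apply: le_Rintegral => //.
- exact: integrable_norm (integrableRB e1 e2).
- exact: integrable_lin K1 (integrableRZ eta^-1 K2).
move=> x _; apply: le_trans (tv_pointwise _ _ eta0) _.
by rewrite -mulrBr (mulrC (f1 x - f2 x)).
Qed.

End tilt.

Section density_measure.
Context d (T : measurableType d) (R : realType) (mu : {measure set T -> \bar R}) (p : T -> R).

(* The proofs are phantom arguments that make the measure structure inferable. *)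
Definition density_measure (p0 : forall x, 0 <= p x) (Ip : mu.-integrable setT (EFin \o p)) :
  set T -> \bar R := fun A => (\int[mu]_(x in A) (p x)%:E)%E.

Variables (p0 : forall x, 0 <= p x) (Ip : mu.-integrable setT (EFin \o p)).
Local Notation nu := (density_measure p0 Ip).

Let nu0 : nu set0 = 0%E. Proof. exact: integral_set0. Qed.

Let nu_ge0 A : (0 <= nu A)%E. Proof. by apply: integral_ge0 => x _; rewrite lee_fin. Qed.

Let nu_sigma_additive : semi_sigma_additive nu.
Proof.
move=> A mA tA mUA; have mp := measurable_int _ Ip.
rewrite /density_measure ge0_integral_bigcup//; last 2 first.
- exact: measurable_funTS.
- by move=> x _; rewrite lee_fin.
apply: is_cvg_ereal_nneg_natsum_cond => n _ _.
by apply: integral_ge0 => x _; rewrite lee_fin.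
Qed.

HB.instance Definition _ := isMeasure.Build _ _ _ nu nu0 nu_ge0 nu_sigma_additive.

Let nu_finite : fin_num_fun nu.
Proof.
apply: lty_fin_num_fun => /=; rewrite /density_measure.
case/integrableP: Ip => _; apply: le_lt_trans; rewrite le_eqVlt; apply/orP; left; apply/eqP.
by apply: eq_integral => x _ /=; rewrite ger0_norm.
Qed.

HB.instance Definition _ := Measure_isFinite.Build _ _ _ nu nu_finite.

Lemma density_measureE A : nu A = (\int[mu]_(x in A) (p x)%:E)%E. Proof. by []. Qed.

End density_measure.

Section tilt_char.
Context (R : realType) (H : sepHilbertType R).
Implicit Types (P : probability (borel H) R) (f : borel H -> R).

Lemma tilt_char P P' f : measurable_fun setT f ->
  P.-integrable setT (EFin \o (fun x => expR (f x))) ->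
  (forall y, \int[P']_x cos (inner (x : H) y) = \int[P]_x (cos (inner (x : H) y) * expR (f x))) ->
  (forall y, \int[P']_x sin (inner (x : H) y) = \int[P]_x (sin (inner (x : H) y) * expR (f x))) ->
  tilt P P' f.
Proof.
move=> mf If cE sE; split=> // A mA.
have p0 x : 0 <= expR (f x) by exact: expR_ge0.
have mp : measurable_fun setT (fun x => expR (f x)) by exact: measurableT_comp mf.
have nuE := density_measureE p0 If.
rewrite -nuE; apply: cramer_wold => // y.
- rewrite cE (density_Rintegral mp p0 (fun A _ => nuE A))//.
  apply: measurableT_comp (measurable_inner y).
  by apply: continuous_measurable_fun => x; exact: continuous_cos.
- rewrite sE (density_Rintegral mp p0 (fun A _ => nuE A))//.
  apply: measurableT_comp (measurable_inner y).
  by apply: continuous_measurable_fun => x; exact: continuous_sin.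
Qed.

End tilt_char.

(** * Limits of exponential densities *)

Section tilt_limit.
Context d (T : measurableType d) (R : realType) (P : probability T R).
Variables (P_ : nat -> probability T R) (f_ : nat -> T -> R) (f : T -> R).
Hypotheses (t_ : forall n, tilt P (P_ n) (f_ n)) (mf : measurable_fun setT f).
Hypothesis f_f : {ae P, forall x, f_ n x @[n --> \oo] --> f x}.
Hypothesis tv : forall e, 0 < e -> exists N, forall n m, (N <= n)%N -> (N <= m)%N ->
  \int[P]_x `|expR (f_ n x) - expR (f_ m x)| <= e.

Let mexp (g : T -> R) : measurable_fun setT g -> measurable_fun setT (fun x : T => expR (g x)).
Proof. by move=> mg; apply: measurableT_comp mg. Qed.

Let mf_ n : measurable_fun setT (f_ n). Proof. by case: (t_ n). Qed.

Let If_ n : P.-integrable setT (EFin \o (fun x => expR (f_ n x))).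
Proof. exact: tilt_exp_integrable (t_ n). Qed.

(** Fatou's lemma in the second index turns the Cauchy estimate into an L1 distance to the limit
    density. *)
Let tv_lim e : 0 < e -> exists N, forall n, (N <= n)%N ->
  (\int[P]_x `|expR (f_ n x) - expR (f x)|%:E <= e%:E)%E.
Proof.
move=> /tv[N hN]; exists N => n Nn.
have mB (a b : T -> R) : measurable_fun setT a -> measurable_fun setT b ->
    measurable_fun setT (fun x => `|expR (a x) - expR (b x)|).
  by move=> ma mb; apply: measurableT_comp => //; apply: measurable_funB; exact: mexp.
apply: (@fatou_le _ _ _ _ (fun m x => `|expR (f_ n x) - expR (f_ m x)|)) => //.
- by move=> m; exact: mB.
- exact: mB.
- apply: filterS f_f => x fx; apply: cvg_norm; apply: cvgB; first exact: cvg_cst.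
  by apply: (cvg_comp _ _ fx); exact: continuous_expR.
near=> m.
have -> : (\int[P]_x `|expR (f_ n x) - expR (f_ m x)|%:E =
    (\int[P]_x `|expR (f_ n x) - expR (f_ m x)|)%:E)%E.
  rewrite /Rintegral fineK//; apply: integrable_fin_num => //.
  exact: integrable_norm (integrableRB (If_ n) (If_ m)).
by rewrite lee_fin hN//; near: m; exact: nbhs_infty_ge.
Unshelve. all: by end_near. Qed.

Let I_diff : exists n, P.-integrable setT (EFin \o (fun x => expR (f_ n x) - expR (f x))).
Proof.
have [N hN] := tv_lim ltr01; exists N; apply/integrableP; split.
  by apply/measurable_EFinP; apply: measurable_funB; exact: mexp.
exact: le_lt_trans (hN N (leqnn N)) (ltry 1).
Qed.

Lemma tilt_limit_integrable : P.-integrable setT (EFin \o (fun x => expR (f x))).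
Proof.
have [n In] := I_diff.
apply: eq_integrable (integrableRB (If_ n) In) => // x _ /=; congr EFin; ring.
Qed.

Lemma tilt_limit_integral (g : T -> R) M : measurable_fun setT g -> (forall x, `|g x| <= M) ->
  \int[P_ n]_x g x @[n --> \oo] --> \int[P]_x (g x * expR (f x)).
Proof.
move=> mg gM; have If := tilt_limit_integrable.
have M0 : 0 <= M by apply: le_trans (gM point).
have Ig h : measurable_fun setT h -> P.-integrable setT (EFin \o h) ->
    P.-integrable setT (EFin \o (fun x => g x * h x)).
  move=> mh Ih; apply: le_integrable (integrable_norm (integrableRZ M Ih)) => //.
    by apply/measurable_EFinP; exact: measurable_funM.
  move=> x _ /=; rewrite lee_fin normr_id !normrM ler_wpM2r//.
  by rewrite (le_trans (gM x))// ler_norm.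
apply/cvgrPdist_le => e e0; have e1 : 0 < e / (M + 1) by rewrite divr_gt0// ltr_wpDl.
have [N hN] := tv_lim e1; near=> n.
have nN : (N <= n)%N by near: n; exact: nbhs_infty_ge.
rewrite (tilt_Rintegral (t_ n) mg) distrC -RintegralB//; last 2 first.
- exact: Ig (mexp (mf_ n)) (If_ n).
- exact: Ig (mexp mf) If.
have ID := integrableRB (If_ n) If.
have IN : P.-integrable setT (EFin \o (fun x => `|expR (f_ n x) - expR (f x)|)).
  exact: integrable_norm ID.
have IgD := integrableRB (Ig _ (mexp (mf_ n)) (If_ n)) (Ig _ (mexp mf) If).
apply: le_trans (le_normr_Rintegral measurableT IgD) _.
apply: (@le_trans _ _ (\int[P]_x (M * `|expR (f_ n x) - expR (f x)|))).
  apply: le_Rintegral => //.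
  - exact: integrable_norm IgD.
  - exact: integrableRZ.
  by move=> x _; rewrite -mulrBr normrM ler_wpM2r.
rewrite (@RintegralZl _ _ _ P setT _ M _ IN)//.
apply: (@le_trans _ _ (M * (e / (M + 1)))).
  apply: ler_wpM2l => //; rewrite -lee_fin; apply: le_trans (hN n nN).
  by rewrite /Rintegral fineK//; apply: integrable_fin_num => //; exact: IN.
rewrite mulrCA ler_piMr ?(ltW e0)//.
by rewrite ler_pdivrMr ?ltr_wpDl// mul1r lerDl.
Unshelve. all: by end_near. Qed.

End tilt_limit.

(** * Densities between Gaussian measures *)

Section bounded_fubini.
Context d d' (T : measurableType d) (Y : measurableType d') (R : realType).
Variables (P : probability T R) (N : probability Y R).

Lemma bounded_Fubini (f : T * Y -> R) M : measurable_fun setT f -> (forall z, `|f z| <= M) ->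
  \int[P]_x \int[N]_y f (x, y) = \int[N]_y \int[P]_x f (x, y).
Proof.
move=> mf fM.
have mf1 x : measurable_fun setT (fun y => f (x, y)).
  by apply: measurableT_comp mf _; exact: measurable_pair1.
have mf2 y : measurable_fun setT (fun x => f (x, y)).
  by apply: measurableT_comp mf _; exact: measurable_pair2.
have If : (P \x N)%E.-integrable setT (EFin \o f).
  apply/integrable12ltyP; first exact/measurable_EFinP.
  have mE : measurable_fun setT (fun z => `|(EFin \o f) z|%E).
    by apply: measurableT_comp => //; exact/measurable_EFinP.
  apply: (@le_lt_trans _ _ (\int[P]_x \int[N]_y M%:E)%E); last first.
    have PM (m : probability T R) : (\int[m]_x M%:E = M%:E)%E.
      by rewrite integral_cst// [X in (_ * X)%E](_ : _ = 1%E) ?mule1//; exact: probability_setT.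
    rewrite (eq_integral (cst M%:E)) => [|x _]; first by rewrite PM ltry.
    by rewrite integral_cst// [X in (_ * X)%E](_ : _ = 1%E) ?mule1//; exact: probability_setT.
  apply: ge0_le_integral => //.
  - by move=> x _; apply: integral_ge0 => y _; exact: abse_ge0.
  - by apply: (measurable_fun_fubini_tonelli_F (fun z => `|(EFin \o f) z|%E)).
  - move=> x _; apply: ge0_le_integral => //.
    + by apply: measurableT_comp => //; exact/measurable_EFinP.
    + by move=> y _; rewrite lee_fin.
have := Fubini If; rewrite /Rintegral => h; congr fine.
transitivity (\int[P]_x \int[N]_y (f (x, y))%:E)%E.
  apply: eq_integral => x _; rewrite fineK//; apply: integrable_fin_num => //.
  exact: (@bounded_integrable _ _ _ N (fun y => f (x, y)) M).
rewrite [LHS]h; apply: eq_integral => y _; rewrite fineK//; apply: integrable_fin_num => //.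
exact: (@bounded_integrable _ _ _ P (fun x => f (x, y)) M).
Qed.

End bounded_fubini.

(** * Rank-one change of the resolvent *)

Section rank_one.
Context (R : realType) (H : sepHilbertType R) (C0 : H -> H).
Hypothesis PC0 : SymP H C0.
Hypothesis C0_ker : forall x, C0 x = 0 -> x = 0.
Local Notation Q := (sqrt_op C0).
Variables (S S' : SymHS H) (P P' : probability (borel H) R).
Hypotheses (SS : SymHS_ltI S) (gP : gaussian (cov C0 S) P).
Hypotheses (SS' : SymHS_ltI S') (gP' : gaussian (cov C0 S') P').
Variables (y : H) (dl : R).
Hypotheses (dl0 : 0 < dl) (hR : rho S' = rho S + dl *: tens (Q y)).
Local Notation C := (cov C0 S).
Local Notation v u := (inner (C u) u).
Let v_gt0 u : u != 0 -> 0 < v u. Proof. exact: cov_gt0. Qed.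
Let v'_gt0 u : u != 0 -> 0 < inner (cov C0 S' u) u. Proof. exact: cov_gt0. Qed.
Let a := v y.
Let a0 : 0 <= a.
Proof. by rewrite /a; have [y0|/v_gt0/ltW//] := eqVneq y 0; rewrite y0 inner0r. Qed.
Let da0 : 0 < 1 + a * dl.
Proof. by rewrite ltr_wpDr// mulr_ge0// ltW. Qed.

(* Sherman-Morrison *)
Let cov_rank1 u : inner (cov C0 S' u) u = v u - dl / (1 + a * dl) * inner (C u) y ^+ 2.
Proof.
pose w := Q y; pose b := w - S w; pose d' := dl / (1 + a * dl).
have bE x : inner b x = inner w (x - S x).
  by rewrite /b innerBl innerBr SymHS_sa.
have aE : a = inner b w by rewrite /a cov_inner// -innerBl.
have S'E x : x - S' x = (x - S x) - (d' * inner b x) *: b.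
  pose z := (x - S x) - (d' * inner b x) *: b.
  have lR := Sym_lin (res_Sym SS).
  (* Checked on the side of the resolvents, where [hR] is explicit, and carried back by [resK]. *)
  have rz : res S' z = x.
    rewrite (resE _ SS') hR SymHSD addrA -(resE _ SS) SymHSZ tensE /z.
    rewrite (linB lR) (linZ lR) !resKl// -/w innerBr innerZr.
    rewrite -bE (innerC w) -aE scalerA -addrA -scaleNr -scalerDl.
    rewrite [X in X *: w](_ : _ = 0) ?scale0r ?addr0//.
    rewrite /d'; field; by rewrite gt_eqF.
  by rewrite -[in LHS]rz resK.
rewrite !cov_inner// -!innerBl S'E [LHS]innerBl innerZl; congr (_ - _).
by rewrite (innerC _ (Q y)) -/w -bE expr2 mulrA.
Qed.

Let Nd := normal_prob (R := R) 0 (Num.sqrt dl).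

Let v_lin u s : v (u + s *: y) = v u + 2 * s * inner (C u) y + s ^+ 2 * a.
Proof.
have lC := cov_lin PC0 S; rewrite (linD lC) (linZ lC) !(innerDl, innerDr, innerZl, innerZr).
by rewrite -/a [inner (C y) u](cov_sa PC0) (innerC y); ring.
Qed.

Let K := (Num.sqrt (1 + a * dl))^-1.

Let mX (u : H) (F : R -> R) : continuous F ->
  measurable_fun setT (fun x : borel H => F (inner (x : H) u)).
Proof.
by move=> cF; apply: measurableT_comp (measurable_inner u); exact: continuous_measurable_fun.
Qed.

Let quad_integrable r : Nd.-integrable setT (EFin \o (fun s => expR (r * s - a * s ^+ 2 / 2))).
Proof.
have cq : continuous (fun s : R => expR (r * s - a * s ^+ 2 / 2)).
  move=> s; apply: (@cvg_comp _ _ _ (fun s : R => r * s - a * s ^+ 2 / 2) expR _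
    (nbhs (r * s - a * s ^+ 2 / 2))); last exact: continuous_expR.
  apply: cvgB; first by apply: cvgMr; exact: cvg_id.
  by apply: cvgMl; apply: cvgMr; exact: (@exprn_continuous R 2 s).
have mq : measurable_fun setT (fun s : R => expR (r * s - a * s ^+ 2 / 2)).
  exact: continuous_measurable_fun.
apply/integrableP; split; first by apply/measurable_EFinP; exact: mq.
rewrite [X in (X < _)%E](_ : _ = (K * expR (r ^+ 2 * dl / (2 * (1 + a * dl))))%:E) ?ltry//.
apply: etrans (normal_expR_quadratic dl0 r a0).
by apply: eq_integral => s _ /=; rewrite ger0_norm ?expR_ge0.
Qed.

Let quad r : \int[Nd]_s expR (r * s - a * s ^+ 2 / 2) =
  K * expR (r ^+ 2 * dl / (2 * (1 + a * dl))).
Proof. by rewrite /Rintegral /Nd (normal_expR_quadratic dl0 r a0). Qed.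

(* [expR (- dl * t ^+ 2 / 2)] is the integral of [cos (s * t)] over [s] of law
   [N(0, dl)]. *)
Let trig_gauss (F : R -> R) (g : R -> R) : continuous F -> (forall r, `|F r| <= 1) ->
  (forall p q, F p * cos q = 2^-1 * (F (p + q) + F (p - q))) ->
  (forall u, \int[P]_x F (inner (x : H) u) = g (v u)) ->
  forall u, \int[P]_x (F (inner (x : H) u) * expR (- dl * inner (x : H) y ^+ 2 / 2)) =
    \int[Nd]_s (2^-1 * (g (v (u + s *: y)) + g (v (u - s *: y)))).
Proof.
move=> cF F1 Fcos Fg u.
have IF z : P.-integrable setT (EFin \o (fun x : borel H => F (inner (x : H) z))).
  by apply: (@bounded_integrable _ _ _ _ _ 1) => //; exact: mX.
transitivity (\int[P]_x \int[Nd]_s (F (inner (x : H) u) * cos (inner (x : H) y * s))).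
  apply: eq_Rintegral => x _.
  rewrite (@RintegralZl _ _ _ Nd setT _ (F (inner (x : H) u)) _ (normal_cos_integrable dl0 _))//.
  by rewrite (normal_cos dl0).
rewrite (@bounded_Fubini _ _ _ _ _ P Nd (fun z => F (inner (z.1 : H) u) * cos (inner (z.1 : H) y * z.2)) 1).
- apply: eq_Rintegral => s _; rewrite -!Fg.
  rewrite -RintegralD// -(@RintegralZl _ _ _ P setT _ 2^-1 _ (integrableRD (IF _) (IF _)))//.
  by apply: eq_Rintegral => x _; rewrite Fcos innerDr innerBr innerZr (mulrC s).
- apply: measurable_funM.
    by apply: (measurableT_comp (mX u cF)); exact: measurable_fst.
  apply: measurableT_comp; first by apply: continuous_measurable_fun => x; exact: continuous_cos.
  apply: measurable_funM; last exact: measurable_snd.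
  by apply: (measurableT_comp (measurable_inner y)); exact: measurable_fst.
- by move=> z; rewrite normrM -[1]mulr1; apply: ler_pM => //; rewrite ler_norml cos_geN1 cos_le1.
Qed.

(** As [v (u + s *: y)] is quadratic in [s], the average over [s] is the integral of a quadratic
    exponential; its exponent is the variance found in [cov_rank1]. *)
Let cosE u : \int[P]_x (cos (inner (x : H) u) * expR (- dl * inner (x : H) y ^+ 2 / 2)) =
  K * expR (- inner (cov C0 S' u) u / 2).
Proof.
rewrite (trig_gauss (g := fun t => expR (- t / 2))).
- pose c := inner (C u) y.
  transitivity (\int[Nd]_s (2^-1 * expR (- v u / 2) *
    (expR (- c * s - a * s ^+ 2 / 2) + expR (c * s - a * s ^+ 2 / 2)))).
    apply: eq_Rintegral => s _; rewrite -scaleNr !v_lin -[RHS]mulrA [in RHS]mulrDr -!expRD.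
    by congr (_ * (expR _ + expR _)); rewrite -/c; field.
  rewrite (@RintegralZl _ _ _ Nd setT _ _ _ (integrableRD (quad_integrable _) (quad_integrable _)))//.
  rewrite RintegralD// !quad sqrrN cov_rank1 -/c.
  have -> : K * expR (- (v u - dl / (1 + a * dl) * c ^+ 2) / 2) =
    expR (- v u / 2) * (K * expR (c ^+ 2 * dl / (2 * (1 + a * dl)))).
    rewrite [RHS]mulrCA -expRD; congr (_ * expR _); field.
    by rewrite gt_eqF.
  by rewrite -mulr2n -mulr_natl; field.
- exact: continuous_cos.
- by move=> r; rewrite ler_norml cos_geN1 cos_le1.
- by move=> p q; rewrite cosD cosB; field.
- by move=> z; exact: (gauss_cos gP v_gt0).
Qed.

Let sinE u : \int[P]_x (sin (inner (x : H) u) * expR (- dl * inner (x : H) y ^+ 2 / 2)) = 0.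
Proof.
rewrite (trig_gauss (g := fun=> 0)).
- rewrite -[RHS](prob_Rintegral_cst Nd); apply: eq_Rintegral => s _; by rewrite addr0 mulr0.
- exact: continuous_sin.
- by move=> r; rewrite ler_norml sin_geN1 sin_le1.
- by move=> p q; rewrite sinD sinB; field.
- by move=> z; exact: (gauss_sin gP v_gt0).
Qed.

(** Agreement of the trigonometric integrals suffices. The weight is bounded because [dl] is
    positive, and [ln K^-1] normalizes it. *)
Let quad_tilt : tilt P P' (fun x => ln K^-1 - dl * inner (x : H) y ^+ 2 / 2).
Proof.
have K0 : 0 < K by rewrite invr_gt0 sqrtr_gt0.
have Ki : K^-1 \is Num.pos by rewrite posrE invr_gt0.
have eE (x : borel H) : expR (ln K^-1 - dl * inner (x : H) y ^+ 2 / 2) =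
    K^-1 * expR (- dl * inner (x : H) y ^+ 2 / 2).
  by rewrite expRD (lnK Ki) !mulNr.
have mq : measurable_fun setT (fun x : borel H => - dl * inner (x : H) y ^+ 2 / 2).
  apply: measurable_funM => //; apply: measurable_funM => //.
  by apply: measurable_funX; exact: measurable_inner.
have eb (F : borel H -> R) : measurable_fun setT F -> (forall x, `|F x| <= 1) ->
    P.-integrable setT (EFin \o (fun x : borel H => F x * expR (- dl * inner (x : H) y ^+ 2 / 2))).
  move=> mF F1; apply: (@bounded_integrable _ _ _ _ _ 1).
    by apply: measurable_funM => //; exact: measurableT_comp mq.
  move=> x; rewrite normrM -[leRHS]mulr1; apply: ler_pM => //.
  rewrite ger0_norm ?expR_ge0// -expR0 ler_expR !mulNr oppr_le0.
  by rewrite mulr_ge0// mulr_ge0 ?sqr_ge0// ltW.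
have fin F : \int[P]_x (F x * expR (ln K^-1 - dl * inner (x : H) y ^+ 2 / 2)) =
   \int[P]_x (K^-1 * (F x * expR (- dl * inner (x : H) y ^+ 2 / 2))).
  by apply: eq_Rintegral => x _; rewrite eE mulrCA.
apply: tilt_char.
- apply: measurable_funB => //; apply: measurable_funM => //; apply: measurable_funM => //.
  by apply: measurable_funX; exact: measurable_inner.
- apply: eq_integrable (integrableRZ K^-1 (eb (cst 1) _ _)) => //.
    by move=> x _ /=; rewrite eE mul1r.
  by move=> x; rewrite normr1.
- move=> u; rewrite fin (@RintegralZl _ _ _ P setT _ K^-1 _ (eb _ _ _))//.
  + by rewrite cosE (gauss_cos gP' v'_gt0) mulKf// gt_eqF.
  + by apply: mX => r; exact: continuous_cos.
  + by move=> x; rewrite ler_norml cos_geN1 cos_le1.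
- move=> u; rewrite fin (@RintegralZl _ _ _ P setT _ K^-1 _ (eb _ _ _))//.
  + by rewrite sinE (gauss_sin gP' v'_gt0) mulr0.
  + by apply: mX => r; exact: continuous_sin.
  + by move=> x; rewrite ler_norml sin_geN1 sin_le1.
Qed.

Lemma rank_one_tilt : exists c, tilt P P' (fun x => c - 2^-1 * gfield C0 (rho S' - rho S) x).
Proof.
have AE : rho S' - rho S = form_op Q [:: (dl, y)].
  by rewrite /form_op lsum_cons lsum_nil /= hR addrAC subrr add0r (addr0 (dl *: _)).
(* The second term compensates the centering in [gform]. *)
exists (ln K^-1 - dl * `|Q y| ^+ 2 / 2); rewrite AE; set A := form_op _ _.
have G2 := gfield_L2 PC0 C0_ker SS gP A; have g2 := gform_L2 PC0 C0_ker SS gP [:: (dl, y)].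
apply: tilt_ae quad_tilt _ _.
  apply: measurable_funB => //; apply: measurable_funM => //; exact: L2_measurable G2.
apply: filterS (gfield_form PC0 C0_ker SS gP [:: (dl, y)]) => x /(_ I) -> _.
rewrite /gform lsum_cons lsum_nil addr0 /GRing.scale /=; lra.
Qed.

End rank_one.

Section zmodule.
Context (V : zmodType).
Implicit Types a b c d : V.

Lemma subr_subr2 a b c : (b - a) - (c - a) = b - c.
Proof. by rewrite opprB addrA subrK. Qed.

Lemma subr_addr2 a b c : (b - a) + (c - b) = c - a.
Proof. by rewrite addrC addrA subrK. Qed.

Lemma addr_split a b c d : c = b + d -> (a + c) = (a + b) + d.
Proof. by move=> ->; rewrite addrA. Qed.

Lemma split_cancel a b c : b + c = (a + b) + (- a + c).
Proof. by rewrite addrACA subrr add0r. Qed.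

Lemma subr_addDl a b c : c - (a + b) = (c - a) - b.
Proof. by rewrite opprD addrA. Qed.

Lemma opprB_opp a b : - a - - b = b - a.
Proof. by rewrite opprK addrC. Qed.

End zmodule.

(** * Densities between all the Gaussian measures *)

Section equivalence.
Context (R : realType) (H : sepHilbertType R) (C0 : H -> H).
Hypothesis PC0 : SymP H C0.
Hypothesis C0_ker : forall x, C0 x = 0 -> x = 0.
Local Notation Q := (sqrt_op C0).
Variable mu : SymHS H -> probability (borel H) R.
Hypothesis gmu : forall S, SymHS_ltI S -> gaussian (cov C0 S) (mu S).
Implicit Types (S T A : SymHS H) (l : seq (R * H)).
Local Notation G := (gfield C0).

Definition affine_field (c : R) A (x : borel H) : R := c - 2^-1 * G A x.

(** The constant is a parameter: it adds under composition, changes sign under inversion and is only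
    bracketed, by [related_le]. *)
Definition related S S' c : Prop := tilt (mu S) (mu S') (affine_field c (rho S' - rho S)).

Lemma affine_L2 S c A : SymHS_ltI S -> affine_field c A \in Lfun (mu S) 2%:E.
Proof.
move=> SS; have G2 := gfield_L2 PC0 C0_ker SS (gmu SS) A.
rewrite (_ : affine_field c A = fun x => - 2^-1 * G A x + cst c x).
  by apply: L2_lin => //; exact: L2_cst.
by apply/funext => x; rewrite /affine_field mulNr addrC.
Qed.

Lemma affine_mean S c A : SymHS_ltI S -> \int[mu S]_x affine_field c A x = c + 2^-1 * hs_ip S A.
Proof.
move=> SS; have G2 := gfield_L2 PC0 C0_ker SS (gmu SS) A.
have -> : \int[mu S]_x affine_field c A x = \int[mu S]_x (- 2^-1 * G A x + cst c x).
  by apply: eq_Rintegral => x _; rewrite /affine_field mulNr addrC.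
rewrite (Rintegral_lin _ (L2_integrable G2) (L2_integrable (L2_cst (mu S) c))).
rewrite (gfield_mean PC0 C0_ker SS (gmu SS)) (prob_Rintegral_cst (mu S)); lra.
Qed.

Lemma gfield_lin_ae S a A A' : SymHS_ltI S ->
  G (a *: A + A') = (fun x => a * G A x + G A' x) %[ae mu S].
Proof.
move=> SS; have G2 A1 : G A1 \in Lfun (mu S) 2%:E := gfield_L2 PC0 C0_ker SS (gmu SS) A1.
apply: L2_class_inj => //; first exact: L2_lin.
by rewrite L2_class_lin//; exact: (gfield_class_lin PC0 C0_ker SS (gmu SS)).
Qed.

Lemma affine_sub_ae S c c' A A' : SymHS_ltI S ->
  (fun x => affine_field c A x - affine_field c' A' x) = affine_field (c - c') (A - A') %[ae mu S].
Proof.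
move=> SS; have E : A - A' = -1 *: A' + A by rewrite scaleN1r (addrC A).
rewrite E; apply: filterS (gfield_lin_ae (-1) A' A SS) => x /(_ I) h _.
apply: (etrans _ (congr1 (fun t => c - c' - 2^-1 * t) (esym h))).
rewrite /affine_field; cbv beta; generalize (G A x) (G A' x) => u v; ring.
Qed.

Let affine0_ae S : SymHS_ltI S -> affine_field 0 0 = (fun=> 0) %[ae mu S].
Proof.
move=> SS; apply: filterS (affine_sub_ae 0 0 0 0 SS) => x /(_ I) h _.
have e1 : (0 : R) - 0 = 0 by exact: subrr.
have e2 : (0 : SymHS H) - 0 = 0 by exact: subrr.
apply: (etrans (esym (congr2 (fun a b => affine_field a b x) e1 e2))).
apply: (etrans (esym h)); exact: subrr.
Qed.

Lemma related_refl S : SymHS_ltI S -> related S S 0.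
Proof.
move=> SS; rewrite /related (subrr (rho S)).
have t0 : tilt (mu S) (mu S) (fun=> 0).
  split=> // A mA; rewrite (eq_integral (cst 1%E)) => [|x _]; last by rewrite expR0.
  by rewrite integral_cst// mul1e.
apply: tilt_ae t0 (L2_measurable (affine_L2 0 0 SS)) _.
by apply: filterS (affine0_ae SS) => x /(_ I) h _; exact: esym.
Qed.

Lemma related_trans S S' S'' c c' : SymHS_ltI S ->
  related S S' c -> related S' S'' c' -> related S S'' (c + c').
Proof.
move=> SS t t'.
apply: tilt_ae (tilt_trans t t') (L2_measurable (affine_L2 _ _ SS)) _.
have E : rho S'' - rho S = 1 *: (rho S' - rho S) + (rho S'' - rho S').
  by rewrite scale1r; exact: esym (subr_addr2 _ _ _).
rewrite E; apply: filterS (gfield_lin_ae 1 (rho S' - rho S) (rho S'' - rho S') SS) => x /(_ I) h _.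
apply: (etrans _ (congr1 (fun t => c + c' - 2^-1 * t) (esym h))).
rewrite /affine_field; cbv beta.
generalize (G (rho S' - rho S) x) (G (rho S'' - rho S') x) => u v; ring.
Qed.

Lemma related_sym S S' c : SymHS_ltI S' -> related S S' c -> related S' S (- c).
Proof.
move=> SS' t.
apply: tilt_ae (tilt_sym t) (L2_measurable (affine_L2 _ _ SS')) _.
have E : 0 - (rho S' - rho S) = rho S - rho S'.
  by apply: etrans (add0r _) _; exact: opprB.
apply: filterS (filterI (affine_sub_ae 0 c 0 (rho S' - rho S) SS') (affine0_ae SS')) => x [/(_ I) h1 /(_ I) h2] _.
have e1 : 0 - c = - c by exact: add0r.
apply: (etrans _ (congr2 (fun a b => affine_field a b x) e1 E)).
apply: (etrans _ h1); rewrite [affine_field 0 0 x]h2.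
exact: (esym (sub0r _)).
Qed.

Lemma related_le S S' c : SymHS_ltI S -> SymHS_ltI S' -> related S S' c ->
  - 2^-1 * hs_ip S' (rho S' - rho S) <= c <= - 2^-1 * hs_ip S (rho S' - rho S).
Proof.
move=> SS SS' t.
have h1 := tilt_mean_le0 t (L2_integrable (affine_L2 _ _ SS)); rewrite affine_mean// in h1.
have t' := related_sym SS' t.
have h2 := tilt_mean_le0 t' (L2_integrable (affine_L2 _ _ SS')); rewrite affine_mean// in h2.
have E : rho S - rho S' = - (rho S' - rho S) by rewrite opprB.
rewrite E hs_ipNr in h2; clear E.
move: (hs_ip S _) (hs_ip S' _) h1 h2 => u v h1 h2.
by apply/andP; split; lra.
Qed.

(** Positive coefficients can only increase the form of [I + rho S], so coercivity persists at each
    stage of a chain. *)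
Lemma ltI_opp_add S l : SymHS_ltI S -> all (fun p => 0 < p.1) l ->
  SymHS_ltI (- (rho S + form_op Q l)).
Proof.
move=> SS l0; have [c c0 cS] := ltI_coercive (opp_rho_ltI SS).
apply: (coercive_ltI c0) => x.
apply: le_trans (cS x) _.
have -> : (idfun \- (- (rho S + form_op Q l) : SymHS H)) x =
    (idfun \- (- rho S : SymHS H)) x + form_op Q l x.
  by rewrite /= !opprK addrA.
rewrite [leRHS]innerDl lerDl; elim: l l0 => [|p l ih] /=.
  by rewrite /form_op lsum_nil SymHS0 inner0l.
move=> /andP[p0 l0]; rewrite /form_op lsum_cons SymHSD SymHSZ tensE innerDl !innerZl.
by rewrite addr_ge0 ?ih// mulr_ge0 ?(ltW p0)// (innerC (Q p.2)) -expr2 sqr_ge0.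
Qed.

Lemma rho_inj S S' : SymHS_ltI S -> SymHS_ltI S' -> rho S = rho S' -> S = S'.
Proof.
move=> SS SS' E; apply: oppr_inj; apply: etrans (esym (rho_opp_rho SS)) _.
exact: (etrans (congr1 (fun T => rho (- T)) E) (rho_opp_rho SS')).
Qed.

Lemma opp_rho_opp T : SymHS_ltI (- T) ->
  SymHS_ltI (- rho (- T)) /\ rho (- rho (- T)) = T.
Proof. by move=> TT; split; [exact: opp_rho_ltI|exact: etrans (rho_opp_rho TT) (opprK T)]. Qed.

(** One tensor is added at a time; the intermediate [S1] is recovered from its prescribed [rho] by
    the involution. *)
Lemma related_pos S S' l : SymHS_ltI S -> SymHS_ltI S' -> all (fun p => 0 < p.1) l ->
  rho S' = rho S + form_op Q l -> exists c, related S S' c.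
Proof.
elim: l S => [|p l ih] S SS SS' /= => [_|/andP[p0 l0]].
  rewrite /form_op lsum_nil => E; exists 0.
  by rewrite (rho_inj SS' SS (etrans E (addr0 (rho S)))); exact: related_refl.
rewrite /form_op lsum_cons => E.
have TT : SymHS_ltI (- (rho S + p.1 *: tens (Q p.2))).
  have := @ltI_opp_add S [:: p] SS; rewrite /= p0 /form_op lsum_cons lsum_nil.
  by rewrite (addr0 (p.1 *: tens (Q p.2))); exact.
have [SS1 E1] := opp_rho_opp TT; set S1 := - rho _ in SS1 E1.
have [c1 r1] := rank_one_tilt PC0 C0_ker SS (gmu SS) SS1 (gmu SS1) p0 E1.
have [c2 r2] : exists c, related S1 S' c.
  apply: ih => //; rewrite E1; exact: etrans E (addrA _ _ _).
by exists (c1 + c2); exact: (related_trans SS r1 r2).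
Qed.

Let split_form l : exists l1 l2, [/\ all (fun p => 0 < p.1) l1, all (fun p => 0 < p.1) l2 &
  form_op Q l1 = form_op Q l + form_op Q l2].
Proof.
elim: l => [|p l [l1 [l2 [h1 h2 E]]]].
  by exists [::], [::]; split => //; rewrite /form_op lsum_nil; exact: esym (addr0 _).
have cons_form q l' : form_op Q (q :: l') = q.1 *: tens (Q q.2) + form_op Q l' by exact: lsum_cons.
have [p0|p0|p0] := ltgtP p.1 0.
- exists l1, ((- p.1, p.2) :: l2); split => //=; first by rewrite oppr_gt0 p0.
  rewrite !cons_form /= scaleNr E; move: (_ *: _) (form_op _ _) (form_op _ _) => a b c.
  exact: split_cancel.
- exists (p :: l1), l2; split => //=; first by rewrite p0.
  by rewrite !cons_form E; exact: addrA.
- exists l1, l2; split => //; rewrite cons_form p0 E scale0r; congr (_ + _).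
  exact: esym (add0r _).
Qed.

(** A negative coefficient could leave the domain midway. Moving the negative part to the other side
    gives an [S1] reached by positive steps from [S] and from [S']. *)
Lemma related_form S S' l : SymHS_ltI S -> SymHS_ltI S' ->
  rho S' = rho S + form_op Q l -> exists c, related S S' c.
Proof.
move=> SS SS' E; have [l1 [l2 [h1 h2 El]]] := split_form l.
have [SS1 E1] := opp_rho_opp (ltI_opp_add SS h1); set S1 := - rho _ in SS1 E1.
have [c1 r1] := related_pos SS SS1 h1 E1.
have E2 : rho S1 = rho S' + form_op Q l2 by rewrite E1 E; exact: addr_split El.
have [c2 r2] := related_pos SS' SS1 h2 E2.
by exists (c1 + - c2); exact: (related_trans SS r1 (related_sym SS1 r2)).
Qed.

Section limit.
Variables (S S' : SymHS H) (S_ : nat -> SymHS H) (c_ : nat -> R).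
Hypotheses (SS : SymHS_ltI S) (SS' : SymHS_ltI S') (SS_ : forall n, SymHS_ltI (S_ n)).
Hypothesis r_ : forall n, related S (S_ n) (c_ n).
Hypotheses (S_cvg : S_ @ \oo --> S')
  (A_fast : forall n, `|rho S' - rho (S_ n)| <= 2^-1 ^+ n).
Let P := mu S.
Let A := rho S' - rho S.
Let A_ n := rho (S_ n) - rho S.

Let A_sub m n : `|A_ m - A_ n| <= 2^-1 ^+ m + 2^-1 ^+ n.
Proof.
have -> : A_ m - A_ n = (rho (S_ m) - rho S') + (rho S' - rho (S_ n)).
  by rewrite /A_ subr_subr2; exact: esym (etrans (addrA _ _ _) (congr1 (fun t => t - _) (subrK _ _))).
by apply: le_trans (ler_normD _ _) _; rewrite lerD// distrC.
Qed.

Let rel_mn m n : related (S_ m) (S_ n) (- c_ m + c_ n).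
Proof. exact: (related_trans (SS_ m) (related_sym (SS_ m) (r_ m)) (r_ n)). Qed.

Let S_bound : exists2 M, 0 <= M & forall n, `|S_ n| <= M.
Proof.
have cb := cvg_seq_bounded (cvgP _ S_cvg).
have [M [Mr hM]] := cb; exists (`|M| + 1) => [|n]; first by rewrite addr_ge0.
by apply: hM => //; rewrite (le_lt_trans (ler_norm _))// ltrDl.
Qed.

(** [related_le] between [S_ m] and [S_ n], whose constant is [c_ n - c_ m]. *)
Let c_cauchy : exists2 M, 0 <= M & forall m n, `|c_ m - c_ n| <= M * (2^-1 ^+ m + 2^-1 ^+ n).
Proof.
have [M M0 hM] := S_bound; exists M => // m n.
have E : rho (S_ n) - rho (S_ m) = A_ n - A_ m by exact: esym (subr_subr2 _ _ _).
have /andP[] := related_le (SS_ m) (SS_ n) (rel_mn m n); rewrite E.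
have B T : `|T| <= M -> `|hs_ip T (A_ n - A_ m)| <= M * (2^-1 ^+ m + 2^-1 ^+ n).
  move=> TM; apply: le_trans (hs_ip_le _ _) _; apply: ler_pM => //.
  by rewrite distrC A_sub.
have hn := B _ (hM n); have hm := B _ (hM m); clear E.
move: (hs_ip (S_ m) _) (hs_ip (S_ n) _) (M * _) hm hn => p q r.
rewrite !ler_norml => /andP[? ?] /andP[? ?] ? ?; apply/andP; split; lra.
Qed.

Let tv_bound e : 0 < e -> exists N, forall n m, (N <= n)%N -> (N <= m)%N ->
  \int[P]_x `|expR (affine_field (c_ n) (A_ n) x) - expR (affine_field (c_ m) (A_ m) x)| <= e.
Proof.
move=> e0; have [M M0 hM] := S_bound.
(* The first term of [tilt_tv] is then [e / 2], and [N] is chosen to bring the entropy term below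
   [e / 2]. *)
pose eta := e / 4; have eta0 : 0 < eta by rewrite divr_gt0.
have /cvgrPdist_le/(_ _ (divr_gt0 e0 (ltr0n _ 2)))[N _ hN] :
    eta^-1 * M * (2 * 2^-1 ^+ n) @[n --> \oo] --> (0 : R).
  by rewrite -(mulr0 (eta^-1 * M)); apply: cvgMr; rewrite -(mulr0 2); apply: cvgMr; exact: half_pow_cvg.
have {hN} hN : eta^-1 * M * (2 * 2^-1 ^+ N) <= e / 2.
  by have := hN N (leqnn N); rewrite sub0r normrN; apply: le_trans; exact: ler_norm.
exists N => n m Nn Nm; set f1 := affine_field _ _; set f2 := affine_field _ _.
have f12 k : f1 \in Lfun (mu (S_ k)) 2%:E /\ f2 \in Lfun (mu (S_ k)) 2%:E.
  by split; exact: affine_L2.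
have I k : (mu (S_ k)).-integrable setT (EFin \o (fun x => f1 x - f2 x)).
  by have [h1 h2] := f12 k; exact: (L2_integrable (L2_B h1 h2)).
have E k : \int[mu (S_ k)]_x (f1 x - f2 x) =
    c_ n + 2^-1 * hs_ip (S_ k) (A_ n) - (c_ m + 2^-1 * hs_ip (S_ k) (A_ m)).
  have [h1 h2] := f12 k.
  apply: (etrans (@RintegralB _ _ _ (mu (S_ k)) setT f1 f2 measurableT (L2_integrable h1) (L2_integrable h2))).
  exact: (congr2 (fun a b => a - b) (affine_mean _ _ (SS_ k)) (affine_mean _ _ (SS_ k))).
apply: le_trans (tilt_tv eta0 (r_ n) (r_ m) (I n) (I m)) _; rewrite !E.
have D : `|hs_ip (S_ n - S_ m) (A_ n - A_ m)| <= 2 * M * (2 * 2^-1 ^+ N).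
  apply: le_trans (hs_ip_le _ _) _; apply: ler_pM => //.
    by apply: le_trans (ler_normB _ _) _; have := hM n; have := hM m; lra.
  apply: le_trans (A_sub _ _) _.
  have hle k : (N <= k)%N -> (2^-1 : R) ^+ k <= 2^-1 ^+ N.
    by move=> Nk; apply: ler_wiXn2l => //; rewrite invr_le1 ?unitfE// ler1n.
  by have := hle _ Nn; have := hle _ Nm; lra.
have Er : hs_ip (S_ n - S_ m) (A_ n - A_ m) = (hs_ip (S_ n) (A_ n) - hs_ip (S_ n) (A_ m)) -
    (hs_ip (S_ m) (A_ n) - hs_ip (S_ m) (A_ m)).
  by rewrite hs_ipBl; congr (_ - _); exact: hs_ipBr.
have i0 : 0 < eta^-1 by rewrite invr_gt0.
have := ler_wpM2l (ltW i0) (le_trans (ler_norm _) D); rewrite Er.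
generalize (hs_ip (S_ n) (A_ n)) (hs_ip (S_ n) (A_ m)) (hs_ip (S_ m) (A_ n)) (hs_ip (S_ m) (A_ m)).
move=> p q r s hX; clear Er D E.
have -> : c_ n + 2^-1 * p - (c_ m + 2^-1 * q) - (c_ n + 2^-1 * r - (c_ m + 2^-1 * s)) =
  2^-1 * (p - q - (r - s)) by field.
have -> : 2 * eta = e / 2 by rewrite /eta; field.
have h3 : eta^-1 * (2 * M * (2 * 2^-1 ^+ N)) = 2 * (eta^-1 * M * (2 * 2^-1 ^+ N)) by ring.
rewrite h3 in hX; rewrite mulrCA.
by move: (eta^-1 * (p - q - _)) (eta^-1 * M * _) hN hX => u v ? ?; lra.
Qed.

Lemma related_lim : exists c, related S S' c.
Proof.
have [M M0 cM] := c_cauchy.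
have cc : cvgn c_.
  apply: (@cauchy_dom _ _ _ (fun n => M * (2 * 2^-1 ^+ n))) => [|n m nm].
    by rewrite -(mulr0 M); apply: cvgMr; rewrite -(mulr0 2); apply: cvgMr; exact: half_pow_cvg.
  apply: le_trans (cM _ _) _; apply: ler_wpM2l => //.
  have : (2^-1 : R) ^+ m <= 2^-1 ^+ n.
    by apply: ler_wiXn2l => //; rewrite invr_le1 ?unitfE// ler1n.
  move: (_ ^+ m) (_ ^+ n) => s t; lra.
exists (limn c_); set c := limn c_ in cc *.
pose f_ n := affine_field (c_ n) (A_ n); pose f := affine_field c A.
have mf : measurable_fun setT f := L2_measurable (affine_L2 c A SS).
have G2 A1 : G A1 \in Lfun P 2%:E := gfield_L2 PC0 C0_ker SS (gmu SS) A1.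
have ff : {ae P, forall x, f_ n x @[n --> \oo] --> f x}.
  have [K K0 hK] := gfield_dist PC0 C0_ker SS (gmu SS).
  have GK m n : `|L2_class P (G (A_ m)) - L2_class P (G (A_ n))| <= K * (2^-1 ^+ m + 2^-1 ^+ n).
    rewrite -(gfield_classB PC0 C0_ker SS (gmu SS)); apply: le_trans (hK _) _.
    by apply: ler_wpM2l => //; exact: A_sub.
  have GA2 n := G2 (A_ n).
  have Gc : L2_class P (G (A_ n)) @[n --> \oo] --> L2_class P (G A).
    apply: (@cvg_dom0 _ _ _ _ (fun n => K * 2^-1 ^+ n)) => [|n].
      by rewrite -(mulr0 K); apply: cvgMr; exact: half_pow_cvg.
    rewrite -(gfield_classB PC0 C0_ker SS (gmu SS)); apply: le_trans (hK _) _.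
    apply: ler_wpM2l => //; rewrite distrC.
    by have -> : A - A_ n = rho S' - rho (S_ n) by exact: subr_subr2.
  (* The almost sure limit of [G (A_ n)], given by the geometric rate, is also its L2 limit, so it
     agrees with [G A] almost everywhere. *)
  have Fc : L2_class P (G (A_ n)) @[n --> \oo] -->
      L2_class P (fun x => fine (limn_esup (fun n => (G (A_ n) x)%:E))).
    apply: (@cvg_dom0 _ _ _ _ (fun n => 2 * K * 2^-1 ^+ n)) => [|n].
      by rewrite -(mulr0 (2 * K)); apply: cvgMr; exact: half_pow_cvg.
    by rewrite distrC; exact: fast_dist GA2 GK n.
  have GF := L2_class_inj (fast_L2 GA2 GK) (G2 A) (cvg_uniq Fc Gc).
  apply: filterS (filterI (fast_ae_cvg GA2 GK) GF) => x [h1 /(_ I) h2].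
  rewrite h2 in h1; apply: cvgB => //.
  by apply: cvgMr.
have tv e : 0 < e -> exists N, forall n m, (N <= n)%N -> (N <= m)%N ->
  \int[P]_x `|expR (f_ n x) - expR (f_ m x)| <= e.
  exact: tv_bound.
have t_ n : tilt P (mu (S_ n)) (f_ n) by exact: r_.
(* Both sides are limits of the integrals under [mu (S_ n)]: the right one by L1 convergence of the
   densities, the left one because the variance depends continuously on [T]. *)
have trig (F : R -> R) (g : R -> R) : continuous F -> continuous g -> (forall r, `|F r| <= 1) ->
    (forall T, SymHS_ltI T -> forall y, \int[mu T]_x F (inner (x : H) y) = g (inner (cov C0 T y) y)) ->
    forall y, \int[mu S']_x F (inner (x : H) y) = \int[P]_x (F (inner (x : H) y) * expR (f x)).
  move=> cF cg F1 Fg y.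
  have mF : measurable_fun setT (fun x : borel H => F (inner (x : H) y)).
    by apply: measurableT_comp (measurable_inner y); exact: continuous_measurable_fun.
  have h1 := tilt_limit_integral t_ mf ff tv mF (fun x => F1 _).
  rewrite Fg//; apply: cvg_uniq h1.
  rewrite (_ : (fun n => _) = fun n => g (inner (cov C0 (S_ n) y) y)); last first.
    by apply/funext => n; rewrite Fg.
  apply: (@cvg_comp _ _ _ (fun n => inner (cov C0 (S_ n) y) y) g _ (nbhs (inner (cov C0 S' y) y)));
    last exact: cg.
  have cE T : inner (cov C0 T y) y = inner (Q y) (Q y) - hs_ip T (tens (Q y)).
    by rewrite cov_inner// hs_ip_tens.
  rewrite cE (_ : (fun n => _) = fun n => inner (Q y) (Q y) - hs_ip (S_ n) (tens (Q y))); last first.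
    by apply/funext => n; rewrite cE.
  apply: cvgB; first exact: cvg_cst.
  by apply: cvg_hs_ip; [exact: S_cvg|exact: cvg_cst].
have vgt0 T : SymHS_ltI T -> forall y, y != 0 -> 0 < inner (cov C0 T y) y.
  by move=> TT y; exact: cov_gt0.
apply: tilt_char => //.
- exact: tilt_limit_integrable t_ mf ff tv.
- apply: (trig cos (fun t => expR (- t / 2))).
  + exact: continuous_cos.
  + move=> t; apply: (@cvg_comp _ _ _ (fun t : R => - t / 2) expR _ (nbhs (- t / 2))).
      by apply: cvgMl; apply: cvgN; exact: cvg_id.
    exact: continuous_expR.
  + by move=> r; rewrite ler_norml cos_geN1 cos_le1.
  + by move=> T TT y; exact: (gauss_cos (gmu TT) (vgt0 T TT)).
- apply: (trig sin (fun=> 0)).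
  + exact: continuous_sin.
  + by move=> t; exact: cvg_cst.
  + by move=> r; rewrite ler_norml sin_geN1 sin_le1.
  + by move=> T TT y; exact: (gauss_sin (gmu TT) (vgt0 T TT)).
Qed.

End limit.

(** [rho S' - rho S] is approximated by finite combinations, which define admissible [S_ n] through
    the involution; continuity of [rho] at [- rho S'] gives their convergence to [S']. *)
Lemma related_ex S S' : SymHS_ltI S -> SymHS_ltI S' -> exists c, related S S' c.
Proof.
move=> SS SS'; pose A := rho S' - rho S.
have [d [K [d0 K0 near_ltI]]] := rho_near (opp_rho_ltI SS').
pose T_ n := rho S + form_op Q (approx C0 A n).
have T_dist n : `|rho S' - T_ n| <= 2^-1 ^+ n.
  by rewrite /T_ subr_addDl; exact: approxP.
have T_dist_opp n : `|- T_ n - (- rho S')| <= 2^-1 ^+ n.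
  by rewrite (opprB_opp (T_ n) (rho S')); exact: T_dist.
(* The domain is open at [- rho S']: from [n0] on the [- T_ n] belong to it, and shifting by [n0]
   preserves the geometric rate. *)
have [n0 hn0] : exists n0, (2^-1 : R) ^+ n0 <= d.
  have /cvgrPdist_le/(_ _ d0)[N _ /(_ N (leqnn N))] := @half_pow_cvg R.
  by rewrite sub0r normrN ger0_norm ?exprn_ge0// => ?; exists N.
have half_le n m : (n <= m)%N -> (2^-1 : R) ^+ m <= 2^-1 ^+ n.
  by move=> nm; apply: ler_wiXn2l => //; rewrite invr_le1 ?unitfE// ler1n.
have TT n : SymHS_ltI (- T_ (n + n0)%N).
  have [] // := near_ltI (- T_ (n + n0)%N) _.
  by apply: le_trans (T_dist_opp _) _; apply: le_trans (half_le _ _ (leq_addl _ _)) hn0.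
pose S_ n := - rho (- T_ (n + n0)%N).
have SS_ n : SymHS_ltI (S_ n) by exact: (opp_rho_opp (TT n)).1.
have rS_ n : rho (S_ n) = T_ (n + n0)%N by exact: (opp_rho_opp (TT n)).2.
have r_ n : exists c, related S (S_ n) c by apply: related_form (rS_ n).
have [c_ hc] := choice r_.
apply: (@related_lim S S' S_ c_) => //; last first.
  move=> n; rewrite rS_; apply: le_trans (T_dist _) _.
  exact: half_le (leq_addr _ _).
have h : - T_ (n + n0)%N @[n --> \oo] --> - rho S'.
  apply: (@cvg_dom0 _ _ _ _ (fun n => 2^-1 ^+ n)) => [|n]; first exact: half_pow_cvg.
  by apply: le_trans (T_dist_opp _) _; exact: half_le (leq_addr _ _).
have := rho_cvg (opp_rho_ltI SS') h; rewrite (rho_opp_rho SS') => h2.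
have h3 : S_ n @[n --> \oo] --> - - S' by exact: (cvgN h2).
by rewrite (opprK S') in h3.
Qed.

End equivalence.

(** * The derivative of the log-density *)

Section quadratic_remainder.
Context (R : realType) (V W : normedModType R).

Lemma quadratic_diff (f : V -> W) (df : V -> W) x (d K M : R) : linear df ->
  0 < d -> 0 <= K -> (forall h, `|df h| <= M * `|h|) ->
  (forall h, `|h| <= d -> `|f (h + x) - f x - df h| <= K * `|h| ^+ 2) ->
  differentiable f x /\ forall h, 'd f x h = df h.
Proof.
move=> ldf d0 K0 dM fK.
pose L : {linear V -> W} := HB.pack df (GRing.isLinear.Build _ _ _ _ df ldf).
have cL : continuous L.
  apply: bounded_linear_continuous; apply/linear_boundedP.
  exists M; split; first exact: num_real.
  by move=> r Mr h; apply: le_trans (dM h) _; apply: ler_wpM2r => //; exact: ltW.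
have fo : f \o shift x = cst (f x) + L +o_ 0 id.
  apply/eqaddoP => e e0; near=> h.
  have hd : `|h| <= d by near: h; apply: nbhs0_le.
  have he : `|h| <= e / (K + 1).
    by near: h; apply: nbhs0_le; rewrite divr_gt0// ltr_wpDl.
  rewrite -[X in `|X|]/(f (h + x) - (f x + df h)) opprD addrA.
  apply: le_trans (fK h hd) _; rewrite expr2 mulrA; apply: ler_wpM2r => //.
  apply: le_trans (ler_wpM2l K0 he) _.
  rewrite mulrCA ler_piMr ?(ltW e0)//.
  by rewrite ler_pdivrMr ?ltr_wpDl// mul1r lerDl.
have dE := diff_unique cL fo; split; last by move=> h; rewrite dE.
by apply/diff_locallyP; rewrite dE; split.
Unshelve. all: by end_near. Qed.

End quadratic_remainder.

Section log_density.
Context (R : realType) (H : sepHilbertType R).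
Implicit Types (P : probability (borel H) R) (f : borel H -> R).
Local Open Scope charge_scope.

Lemma log_density_measurable P P' : P' `<< P -> measurable_fun setT (log_density P' P : borel H -> R).
Proof.
move=> D; have Ig := Radon_Nikodym_integrable (nu := charge_of_finite_measure P') (mu := P) D.
apply: measurableT_comp; first exact: measurable_ln.
by apply: measurableT_comp => //; exact: measurable_int Ig.
Qed.

Lemma log_density_tilt P P' f : tilt P P' f -> log_density P' P = f %[ae P].
Proof.
move=> t; have D := tilt_dominates t; have [mf h] := t.
have Ig := Radon_Nikodym_integrable (nu := charge_of_finite_measure P') (mu := P) D.
have m1 : measurable_fun setT (fun x => (expR (f x))%:E).
  by apply/measurable_EFinP; apply: measurableT_comp mf.
have m2 A : A `<=` setT -> measurable A ->
    (\int[P]_(x in A) ('d (charge_of_finite_measure P') '/d P) x = \int[P]_(x in A) (expR (f x))%:E)%E.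
  by move=> _ mA; rewrite -h// -Radon_Nikodym_integral.
apply: filterS (integral_ae_eq measurableT Ig m1 m2) => x /(_ I) gx _.
by rewrite /log_density gx /= expRK.
Qed.

End log_density.

Section L2_ae.
Context d (T : measurableType d) (R : realType) (P : probability T R).

Lemma L2_ae (f g : T -> R) : measurable_fun setT f -> g \in Lfun P 2%:E -> f = g %[ae P] ->
  f \in Lfun P 2%:E.
Proof.
move=> mf g2 fg; rewrite inE; apply/andP; split; rewrite inE//=.
rewrite /finite_norm (Lnorm_ae (lee1n 2) mf (L2_measurable g2) fg).
exact: Lfun_finite g2.
Qed.

End L2_ae.

Lemma affine_remainder (R : realType) (W : lmodType R) (u g q : W) (c s : R) :
  (- 2^-1 *: g + c *: u) - (- 2^-1 *: (s *: u + q)) =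
  (c + 2^-1 * s) *: u + (- 2^-1) *: (g - q).
Proof.
rewrite !scaleNr opprK scalerDr scalerA scalerDl scalerBr opprB.
rewrite (addrC (- _)) addrACA; congr (_ + _); exact: addrC.
Qed.

Lemma scale_affine_lin (R : realType) (W : lmodType R) (u gA gB : W) (k a p q : R) :
  k *: ((a * p + q) *: u + (a *: gA + gB)) =
  a *: (k *: (p *: u + gA)) + k *: (q *: u + gB).
Proof.
rewrite scalerA (mulrC a k) -scalerA -scalerDr (scalerDr a) scalerA scalerDl.
by rewrite -!addrA; congr (k *: (_ + _)); rewrite addrCA.
Qed.

(** Used with [p = hs_ip h Dl], [q = hs_ip S Dl] and [r = hs_ip S A], where [Dl] is the increment of
    [rho] and [A] its linear part: it bounds the constant part of the remainder. *)
Lemma remainder_bound (R : realFieldType) (p q r c X Y : R) : `|p| <= X -> `|q - r| <= Y ->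
  c <= - 2^-1 * q -> - 2^-1 * (p + q) <= c -> `|c + 2^-1 * r| <= X + Y.
Proof. by rewrite !ler_norml => /andP[? ?] /andP[? ?] ? ?; apply/andP; split; lra. Qed.

Section score.
Context (R : realType) (H : sepHilbertType R) (C0 : H -> H).
Hypothesis PC0 : SymP H C0.
Hypothesis C0_ker : forall x, C0 x = 0 -> x = 0.
Variables (mu0 : probability (borel H) R) (mu : SymHS H -> probability (borel H) R).
Hypothesis g0 : gaussian C0 mu0.
Hypothesis gmu : forall S, SymHS_ltI S -> gaussian (cov C0 S) (mu S).
Variable Sstar : SymHS H.
Hypothesis Sstar_lt : SymHS_ltI Sstar.
Implicit Types (S T A V : SymHS H).
Local Notation G := (gfield C0).
Local Notation P := (mu Sstar).
Local Notation cl := (L2_class P).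
Local Notation aff := (affine_field C0).

Definition logdens S : LspaceType2 P := cl (log_density (mu S) mu0).

Lemma ltI0 : SymHS_ltI (0 : SymHS H).
Proof. by apply: (@coercive_ltI _ _ _ 1) => // x; rewrite -[(_ \- _) x]/(x - (0 : SymHS H) x) SymHS0 subr0 inner_norm mul1r. Qed.

Lemma rho0 : rho (0 : SymHS H) = 0.
Proof.
apply: SymHS_ext => x; rewrite (rhoE _ ltI0) SymHS0; have := resK x ltI0.
by rewrite SymHS0 subr0 => ->; rewrite subrr.
Qed.

Lemma gaussian0 : gaussian (cov C0 0) mu0.
Proof.
move=> y U mU; rewrite (g0 y mU); congr (centered_normal (inner _ y) U).
rewrite -[cov C0 0 y]/(sqrt_op C0 (sqrt_op C0 y - (0 : SymHS H) (sqrt_op C0 y))).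
by rewrite SymHS0 subr0 (sqrt_opP PC0).2.
Qed.

(** [mu 0] is known only through its one-dimensional laws, which are those of [mu0]. *)
Lemma mu0E (A : set (borel H)) : measurable A -> mu 0 A = mu0 A.
Proof.
have v0 y : y != 0 -> 0 < inner (cov C0 0 y) y by apply: cov_gt0 => //; exact: ltI0.
move=> mA; apply: cramer_wold => // y.
- by rewrite (gauss_cos (gmu ltI0) v0) (gauss_cos gaussian0 v0).
- by rewrite (gauss_sin (gmu ltI0) v0) (gauss_sin gaussian0 v0).
Qed.

Lemma related0_tilt S c : SymHS_ltI S -> related C0 mu 0 S c -> tilt mu0 (mu S) (aff c (rho S)).
Proof.
move=> SS [mf h].
have E : rho S - rho 0 = rho S by rewrite rho0; exact: subr0.
rewrite E in mf h; split=> // A mA; rewrite h//.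
by apply: eq_measure_integral => B mB _; exact: mu0E.
Qed.

(** The density is determined almost everywhere for [mu0], whereas classes are taken for [P];
    absolute continuity of [P] transfers the identity. *)
Lemma log_density_affine S c : SymHS_ltI S -> related C0 mu 0 S c ->
  log_density (mu S) mu0 = aff c (rho S) %[ae P].
Proof.
move=> SS r; have [c' r'] := related_ex PC0 C0_ker gmu ltI0 Sstar_lt.
apply: (null_dominates_ae_eq measurableT (tilt_dominates (related0_tilt Sstar_lt r'))).
exact: log_density_tilt (related0_tilt SS r).
Qed.

Lemma log_density_L2 S : SymHS_ltI S -> log_density (mu S) mu0 \in Lfun P 2%:E.
Proof.
move=> SS; have [c r] := related_ex PC0 C0_ker gmu ltI0 SS.
apply: L2_ae (affine_L2 PC0 C0_ker gmu c (rho S) Sstar_lt) (log_density_affine SS r).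
exact: log_density_measurable (tilt_dominates (related0_tilt SS r)).
Qed.

Lemma logdens_affine S c : SymHS_ltI S -> related C0 mu 0 S c -> logdens S = cl (aff c (rho S)).
Proof.
move=> SS r; apply: L2_class_ae; [exact: log_density_L2| |exact: log_density_affine].
exact: affine_L2.
Qed.

Lemma logdens_sub S S' : SymHS_ltI S -> SymHS_ltI S' -> exists2 c,
  - 2^-1 * hs_ip S' (rho S' - rho S) <= c <= - 2^-1 * hs_ip S (rho S' - rho S) &
  logdens S' - logdens S = cl (aff c (rho S' - rho S)).
Proof.
move=> SS SS'; have [c r] := related_ex PC0 C0_ker gmu ltI0 SS.
have [c' r'] := related_ex PC0 C0_ker gmu ltI0 SS'; exists (c' - c).
  rewrite (addrC c'); apply: (related_le PC0 C0_ker gmu SS SS').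
  exact: (related_trans PC0 C0_ker gmu SS (related_sym PC0 C0_ker gmu SS r) r').
rewrite (logdens_affine SS r) (logdens_affine SS' r').
have a2 k A : aff k A \in Lfun P 2%:E by exact: affine_L2.
apply: (etrans (esym (L2_class_B (a2 c' (rho S')) (a2 c (rho S))))).
apply: L2_class_ae; [exact: L2_B (a2 _ _) (a2 _ _)|exact: a2|].
exact: affine_sub_ae.
Qed.

Let u1 : LspaceType2 P := cl (cst 1).

Lemma affine_class c A : cl (aff c A) = - 2^-1 *: cl (G A) + c *: u1.
Proof.
have G2 : G A \in Lfun P 2%:E := gfield_L2 PC0 C0_ker Sstar_lt (gmu Sstar_lt) A.
have c1 : (fun=> c * 1 + 0) \in Lfun P 2%:E by exact: L2_cst.
rewrite (_ : aff c A = fun x => - 2^-1 * G A x + (c * 1 + 0)); last first.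
  by apply/funext => x; rewrite /affine_field mulr1 addr0 mulNr addrC.
apply: (etrans (L2_class_lin _ G2 c1)); congr (_ + _).
apply: (etrans (L2_class_lin c (L2_cst P 1) (L2_cst P 0))).
rewrite [L2_class _ (cst 0)]L2_class0; exact: addr0.
Qed.

(** The point [S] of differentiation varies while the class stays in L2 of the fixed [P = mu Sstar];
    [u1] carries the constants. *)
Definition score S V : LspaceType2 P :=
  - 2^-1 *: (hs_ip S (hs_conj (res S) V) *: u1 + cl (G (hs_conj (res S) V))).

Let gl a A A' := gfield_class_lin PC0 C0_ker Sstar_lt (gmu Sstar_lt) a A A'.

Lemma score_linear S : SymHS_ltI S -> linear (score S).
Proof.
move=> SS a V W; rewrite /score; have E := hs_conj_lin (res_Sym SS) a V W.
apply: (etrans (congr1 (fun A => - 2^-1 *: (hs_ip S A *: u1 + cl (G A))) E)).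
generalize (hs_conj (res S) V) (hs_conj (res S) W) => A B.
apply: (etrans (congr1 (fun g => - 2^-1 *: (hs_ip S (a *: A + B) *: u1 + g)) (gl a A B))).
have e : hs_ip S (a *: A + B) = a * hs_ip S A + hs_ip S B by rewrite hs_ipDr hs_ipZr.
apply: (etrans (congr1 (fun r => - 2^-1 *: (r *: u1 + (a *: cl (G A) + cl (G B)))) e)).
exact: scale_affine_lin.
Qed.

Lemma score_bound S : SymHS_ltI S -> exists2 M, 0 <= M & forall V, `|score S V| <= M * `|V|.
Proof.
move=> SS; have [c c0 cS] := ltI_coercive SS; have Rb := res_opb c0 cS.
have [K K0 hK] := gfield_dist PC0 C0_ker Sstar_lt (gmu Sstar_lt).
pose r := c^-1; have r0 : 0 <= r by rewrite invr_ge0 ltW.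
exists (2^-1 * ((`|S| * `|u1| + K) * r ^+ 2)) => [|V].
  by rewrite !mulr_ge0 ?addr_ge0 ?mulr_ge0 ?sqr_ge0.
have := hs_conj_norm V (res_Sym SS) Rb r0; rewrite -/r /score.
generalize (hs_conj (res S) V) => A hA.
have -> : 2^-1 * ((`|S| * `|u1| + K) * r ^+ 2) * `|V| =
  2^-1 * (`|S| * (r ^+ 2 * `|V|) * `|u1| + K * (r ^+ 2 * `|V|)) by ring.
rewrite normrZ normrN ger0_norm ?invr_ge0//; apply: ler_wpM2l; rewrite ?invr_ge0//.
apply: le_trans (ler_normD _ _) _; rewrite normrZ; apply: lerD.
  apply: ler_wpM2r => //; apply: le_trans (hs_ip_le S A) _; exact: ler_wpM2l.
by apply: le_trans (hK A) _; exact: ler_wpM2l.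
Qed.

Lemma logdens_diff S : SymHS_ltI S ->
  differentiable logdens S /\ forall V, 'd logdens S V = score S V.
Proof.
move=> SS; have [M M0 hM] := score_bound SS.
have [d [K [d0 K0 hd]]] := rho_near SS.
have [K' K'0 hK'] := gfield_dist PC0 C0_ker Sstar_lt (gmu Sstar_lt).
(* The first term of the constant bounds the multiple of [u1] in the remainder, the second the field
   part. *)
apply: (@quadratic_diff _ _ _ logdens (score S) S d
  (K * (1 + `|S|) * `|u1| + 2^-1 * (K' * K)) M) => //.
- exact: score_linear.
- by rewrite addr_ge0// !mulr_ge0 ?addr_ge0// ltW.
move=> h hh; have [TT h1 h2] : [/\ SymHS_ltI (h + S), `|rho (h + S) - rho S| <= K * `|h| &
    `|rho (h + S) - rho S - hs_conj (res S) h| <= K * `|h| ^+ 2].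
  by have := hd (h + S); rewrite (addrK S h); exact.
have [c /andP[c1 c2] ->] := logdens_sub SS TT.
have dS : hs_ip (h + S) (rho (h + S) - rho S) = hs_ip h (rho (h + S) - rho S) +
  hs_ip S (rho (h + S) - rho S) by exact: hs_ipDl.
rewrite {}dS in c1; rewrite affine_class /score affine_remainder.
generalize dependent (rho (h + S) - rho S) => Dl h1 h2 c1 c2.
move: (hs_conj _ h) h2 => A h2.
rewrite -(gfield_classB PC0 C0_ker Sstar_lt (gmu Sstar_lt)).
apply: le_trans (ler_normD _ _) _; rewrite mulrDl !normrZ normrN; apply: lerD.
  rewrite [leRHS]mulrAC; apply: ler_wpM2r => //.
  have b1 := le_trans (hs_ip_le h Dl) (ler_wpM2l (normr_ge0 h) h1).
  have b2 := le_trans (hs_ip_le S (Dl - A)) (ler_wpM2l (normr_ge0 S) h2).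
  rewrite (hs_ipBr Dl A S) in b2.
  have -> : K * (1 + `|S|) * `|h| ^+ 2 = `|h| * (K * `|h|) + `|S| * (K * `|h| ^+ 2) by ring.
  exact: (remainder_bound b1 b2 c1 c2).
have -> : 2^-1 * (K' * K) * `|h| ^+ 2 = 2^-1 * (K' * (K * `|h| ^+ 2)) by ring.
rewrite ger0_norm ?invr_ge0//; apply: ler_wpM2l; rewrite ?invr_ge0//.
by apply: le_trans (hK' _) _; exact: ler_wpM2l.
Qed.

End score.

(** * The inverse square root of I - S *)

Section sqrt_resolvent.
Context (R : realType) (H : sepHilbertType R).
Variable S : SymHS H.
Hypothesis SS : SymHS_ltI S.
Local Notation B := (sqrt_op (idfun \- S)).
Local Notation X := (inv_op B).

Let PB := sqrt_idBP SS.

Let SB : Sym H B. Proof. by case: PB => [[]]. Qed.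

(** [c] times the squared norm of [x] is at most that of [B x], which is at most [M * inner (B x) x]
    by [psd_sqr_le]. *)
Let B_coercive : exists2 c, 0 < c & coercive B c.
Proof.
have [c c0 cS] := ltI_coercive SS; have [M M0 BM] := Sym_opb SB.
exists (c / M); first exact: divr_gt0.
move=> x; rewrite mulrAC ler_pdivrMr// mulrC (mulrC (inner _ _)).
have B0 y : 0 <= inner (B y) y by case: PB => [[]].
apply: (@le_trans _ _ (`|B x| ^+ 2)); last first.
  apply: psd_sqr_le => //; [exact: Sym_lin|exact: Sym_sa|move=> y; exact: opb_inner_le].
by rewrite -[leRHS]inner_norm (Sym_sa SB) PB.2 innerC mulrC; exact: cS.
Qed.

Lemma invsqrt_Sym : Sym H X.
Proof. by have [c c0 cB] := B_coercive; exact: inv_op_Sym SB c0 cB. Qed.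

Let BX x : B (X x) = x. Proof. by have [c c0 cB] := B_coercive; exact: inv_opK SB c0 cB x. Qed.

Let XB x : X (B x) = x. Proof. by have [c c0 cB] := B_coercive; exact: inv_opKl SB c0 cB x. Qed.

Let XX x : X (X x) = res S x.
Proof. by rewrite -[LHS](resKl _ SS) -PB.2 !BX. Qed.

Lemma hs_conj_sqrt_res V : hs_conj B (hs_conj (res S) V) = hs_conj X V.
Proof.
apply: SymHS_ext => x; have SR := res_Sym SS; have SX := invsqrt_Sym.
by rewrite (hs_conjE _ _ SB) (hs_conjE _ _ SR) (hs_conjE _ _ SX) -!XX BX XB.
Qed.

Lemma hs_conj_invsqrt V : hs_conj X (hs_conj X V) = hs_conj (res S) V.
Proof.
apply: SymHS_ext => x; have SR := res_Sym SS; have SX := invsqrt_Sym.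
by rewrite (hs_conjE _ _ SR) !(hs_conjE _ _ SX) -!XX.
Qed.

End sqrt_resolvent.

Section hs_conj_dist.
Context (R : realType) (H : sepHilbertType R).

(** [X V X - Y V Y = (X - Y) V X + Y V (X - Y)]. The two terms are not self-adjoint, so they are
    estimated through [hs_sum] rather than in [SymHS]. *)
Lemma hs_conj_dist (X Y : H -> H) (V : SymHS H) (b eps : R) : Sym H X -> Sym H Y ->
  opb X b -> opb Y b -> opb (X \- Y) eps -> 0 <= b -> 0 <= eps ->
  `|hs_conj X V - hs_conj Y V| <= 2 * (eps * b * `|V|).
Proof.
move=> SX SY Xb Yb XY b0 e0; have lX := Sym_lin SX; have lY := Sym_lin SY.
have SD : Sym H (X \- Y).
  apply: SymI XY _ => [a x y|x y] /=.
    by rewrite lX lY opprD addrACA -scalerBr.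
  by rewrite innerBl innerBr (Sym_sa SX) (Sym_sa SY).
have h1 := hs_sum_sandwich V SD SX XY Xb e0 b0.
have h2 := hs_sum_sandwich V SY SD Yb XY b0 e0.
have m0 : 0 <= eps * b * `|V| by rewrite !mulr_ge0.
have le_norm (Z : H -> H) : (hs_sum Z <= ((eps * b * `|V|) ^+ 2)%:E)%E ->
    hs_norm Z <= eps * b * `|V|.
  move=> hZ; rewrite /hs_norm -[leRHS]ger0_norm// -sqrtr_sqr ler_wsqrtr//.
  rewrite -lee_fin fineK// ge0_fin_numE ?hs_sum_ge0//; exact: le_lt_trans hZ (ltry _).
apply: hs_norm_le; first by rewrite mulr_ge0.
have E : SymHS_op (hs_conj X V - hs_conj Y V) =
    (((X \- Y) \o V \o X : H -> H) + (Y \o V \o (X \- Y) : H -> H))%R.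
  apply/funext => x; rewrite [LHS]SymHSB !hs_conjE// -[RHS]/((X (V (X x)) - Y (V (X x))) + Y (V (X x - Y x))).
  by rewrite (linB (SymHS_lin V)) (linB lY) addrA subrK.
have h2' : (hs_sum (Y \o V \o (X \- Y))%R <= ((eps * b * `|V|) ^+ 2)%:E)%E by rewrite (mulrC eps).
rewrite E; apply: le_trans (hs_normD_fin (le_lt_trans h1 (ltry _)) (le_lt_trans h2' (ltry _))) _.
rewrite lee_fin ler_sqr ?nnegrE ?addr_ge0 ?mulr_ge0// ?sqrtr_ge0//.
by rewrite mulr_natl mulr2n; apply: lerD; exact: le_norm.
Qed.

Lemma hs_conj_res_cvg (S_ : nat -> SymHS H) S V : (forall n, SymHS_ltI (S_ n)) -> SymHS_ltI S ->
  S_ @ \oo --> S -> hs_conj (res (S_ n)) V @[n --> \oo] --> hs_conj (res S) V.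
Proof.
move=> SS_ SS Sc; have [c c0 cS] := ltI_coercive SS; have Rb := res_opb c0 cS.
have h := cvg_dist0 (rho_cvg SS Sc).
have cV0 : 0 <= c^-1 by rewrite invr_ge0 ltW.
pose eps n := `|rho (S_ n) - rho S|.
apply: (@cvg_dom0 _ _ _ _ (fun n => 2 * (eps n * (c^-1 + eps n) * `|V|))) => [|n].
  have e0 : eps n @[n --> \oo] --> (0 : R) by exact: h.
  have hh : eps n * (c^-1 + eps n) * `|V| @[n --> \oo] --> 0 * (c^-1 + 0) * `|V|.
    by apply: cvgMl; apply: cvgM => //; apply: cvgD => //; exact: cvg_cst.
  rewrite !mul0r in hh; rewrite -(mulr0 2); exact: cvgMr.
have D : opb (res (S_ n) \- res S) (eps n).
  move=> x; have := hs_opb (rho (S_ n) - rho S) x; rewrite SymHSB.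
  by rewrite -[(_ \- _) x]/(res (S_ n) x - res S x) !resE// opprD addrACA subrr add0r.
have en0 : 0 <= eps n by exact: normr_ge0.
apply: hs_conj_dist => //.
- exact: res_Sym.
- exact: res_Sym.
- move=> x; rewrite -[res (S_ n) x](subrK (res S x)) addrC.
  by apply: le_trans (ler_normD _ _) _; rewrite mulrDl; apply: lerD; [exact: Rb|exact: D].
- by move=> x; apply: le_trans (Rb x) _; apply: ler_wpM2r => //; rewrite lerDl.
- by rewrite addr_ge0.
Qed.

End hs_conj_dist.

Section L2_polarization.
Context d (T : measurableType d) (R : realType) (P : probability T R).
Local Notation cl := (L2_class P).

Lemma L2_polar (u v : LspaceType2 P) : 4 * L2_inner u v = `|u + v| ^+ 2 - `|u - v| ^+ 2.
Proof.
set f := Lspace_fun u; set g := Lspace_fun v.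
have f2 : f \in Lfun P 2%:E by exact: Lspace_funP.
have g2 : g \in Lfun P 2%:E by exact: Lspace_funP.
have -> : u + v = cl (fun x => 1 * f x + g x).
  by rewrite L2_class_lin// !L2_classK scale1r.
have -> : u - v = cl (fun x => f x - g x) by rewrite L2_class_B// !L2_classK.
rewrite !L2_class_norm//; [|exact: L2_B|exact: L2_lin].
have Ip := L2_sqr_integrable (L2_lin 1 f2 g2); have Im := L2_sqr_integrable (L2_B f2 g2).
rewrite -RintegralB//.
rewrite -(@RintegralZl _ _ _ P setT _ 4 _ (L2_mul_integrable f2 g2))//.
by apply: eq_Rintegral => x _; rewrite -/(f x) -/(g x); ring.
Qed.

End L2_polarization.

(** * Norm, inner product and continuity of the score *)

Section score_properties.
Context (R : realType) (H : sepHilbertType R) (C0 : H -> H).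
Hypothesis PC0 : SymP H C0.
Hypothesis C0_ker : forall x, C0 x = 0 -> x = 0.
Variables (mu0 : probability (borel H) R) (mu : SymHS H -> probability (borel H) R).
Hypothesis g0 : gaussian C0 mu0.
Hypothesis gmu : forall S, SymHS_ltI S -> gaussian (cov C0 S) (mu S).
Variable Sstar : SymHS H.
Hypothesis Sstar_lt : SymHS_ltI Sstar.
Implicit Types (S T A V W : SymHS H).
Local Notation G := (gfield C0).
Local Notation Q := (sqrt_op C0).
Local Notation P := (mu Sstar).
Local Notation cl := (L2_class P).
Local Notation aff := (affine_field C0).
Local Notation score := (score C0 mu Sstar).

Lemma score_affine S V : score S V =
  cl (aff (- 2^-1 * hs_ip S (hs_conj (res S) V)) (hs_conj (res S) V)).
Proof.
rewrite (affine_class PC0 C0_ker gmu Sstar_lt) /score scalerDr scalerA.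
exact: addrC.
Qed.

(** The constant in [score_affine] centers the score under [P], so its squared norm is a quarter of
    the variance of [G A]. With [A = R V R], [hs_conj_sqrt_res] turns [B A B] into the conjugate of
    [V] by the inverse square root. *)
Lemma score_norm V : `|score Sstar V| ^+ 2 =
  2^-1 * `|hs_conj (inv_op (sqrt_op (idfun \- Sstar))) V| ^+ 2.
Proof.
rewrite score_affine -(hs_conj_sqrt_res Sstar_lt).
generalize (hs_conj (res Sstar) V) => A; set s := hs_ip Sstar A.
have G2 : G A \in Lfun P 2%:E := gfield_L2 PC0 C0_ker Sstar_lt (gmu Sstar_lt) A.
rewrite L2_class_norm; last exact: affine_L2.
have -> : \int[P]_x (aff (- 2^-1 * s) A x * aff (- 2^-1 * s) A x) =
    \int[P]_x (4^-1 * (G A x * G A x) + (2^-1 * s * G A x + 4^-1 * s ^+ 2)).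
  by apply: eq_Rintegral => x _; rewrite /affine_field; generalize (G A x) => g; field.
have I1 := L2_mul_integrable G2 G2; have I2 := L2_integrable G2.
have I3 := L2_integrable (L2_cst P (4^-1 * s ^+ 2)).
rewrite (Rintegral_lin _ I1 (integrable_lin _ I2 I3)) (Rintegral_lin _ I2 I3).
rewrite (prob_Rintegral_cst P) (gfield_mean PC0 C0_ker Sstar_lt (gmu Sstar_lt)).
rewrite -(L2_class_norm G2) (gfield_norm PC0 C0_ker Sstar_lt (gmu Sstar_lt)) -/s.
by generalize (`|hs_conj (sqrt_op (idfun \- Sstar)) A| ^+ 2) => t; field.
Qed.

(** Polarization of [score_norm]; the two factors [X] around [V] are then moved onto [W], where they
    complete [X W X] to [R W R]. *)
Lemma score_inner V W : L2_inner (score Sstar V) (score Sstar W) =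
  2^-1 * hs_ip V (hs_conj (res Sstar) W).
Proof.
pose X := inv_op (sqrt_op (idfun \- Sstar)); have SX : Sym H X by exact: invsqrt_Sym.
have lS := score_linear PC0 C0_ker gmu Sstar_lt Sstar_lt.
have h := L2_polar (score Sstar V) (score Sstar W).
have hD : score Sstar V + score Sstar W = score Sstar (V + W) by exact: esym (linD lS V W).
have hB : score Sstar V - score Sstar W = score Sstar (V - W) by exact: esym (linB lS V W).
have nD : `|score Sstar (V + W)| ^+ 2 = 2^-1 * `|hs_conj X V + hs_conj X W| ^+ 2.
  exact: etrans (score_norm _) (congr1 (fun A => 2^-1 * `|A| ^+ 2) (linD (hs_conj_lin SX) V W)).
have nB : `|score Sstar (V - W)| ^+ 2 = 2^-1 * `|hs_conj X V - hs_conj X W| ^+ 2.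
  exact: etrans (score_norm _) (congr1 (fun A => 2^-1 * `|A| ^+ 2) (linB (hs_conj_lin SX) V W)).
have {}h : 4 * L2_inner (score Sstar V) (score Sstar W) =
    2^-1 * `|hs_conj X V + hs_conj X W| ^+ 2 - 2^-1 * `|hs_conj X V - hs_conj X W| ^+ 2.
  apply: (etrans h); apply: (congr2 (fun a b : R => a - b)).
    exact: etrans (congr1 (fun u => `|u| ^+ 2) hD) nD.
  exact: etrans (congr1 (fun u => `|u| ^+ 2) hB) nB.
have e1 : hs_ip V (hs_conj (res Sstar) W) = hs_ip (hs_conj X V) (hs_conj X W).
  rewrite (hs_ip_conj V (hs_conj X W) SX); apply: (congr1 (hs_ip V)).
  exact: esym (hs_conj_invsqrt Sstar_lt W).
apply: (etrans _ (congr1 (fun t => 2^-1 * t) (esym e1))); rewrite /hs_ip.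
move: h; generalize (`|hs_conj X V + hs_conj X W| ^+ 2) (`|hs_conj X V - hs_conj X W| ^+ 2).
move=> a b h; apply: (mulfI (_ : 4 != 0)); first by rewrite pnatr_eq0.
by apply: etrans h _; field.
Qed.

(** The product is not self-adjoint, so its diagonal is read as [inner (W e) (R V R e)] on basis
    vectors. *)
Lemma trace_res V W : trace (res Sstar \o V \o res Sstar \o W) = hs_ip V (hs_conj (res Sstar) W).
Proof.
have SR := res_Sym Sstar_lt.
rewrite hs_ipC (hs_ip_conj _ _ SR) hs_ipC; apply/cvg_lim => //.
have := hs_ip_series (hs_conj (res Sstar) V) W (@onbP _ H).
rewrite (_ : (fun k => inner _ _) = fun k => inner ((res Sstar \o V \o res Sstar \o W) (onb H k)) (onb H k))//.
by apply/funext => k; rewrite SymHS_sa innerC hs_conjE.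
Qed.

Lemma score_cvg V (V_ : nat -> SymHS H) : `|V_ j - V| @[j --> \oo] --> (0 : R) ->
  score Sstar (V_ j) @[j --> \oo] --> score Sstar V.
Proof.
move=> VV; have [M M0 hM] := score_bound PC0 C0_ker gmu Sstar_lt Sstar_lt.
have lS := score_linear PC0 C0_ker gmu Sstar_lt Sstar_lt.
apply: (@cvg_dom0 _ _ _ _ (fun n => M * `|V_ n - V|)) => [|n].
  by rewrite -(mulr0 M); exact: cvgMr.
have <- : score Sstar (V_ n - V) = score Sstar (V_ n) - score Sstar V by exact: linB lS _ _.
exact: hM.
Qed.

Lemma score_cvg_base (S_ : nat -> SymHS H) V : (forall n, SymHS_ltI (S_ n)) ->
  `|S_ k - Sstar| @[k --> \oo] --> (0 : R) ->
  score (S_ k) V @[k --> \oo] --> score Sstar V.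
Proof.
move=> SS_ h.
have Sc : S_ @ \oo --> Sstar by apply: (cvg_dom0 h).
have hA := hs_conj_res_cvg (V := V) SS_ Sstar_lt Sc.
have hs := cvg_hs_ip Sc hA.
have [K K0 hK] := gfield_dist PC0 C0_ker Sstar_lt (gmu Sstar_lt).
have hG : cl (G (hs_conj (res (S_ n)) V)) @[n --> \oo] --> cl (G (hs_conj (res Sstar) V)).
  apply: (@cvg_dom0 _ _ _ _ (fun n => K * `|hs_conj (res (S_ n)) V - hs_conj (res Sstar) V|)) => [|n].
    by rewrite -(mulr0 K); apply: cvgMr; exact: cvg_dist0.
  by rewrite -(gfield_classB PC0 C0_ker Sstar_lt (gmu Sstar_lt)); exact: hK.
apply: cvgZl_tmp; apply: cvgD => //.
by apply: cvgZr_tmp.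
Qed.

End score_properties.

(** * The trace formula in the eigenbasis of the covariance *)

Section trace_class_score.
Context (R : realType) (H : sepHilbertType R) (C0 : H -> H).
Hypothesis PC0 : SymP H C0.
Hypothesis C0_ker : forall x, C0 x = 0 -> x = 0.
Variables (mu0 : probability (borel H) R) (mu : SymHS H -> probability (borel H) R).
Hypothesis g0 : gaussian C0 mu0.
Hypothesis gmu : forall S, SymHS_ltI S -> gaussian (cov C0 S) (mu S).
Variable Sstar : SymHS H.
Hypothesis Sstar_lt : SymHS_ltI Sstar.
Variables (V : SymHS H) (V_tr : Tr H V) (e : nat -> H) (lambda : nat -> R).
Hypotheses (oe : is_onb e) (C0e : forall k, C0 (e k) = lambda k *: e k).
Local Notation G := (gfield C0).
Local Notation Q := (sqrt_op C0).
Local Notation P := (mu Sstar).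
Local Notation cl0 := (L2_class mu0).
Local Notation inv := (res Sstar).
Let PQ : SymP H Q := sqrt_op_SymP PC0.
Let SQ : Sym H Q. Proof. by case: PQ. Qed.
Let lQ := Sym_lin SQ.
Let SR : Sym H inv := res_Sym Sstar_lt.
Let A := hs_conj inv V.
Let s k := Num.sqrt (lambda k).

Let e_neq0 k : e k != 0.
Proof.
by apply/eqP => ek; have := oe.1 k k; rewrite ek inner0l eqxx => /esym/eqP; rewrite oner_eq0.
Qed.

Let lambda_gt0 k : 0 < lambda k.
Proof.
have E : lambda k = inner (C0 (e k)) (e k) by rewrite C0e innerZl oe.1 eqxx mulr1.
rewrite lt_neqAle; apply/andP; split; last by rewrite E; case: PC0 => _; apply.
apply: contraNneq (e_neq0 k) => l0; apply/eqP; apply: C0_ker.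
by rewrite C0e -l0 scale0r.
Qed.

Let s_gt0 k : 0 < s k. Proof. by rewrite sqrtr_gt0. Qed.

(** [C0 - lambda = (Q + s) (Q - s)], and [Q + s] is injective because [Q] is positive and
    [s > 0]. *)
Let Qe k : Q (e k) = s k *: e k.
Proof.
apply/eqP; rewrite -subr_eq0; apply/eqP; set z := _ - _.
have Qz : Q z = - (s k *: z).
  rewrite /z (linB lQ) (linZ lQ) (sqrt_opP PC0).2 C0e.
  rewrite -[lambda k]sqr_sqrtr ?(ltW (lambda_gt0 k))// -/(s k) scalerBr opprB addrC scalerA expr2.
  by rewrite addrC.
have h : inner (Q z) z + s k * inner z z = 0.
  by rewrite Qz innerNl innerZl addNr.
apply: inner_eq0; apply/eqP; have := s_gt0 k; have Q0 : 0 <= inner (Q z) z by case: PQ => _; apply.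
have z0 := inner_ge0 z => sk.
have : s k * inner z z = 0.
  apply/eqP; rewrite eq_le mulr_ge0 ?(ltW sk)// andbT.
  by move: h; move: (inner (Q z) z) (s k * _) Q0 => a b ? ?; lra.
by move=> /eqP; rewrite mulf_eq0 gt_eqF.
Qed.

Let y k := (s k)^-1 *: e k.

Let Qy k : Q (y k) = e k.
Proof. by rewrite /y (linZ lQ) Qe scalerA mulVf ?scale1r// gt_eqF. Qed.

(** [inv_op Q] picks a preimage, which injectivity determines on the range of [Q]; the projections
    [onproj e N x] lie in this range. *)
Let invQ x z : Q z = x -> inv_op Q x = z.
Proof.
move=> Qz; have : Q (inv_op Q x) = x by apply: (@getPex _ [set z | Q z = x]); exists z.
rewrite -Qz => E; apply/eqP; rewrite -subr_eq0; apply/eqP.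
by apply: (sqrt_op_ker PC0 C0_ker); rewrite (linB lQ) E subrr.
Qed.

Let onprojE N x : onproj e N x = \sum_(0 <= k < N) inner x (e k) *: e k.
Proof.
rewrite /onproj fct_sumE big_mkord; apply: eq_bigr => k _.
by rewrite /tensor innerC.
Qed.

Let z N (x : H) := \sum_(0 <= k < N) inner x (e k) *: y k.

Let invQ_onproj N x : inv_op Q (onproj e N x) = z N x.
Proof.
apply: invQ; rewrite /z (lin_sum lQ) onprojE; apply: eq_bigr => k _.
by rewrite (linZ lQ) Qy.
Qed.

Let f N (x : borel H) : R := inner (inv_op Q (onproj e N x)) (inv (V (inv (inv_op Q (onproj e N x))))).

Let a j k := inner (A (e j)) (e k).
Let l N := polar_list a y N.
Let tN N := series (fun k => a k k) N.

(** The quadratic form is not centered: its mean under [mu0] is the partial trace [tN N] of [R V R],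
    which has to converge separately. *)
Let fE N x : f N x = gform C0 (l N) x + tN N.
Proof.
have -> : gform C0 (l N) x =
    \sum_(0 <= j < N) \sum_(0 <= k < N) a j k * (inner x (y j) * inner x (y k) - inner (e j) (e k)).
  rewrite /gform /l (@lsum_polar_bilin _ _ _ (fun u v => inner (x : H) u * inner (x : H) v - inner (Q u) (Q v))).
    by apply: eq_bigr => j _; apply: eq_bigr => k _; rewrite !Qy.
  move=> u v; rewrite -!inner_norm (linB lQ) (linD lQ).
  by rewrite !(innerDl, innerDr, innerNl, innerNr) (innerC (Q v)); ring.
have -> : tN N = \sum_(0 <= j < N) \sum_(0 <= k < N) a j k * inner (e j) (e k).
  rewrite /tN /series /=; apply: eq_big_nat => j /andP[_ jN].
  rewrite (bigD1_seq j) ?mem_index_iota ?iota_uniq//= oe.1 eqxx mulr1 big1 ?addr0// => k kj.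
  by rewrite oe.1 eq_sym (negbTE kj) mulr0.
rewrite -big_split /= /f invQ_onproj -(hs_conjE V _ SR) -/A /z inner_suml_ord.
apply: eq_bigr => j _; rewrite -big_split /= (lin_sum (SymHS_lin A)) inner_sumr_ord.
apply: eq_bigr => k _; rewrite (linZ (SymHS_lin A)) /y (linZ (SymHS_lin A)) !innerZl !innerZr.
by rewrite -[inner (e j) (A (e k))]SymHS_sa -/(a j k); ring.
Qed.

Let form_trunc N : form_op Q (l N) = trunc e A N.
Proof.
rewrite /form_op /trunc /form_op !lsum_polar; apply: eq_bigr => j _; apply: eq_bigr => k _.
by rewrite (linB lQ) (linD lQ) !Qy.
Qed.

(** [R = I + rho]: the first part is the trace of [V], the second a Hilbert-Schmidt inner
    product. *)
Let resV_cvg (r : R) : (forall e', is_onb e' -> series (fun k => inner (V (e' k)) (e' k)) @ \oo --> r) ->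
  forall e', is_onb e' ->
  series (fun k => inner (V (e' k)) (inv (e' k))) @ \oo --> r + hs_ip V (rho Sstar).
Proof.
move=> hr e' oe'.
rewrite (_ : series _ = fun n => series (fun k => inner (V (e' k)) (e' k)) n +
    series (fun k => inner (V (e' k)) (rho Sstar (e' k))) n).
  by apply: cvgD; [exact: hr|exact: hs_ip_series].
apply/funext => n; rewrite /series /= -big_split; apply: eq_bigr => k _ /=.
by rewrite (resE _ Sstar_lt) innerDr.
Qed.

(** [A = S A + (I - S) A] with [(I - S) A = V R], so the diagonal of [A] splits into that of a
    Hilbert-Schmidt inner product and the series of [resV_cvg]. *)
Let tN_cvg (r : R) : (forall e', is_onb e' -> series (fun k => inner (V (e' k)) (e' k)) @ \oo --> r) ->
  tN @ \oo --> hs_ip Sstar A + (r + hs_ip V (rho Sstar)).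
Proof.
move=> hr.
rewrite (_ : tN = fun n => series (fun k => inner (Sstar (e k)) (A (e k))) n +
    series (fun k => inner (V (e k)) (inv (e k))) n).
  by apply: cvgD; [exact: hs_ip_series|exact: resV_cvg].
apply/funext => n; rewrite /tN /series /= -big_split; apply: eq_bigr => k _ /=.
rewrite /a innerC !SymHS_sa -[in LHS](subrK (Sstar (A (e k))) (A (e k))) innerDr addrC.
by congr (_ + _); rewrite {1 2}/A !hs_conjE// resK.
Qed.

Let trace_cvg (r : R) : (forall e', is_onb e' -> series (fun k => inner (V (e' k)) (e' k)) @ \oo --> r) ->
  trace (inv \o V) = r + hs_ip V (rho Sstar).
Proof.
move=> hr; apply/cvg_lim => //; have := resV_cvg hr (@onbP _ H).
rewrite (_ : (fun k => inner _ _) = fun k => inner ((inv \o V) (onb H k)) (onb H k))//.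
by apply/funext => k; rewrite /= (Sym_sa SR).
Qed.

Lemma score_trace_class : exists2 q : LspaceType2 mu0,
  L2_cvg (fun N (x : borel H) => inner (inv_op Q (onproj e N x))
    (inv (V (inv (inv_op Q (onproj e N x)))))) q &
  Lspace_fun (score C0 mu Sstar Sstar V) =
    (fun x : H => 2^-1 * trace (inv \o V) - 2^-1 * Lspace_fun q x) %[ae P].
Proof.
have [r hr] := trace_basis V_tr (SymHS_Sym V).
(* The limit of [tN]. Its part [hs_ip Sstar A] cancels against the constant of [score_affine], and
   the rest is [trace (inv \o V)]. *)
pose t := hs_ip Sstar A + (r + hs_ip V (rho Sstar)).
have g00 := gaussian0 PC0 g0; have lt0 := @ltI0 R H.
have G02 : G A \in Lfun mu0 2%:E by exact: (gfield_L2 PC0 C0_ker lt0 g00).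
have gf2 N : gform C0 (l N) \in Lfun mu0 2%:E by exact: (gform_L2 PC0 C0_ker lt0 g00).
have fE' N : f N = fun x => 1 * gform C0 (l N) x + (tN N * cst 1 x + cst 0 x).
  by apply/funext => x; rewrite fE mul1r mulr1 addr0.
have c2 k : (fun x : borel H => k * cst 1 x + cst 0 x) \in Lfun mu0 2%:E.
  by apply: L2_lin; exact: L2_cst.
have clE (g : borel H -> R) k : g \in Lfun mu0 2%:E ->
    cl0 (fun x => 1 * g x + (k * cst 1 x + cst 0 x)) = cl0 g + k *: cl0 (cst 1).
  move=> g2; apply: (etrans (L2_class_lin 1 g2 (c2 k))); rewrite scale1r; congr (_ + _).
  apply: (etrans (L2_class_lin k (L2_cst mu0 1) (L2_cst mu0 0))).
  by rewrite [L2_class _ (cst 0)]L2_class0; exact: addr0.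
pose q := cl0 (fun x => 1 * G A x + (t * cst 1 x + cst 0 x)).
have q2 : (fun x => 1 * G A x + (t * cst 1 x + cst 0 x)) \in Lfun mu0 2%:E by exact: L2_lin.
exists q.
  split=> [N|]; first by rewrite -/(f N) fE'; exact: L2_lin.
  rewrite (_ : (fun n => _) = fun n => cl0 (gform C0 (l n)) + tN n *: cl0 (cst 1)); last first.
    by apply/funext => n; rewrite -/(f n) fE' clE.
  rewrite /q (clE _ _ G02); apply: cvgD.
    apply: (gfield_cvg PC0 C0_ker lt0 g00).
    rewrite (_ : (fun n => _) = trunc e A); first exact: trunc_cvg.
    by apply/funext => n; exact: form_trunc.
  by apply: cvgZr_tmp; exact: tN_cvg.
have dom : P `<< mu0.
  have [c rc] := related_ex PC0 C0_ker gmu lt0 Sstar_lt.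
  exact: tilt_dominates (related0_tilt PC0 C0_ker g0 gmu Sstar_lt rc).
have qE := null_dominates_ae_eq measurableT dom (to_LspaceE (lee1n 2) q2).
have aE := to_LspaceE (lee1n 2) (affine_L2 PC0 C0_ker gmu (- 2^-1 * hs_ip Sstar A) A Sstar_lt).
rewrite (score_affine PC0 C0_ker gmu Sstar_lt) -/A.
apply: filterS (filterI qE aE) => x [/(_ I) h1 /(_ I) h2] _.
apply: (etrans h2); rewrite (trace_cvg hr) [Lspace_fun q x]h1 /t /affine_field mul1r mulr1 addr0.
by generalize (G A x) (hs_ip Sstar A) (hs_ip V (rho Sstar)) => g u v; field.
Qed.

End trace_class_score.

Theorem theorem2 (R : realType) (H : sepHilbertType R) (C0 : H -> H)
    (C0_pos : SymP H C0) (C0_tr : Tr H C0)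
    (C0_ker : forall x, C0 x = 0 -> x = 0)
    (mu0 : probability (borel H) R) (mu0_gaussian : gaussian C0 mu0)
    (mu : SymHS H -> probability (borel H) R)
    (mu_gaussian : forall S, SymHS_ltI S -> gaussian (cov C0 S) (mu S))
    (Sstar : SymHS H) (Sstar_lt : SymHS_ltI Sstar) :
  let mustar := mu Sstar in
  let logdens : SymHS H -> LspaceType2 mustar :=
    fun S => L2_class mustar (log_density (mu S) mu0) in
  let D (S V : SymHS H) : LspaceType2 mustar := 'd logdens S V in
  let inv : H -> H := inv_op (idfun \- Sstar) in
  let invsqrt : H -> H := inv_op (sqrt_op (idfun \- Sstar)) in
  let C0invsqrt : H -> H := inv_op (sqrt_op C0) in
  (forall S, SymHS_ltI S ->
    [/\ mu S `<< mu0, mu0 `<< mu S,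
        log_density (mu S) mu0 \in Lfun mustar 2%:E &
        differentiable logdens S]) /\
  (SymTr_ltI Sstar -> forall V : SymHS H, Tr H V ->
    forall (e : nat -> H) (lambda : nat -> R),
    is_onb e -> (forall k, C0 (e k) = lambda k *: e k) ->
    exists2 q : LspaceType2 mu0,
      L2_cvg (fun N (x : borel H) => inner (C0invsqrt (onproj e N x))
        (inv (V (inv (C0invsqrt (onproj e N x)))))) q &
      Lspace_fun (D Sstar V) = (fun x : H =>
        2^-1 * trace (inv \o V) - 2^-1 * Lspace_fun q x) %[ae mustar]) /\
  (forall S_ : nat -> SymHS H,
    (forall k, SymTr_ltI (S_ k)) ->
    `|S_ k - Sstar| @[k --> \oo] --> (0 : R) ->
    forall V : SymHS H, Tr H V ->
    D (S_ k) V @[k --> \oo] --> D Sstar V) /\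
  (forall (V : SymHS H) (V_ : nat -> SymHS H),
    (forall j, Tr H (V_ j)) ->
    `|V_ j - V| @[j --> \oo] --> (0 : R) ->
    D Sstar (V_ j) @[j --> \oo] --> D Sstar V) /\
  (forall V : SymHS H,
    `|D Sstar V| ^+ 2 = 2^-1 * hs_norm (invsqrt \o V \o invsqrt) ^+ 2) /\
  (forall V W : SymHS H,
    L2_inner (D Sstar V) (D Sstar W) = 2^-1 * trace (inv \o V \o inv \o W)).
Proof.
move=> mustar logdens D inv invsqrt C0invsqrt.
have ld S : SymHS_ltI S -> differentiable logdens S /\ forall V, D S V = score C0 mu Sstar S V.
  exact: (logdens_diff C0_pos C0_ker mu0_gaussian mu_gaussian Sstar_lt).
have DE := (ld _ Sstar_lt).2.
split; [|split; [|split; [|split; [|split]]]].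
- move=> S SS; have [c r] := related_ex C0_pos C0_ker mu_gaussian (@ltI0 R H) SS.
  have t := related0_tilt C0_pos C0_ker mu0_gaussian mu_gaussian SS r.
  split; [exact: tilt_dominates t|exact: tilt_dominatesr t| |exact: (ld S SS).1].
  exact: (log_density_L2 C0_pos C0_ker mu0_gaussian mu_gaussian Sstar_lt SS).
- move=> _ V V_tr e lambda oe C0e; rewrite DE.
  exact: (score_trace_class C0_pos C0_ker mu0_gaussian mu_gaussian Sstar_lt V_tr oe C0e).
- move=> S_ S_lt S_cvg V _; rewrite DE.
  rewrite (_ : (fun k => D (S_ k) V) = fun k => score C0 mu Sstar (S_ k) V).
    by apply: (score_cvg_base C0_pos C0_ker mu_gaussian Sstar_lt) => // k; case: (S_lt k).
  by apply/funext => k; exact: (ld _ (S_lt k).1).2.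
- move=> V V_ _ V_cvg; rewrite DE.
  rewrite (_ : (fun j => D Sstar (V_ j)) = fun j => score C0 mu Sstar Sstar (V_ j)).
    exact: (score_cvg C0_pos C0_ker mu_gaussian Sstar_lt).
  by apply/funext => j; exact: DE.
- move=> V; rewrite DE (score_norm C0_pos C0_ker mu_gaussian Sstar_lt); congr (_ * _ ^+ 2).
  by rewrite SymHS_normE; congr hs_norm; exact: (mkHSE (hs_conj_symhs V (invsqrt_Sym Sstar_lt))).
- move=> V W; rewrite !DE (score_inner C0_pos C0_ker mu_gaussian Sstar_lt).
  by rewrite -(trace_res Sstar_lt).
Qed.
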